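(* Let $k_1\neq k_2$ in $\{1,\dots,K\}$, $1\le l_1\le L_{k_1}$, and assume $X(0)=(k_1,l_1)$. Let $\omega\in[0,\infty)$ and let $t(\nu)\ge 0$ satisfy $\lim_{\nu\to\infty} t(\nu)/\mathbb{E}\,T_{(k_1,l_1),(k_2,1)}(\nu)=\omega$. Then $$\lim_{\nu\to\infty}\mathbb{P}\big(\tau_{k_2}(t(\nu))=0\big)\ge \mathbb{P}(Z\ge\omega).$$ In particular, if $t(\nu)=o\big(\mathbb{E}\,T_{(k_1,l_1),(k_2,1)}(\nu)\big)$ as $\nu\to\infty$, then $\lim_{\nu\to\infty}\mathbb{P}\big(\tau_{k_2}(t(\nu))=0\big)=1$.
   Context: Let $K, L_1,\dots,L_K$ be positive integers and let $f_1,\dots,f_K:\mathbb{R}_+\to\mathbb{R}_+$ be monotone functions with $\lim_{\nu\to\infty} f_k(\nu)=\infty$ for every $k$. Put $\mathcal{B}_k=\{(k,l):1\le l\le L_k\}$ and $\Omega=\{0\}\cup\bigcup_{k=1}^K\mathcal{B}_k$. For each $\nu$, $\{X(t)\}_{t\ge 0}$ is the continuous-time Markov process on $\Omega$ with transition rates $q(0,(k,1))=L_k f_k(\nu)$, $q((k,1),0)=1$, $q((k,l),(k,l+1))=(L_k-l)f_k(\nu)$ for $1\le l\le L_k-1$, $q((k,l),(k,l-1))=l$ for $2\le l\le L_k$ (for $k=1,\dots,K$), all other off-diagonal rates being $0$. For states $a,b\in\Omega$, the transition time is $T_{a,b}(\nu)=\inf\{t>0: X(t)=b\}$ for the process started at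 $X(0)=a$. The throughput of component $k$ over $[0,t]$ is $\tau_k(t)=\int_0^t I_{\{X(s)\in\mathcal{B}_k\}}\,ds$. For fixed $k_1\ne k_2$, the following limits are assumed to exist: - for $k\ne k_2$, $\gamma_k=\lim_{\nu\to\infty}\frac{f_k(\nu)^{L_k}}{\sum_{j\ne k_2} f_j(\nu)^{L_j}}\in[0,1]$; put $K_*=\{k\ne k_2:\gamma_k>0\}$; - for $k\in K_*$, $\beta_k=\lim_{\nu\to\infty}\frac{L_k f_k(\nu)}{L_{k_2}f_{k_2}(\nu)}\in[0,\infty]$; - $\alpha=\lim_{\nu\to\infty}\frac{\mathbb{E}\,T_{(k_1,l_1),0}(\nu)}{\mathbb{E}\,T_{(k_1,l_1),(k_2,1)}(\nu)}\in[0,1]$. Put $\mathcal{A}=\{k\in K_*:0<\beta_k<\infty\}$, $\mathcal{S}=\{k\in K_*:\beta_k=\infty\}$ and $\gamma_{\mathcal{S}}=\sum_{k\in\mathcal{S}}\gamma_k$ (empty sums are $0$). The random variable $Z$ is $Z=\alpha Y+(1-\alpha)W$ in distribution, where $Y$ is exponential with unit mean and $W$ is independent of $Y$ with Laplace transform $\mathbb{E}(e^{-sW})=\Big(1+\sum_{k\in\mathcal{A}}\frac{\gamma_k s}{1+\gamma_k s/\beta_k}+s\gamma_{\mathcal{S}}\Big)^{-1}$; it is the limit in distribution of $T_{(k_1,l_1),(k_2,1)}(\nu)/\mathbb{E}\,T_{(k_1,l_1),(k_2,1)}(\nu)$ as $\nu\to\infty$.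
   Formalization: For ω = 0, and hence in the ''in particular'' claim with t(ν) = o(E T), it is additionally assumed that P(Z = 0) = 0; without this the claim fails (e.g. K=3, L=(1,1,2), all f_k = ν, k_1=1, k_2=2, t = √ν). *)

(* Defs.v *)
From HB Require Import structures.
From mathcomp Require Import all_boot all_order all_algebra.
From mathcomp Require Import all_classical all_reals all_analysis.

Set Implicit Arguments.
Unset Strict Implicit.
Unset Printing Implicit Defensive.

Import Order.TTheory GRing.Theory Num.Theory.
Import numFieldNormedType.Exports.

Local Open Scope classical_set_scope.
Local Open Scope ring_scope.

(* [None] is the state 0; the state (k, l) with 1 <= l <= L k is encoded with
   the ordinal of value l - 1. *)
Definition state (K : nat) (L : 'I_K -> nat) : finType :=
  option {k : 'I_K & 'I_(L k)}.

Definition active (K : nat) (L : 'I_K -> nat) (k : 'I_K) (l : 'I_(L k)) :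
  state L := Some (Tagged (fun k => 'I_(L k)) l).

Definition in_component (K : nat) (L : 'I_K -> nat) (k : 'I_K) (x : state L) :
  bool := if x is Some u then tag u == k else false.

Definition level (K : nat) (L : 'I_K -> nat) (u : {k : 'I_K & 'I_(L k)}) :
  nat := (tagged u).+1.

(* Off-diagonal transition rates; g k stands for f_k(nu). *)
Definition rate (R : realType) (K : nat) (L : 'I_K -> nat) (g : 'I_K -> R)
    (a b : state L) : R :=
  match a, b with
  | None, Some v => if level v == 1%N then (L (tag v))%:R * g (tag v) else 0
  | Some u, None => if level u == 1%N then 1 else 0
  | Some u, Some v =>
      if tag u != tag v then 0
      else if level v == (level u).+1 then
        (L (tag u) - level u)%:R * g (tag u)
      else if level u == (level v).+1 then (level u)%:R
      else 0
  | None, None => 0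
  end.

Section continuous_time_markov_process.
Context (R : realType) (S : finType).

Definition generator (q : S -> S -> R) (a b : S) : R :=
  if a == b then - \sum_(c | c != a) q a c else q a b.

Definition transition_function (q : S -> S -> R) (p : R -> S -> S -> R) :
    Prop :=
  [/\ forall t a b, 0 <= t -> 0 <= p t a b,
      forall t a, 0 <= t -> \sum_b p t a b = 1,
      forall a b, p 0 a b = (a == b)%:R,
      forall s t a b, 0 <= s -> 0 <= t ->
        p (s + t) a b = \sum_c p s a c * p t c b
    & forall a b,
        (p h a b - (a == b)%:R) / h @[h --> 0^'+] --> generator q a b].

(* The Markov property is stated without conditional probabilities:
   P(X(u_0) = x_0, ..., X(u_(n+1)) = x_(n+1))
     = P(X(u_0) = x_0, ..., X(u_n) = x_n) p_(u_(n+1) - u_n)(x_n, x_(n+1)). *)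
Definition markov_process (d : measure_display) (T : measurableType d)
    (P : probability T R) (q : S -> S -> R) (X : R -> T -> S) : Prop :=
  [/\ forall t a, 0 <= t -> measurable [set w | X t w = a],
      forall w t, 0 <= t -> \forall s \near t^'+, X s w = X t w
    & exists2 p : R -> S -> S -> R, transition_function q p &
      forall (n : nat) (u : nat -> R) (x : nat -> S),
        0 <= u 0%N -> {homo u : i j / (i <= j)%N >-> i <= j} ->
        P [set w | forall i, (i <= n.+1)%N -> X (u i) w = x i] =
        (P [set w | forall i, (i <= n)%N -> X (u i) w = x i] *
         (p (u n.+1 - u n) (x n) (x n.+1))%:E)%E].

Definition transition_time (d : measure_display) (T : measurableType d)
    (X : R -> T -> S) (b : S) (w : T) : \bar R :=
  ereal_inf [set t%:E | t in [set t : R | 0 < t /\ X t w = b]].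

(* E T_(a,b), where a is the state in which X starts under P. *)
Definition mean_transition_time (d : measure_display) (T : measurableType d)
    (P : probability T R) (X : R -> T -> S) (b : S) : \bar R :=
  (\int[P]_w transition_time X b w)%E.

End continuous_time_markov_process.

Definition throughput (R : realType) (K : nat) (L : 'I_K -> nat)
    (d : measure_display) (T : measurableType d) (X : R -> T -> state L)
    (k : 'I_K) (t : R) (w : T) : \bar R :=
  (\int[lebesgue_measure]_(s in `[0%R, t]) (in_component k (X s w))%:R%:E)%E.

Definition independent_RV (R : realType) (d : measure_display)
    (T : measurableType d) (P : probability T R) (Y W : {RV P >-> R}) : Prop :=
  forall A B : set R, measurable A -> measurable B ->
    P (Y @^-1` A `&` W @^-1` B) = (P (Y @^-1` A) * P (W @^-1` B))%E.

(* The index sets A and S of the paper; both are included in K_*, that is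
   k <> k2 and gamma_k > 0. *)
Definition index_A (R : realType) (K : nat) (k2 : 'I_K) (gamma : 'I_K -> R)
    (beta : 'I_K -> \bar R) : {set 'I_K} :=
  [set k | [&& k != k2, 0 < gamma k & (0 < beta k < +oo)%E]]%SET.

Definition index_S (R : realType) (K : nat) (k2 : 'I_K) (gamma : 'I_K -> R)
    (beta : 'I_K -> \bar R) : {set 'I_K} :=
  [set k | [&& k != k2, 0 < gamma k & beta k == +oo%E]]%SET.

Definition laplace_W (R : realType) (K : nat) (k2 : 'I_K) (gamma : 'I_K -> R)
    (beta : 'I_K -> \bar R) (s : R) : R :=
  (1 + \sum_(k in index_A k2 gamma beta)
         gamma k * s / (1 + gamma k * s / fine (beta k))
     + s * \sum_(k in index_S k2 gamma beta) gamma k)^-1.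

(* Main.v *)
Require Import Defs.
From HB Require Import structures.
From mathcomp Require Import all_boot all_order all_algebra.
From mathcomp Require Import all_classical all_reals all_analysis.
From mathcomp Require Import measurable_realfun ring lra.

(** Let H be the hitting time of component k2 and M the mean of
    T_{(k1,l1),(k2,1)}. The event {tau_{k2}(t) = 0} is {t <= H}, that is
    {x <= exp(-t/M)} with x = exp(-H/M) in [0, 1].

    For sigma > 0, nonnegative functions g with (drift g) - sigma g <= -1 off
    component k2 bound 1 - E exp(-sigma H) from above by sigma g(start), and
    conversely; this is proved on the discrete skeletons X(i delta), delta -> 0.
    On the star there are explicit such g, exact if the excursion in branch k
    were exponential of mean r_k: taking for r_k the mean return time from level 1
    (resp. L_k) gives one inequality (resp. the other), and the ratio of the two
    tends to 1. Hence all the moments E x^n converge, to those of z = exp(-Z).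

    Convergence of moments gives P(x <= a) -> P(z <= a) at every a that is not an
    atom of z, because the polynomials (1 - x^n)^m approximate indicators of
    intervals. That z has no atom in (0, 1) follows from its moments alone: the
    integrals of the peaks (1 - (x - a)^2)^N tend to P(z = a), and the formula for
    the moments rewrites them as integrals of peaks smoothed by exponential
    variables, which tend to 0. *)

Set Implicit Arguments.
Unset Strict Implicit.
Unset Printing Implicit Defensive.

Import Order.TTheory GRing.Theory Num.Theory.
Import numFieldNormedType.Exports.

Local Open Scope classical_set_scope.
Local Open Scope ring_scope.

(** * Convergence of moments *)

(** The process is known only through its finite-dimensional laws and the right continuity of its
    paths, so neither the independent excursions from 0 nor the strong Markov property is at hand.
    Hitting times are therefore reached through functions on the finite state space, whose drift is
    computable; even the measurability of a hitting time comes from the skeletons.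

    The two choices of r_k are asymptotically equivalent because, at a large activation rate g, a
    branch sits mostly near its top level and returns to 0 are rare: the mean time from level 1 to 0
    is already that from the top up to a factor 1 + O(1/g).

    The n-th moment of x is the Laplace transform of H at n/M. In the limit it splits into 1/(1 +
    alpha n), due to the first return to 0, and [laplace_W] at (1 - alpha) n, due to the time spent
    afterwards.

    Z can have an atom at 0: for alpha = 0 and S empty, W vanishes with probability 1/(1 + sum of
    beta_k over A). Then z has an atom at 1; this is why omega = 0 comes with P(Z = 0) = 0. *)

Section bounded_expectation.
Context (R : realType) (d : measure_display) (T : measurableType d)
  (P : probability T R).
Implicit Types (f g x : T -> R) (p : {poly R}).

Lemma integrable_bounded (c : R) f :
  measurable_fun setT f -> (forall w, `|f w| <= c) ->
  P.-integrable setT (EFin \o f).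
Proof.
move=> mf fc; apply: measurable_bounded_integrable => //.
  by rewrite /= probability_setT ltry.
exists `|c|; split => // M cM w _.
by rewrite /= (le_trans (fc w))// (le_trans (ler_norm _))// ltW.
Qed.

Lemma cvg_Rintegral_bounded (f_ : (T -> R)^nat) f :
  (forall n, measurable_fun setT (f_ n)) -> (forall n w, `|f_ n w| <= 1) ->
  (forall w, f_ n w @[n --> \oo] --> f w) ->
  \int[P]_w f_ n w @[n --> \oo] --> \int[P]_w f w.
Proof.
move=> mf f1 ff; have mff : measurable_fun setT f.
  exact: (measurable_fun_cvg mf (fun w _ => ff w)).
have i1 : P.-integrable setT (cst 1%E).
  by apply: (@integrable_bounded 1 (cst 1)) => // w; rewrite normr1.
have mEf n : measurable_fun setT (EFin \o f_ n) by exact/measurable_EFinP.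
have mEff : measurable_fun setT (EFin \o f) by exact/measurable_EFinP.
have [] := @dominated_convergence _ T R P setT measurableT
    (fun n => EFin \o f_ n) (EFin \o f) (cst 1%E) mEf mEff _ i1.
- by apply: aeW => w _; apply: cvg_EFin; [exact: nearW|exact: ff].
- by apply: aeW => w n _; rewrite /= lee_fin.
- move=> int_f _ cvg_int; apply: fine_cvg; rewrite fineK //.
  exact: integrable_fin_num.
Qed.

Lemma Rintegral_indic (A : set T) : measurable A ->
  \int[P]_w \1_A w = fine (P A).
Proof. by move=> mA; rewrite /Rintegral integral_indic// setIT. Qed.

Lemma measurable_horner x p :
  measurable_fun setT x -> measurable_fun setT (fun w => p.[x w]).
Proof.
move=> mx; elim/poly_ind: p => [|p c IH].
  by rewrite (_ : (fun _ => _) = cst 0)//; apply/funext => w; rewrite horner0.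
rewrite (_ : (fun _ => _) = (fun w => p.[x w] * x w + c)); last first.
  by apply/funext => w; rewrite hornerMXaddC.
by apply: measurable_funD => //; apply: measurable_funM.
Qed.

Lemma Rintegral_1B f : measurable_fun setT f -> (forall w, `|f w| <= 1) ->
  \int[P]_w (1 - f w) = 1 - \int[P]_w f w.
Proof.
move=> mf f1; have int1 : P.-integrable setT (EFin \o (cst 1 : T -> R)).
  by apply: (@integrable_bounded 1) => // w; rewrite normr1.
rewrite (RintegralB measurableT int1 (integrable_bounded mf f1)).
have PT : fine (P setT) = 1 by rewrite probability_setT.
by rewrite Rintegral_cst// PT mulr1.
Qed.

Lemma Rintegral_lincomb n (a : nat -> R) (f : nat -> T -> R) :
  (forall i, measurable_fun setT (f i)) -> (forall i w, `|f i w| <= 1) ->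
  \int[P]_w (\sum_(i < n) a i * f i w) = \sum_(i < n) a i * \int[P]_w f i w.
Proof.
move=> mf f1.
have intf i : P.-integrable setT (EFin \o f i) by exact: integrable_bounded (f1 i).
suff [] : P.-integrable setT (EFin \o (fun w => \sum_(i < n) a i * f i w)) /\
    \int[P]_w (\sum_(i < n) a i * f i w) = \sum_(i < n) a i * \int[P]_w f i w by [].
elim: n => [|n [iIH IH]].
  split; last first.
    under eq_Rintegral do rewrite big_ord0.
    by rewrite big_ord0 Rintegral_cst// mul0r.
  rewrite (_ : _ \o _ = cst 0%E); first exact: integrable0.
  by apply/funext => w /=; rewrite big_ord0.
have iZ : P.-integrable setT (EFin \o (fun w => a n * f n w)).
  rewrite (_ : _ \o _ = (fun w => (a n)%:E * (f n w)%:E)%E); last first.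
    by apply/funext => w /=; rewrite EFinM.
  by apply: integrableZl => //; exact: intf.
have E : (fun w => \sum_(i < n.+1) a i * f i w) =
    (fun w => (\sum_(i < n) a i * f i w) + a n * f n w).
  by apply/funext => w; rewrite big_ord_recr.
rewrite E; split; first exact: (integrableD measurableT iIH iZ).
by rewrite RintegralD// IH RintegralZl// big_ord_recr.
Qed.

Lemma Rintegral_horner x p : measurable_fun setT x ->
  (forall w, 0 <= x w <= 1) ->
  \int[P]_w p.[x w] = \sum_(i < size p) p`_i * \int[P]_w x w ^+ i.
Proof.
move=> mx x01; under eq_Rintegral do rewrite horner_coef.
rewrite (@Rintegral_lincomb _ (fun i => p`_i) (fun i w => x w ^+ i))// => i.
  exact: measurable_funX.
by move=> w; have /andP[x0 x1] := x01 w; rewrite normrX ger0_norm// exprn_ile1.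
Qed.

End bounded_expectation.

Section step_polynomial.
Context (R : realType).
Implicit Types (a x y : R) (n : nat).

(* [(1 - x ^ n) ^ m] with [m] of order [a ^ - n] tends to 1 for [x < a] and,
   by Bernoulli's inequality, to 0 for [x > a]. *)
Definition step_poly a n : {poly R} :=
  (1 - 'X^n) ^+ (Num.truncn (a ^- n)).+1.

Lemma step_polyE a n x :
  (step_poly a n).[x] = (1 - x ^+ n) ^+ (Num.truncn (a ^- n)).+1.
Proof. by rewrite !hornerE. Qed.

Lemma step_poly_itv a n x : 0 <= x <= 1 -> 0 <= (step_poly a n).[x] <= 1.
Proof.
move=> /andP[x0 x1]; rewrite step_polyE.
have xn0 : 0 <= x ^+ n by exact: exprn_ge0.
have xn1 : x ^+ n <= 1 by exact: exprn_ile1.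
by rewrite exprn_ge0 ?exprn_ile1//; lra.
Qed.

Lemma step_poly_nincr a n x y : 0 <= x <= y -> y <= 1 ->
  (step_poly a n).[y] <= (step_poly a n).[x].
Proof.
move=> /andP[x0 xy] y1; rewrite !step_polyE lerXn2r// ?nnegrE ?subr_ge0.
- by rewrite exprn_ile1// (le_trans x0).
- by rewrite exprn_ile1// (le_trans xy).
- by rewrite lerB// lerXn2r// nnegrE// (le_trans x0).
Qed.

Lemma bernoulli_ineq (y : R) n : -1 <= y -> 1 + n%:R * y <= (1 + y) ^+ n.
Proof.
move=> y1; elim: n => [|n IH]; first by rewrite mul0r addr0.
rewrite exprS -natr1.
have : (1 + y) * (1 + n%:R * y) <= (1 + y) * (1 + y) ^+ n.
  by rewrite ler_wpM2l//; lra.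
apply: le_trans.
have : 0 <= n%:R * y ^+ 2 :> R by rewrite mulr_ge0// sqr_ge0.
nra.
Qed.

Let truncn_bound a n : 0 < a ->
  a ^- n <= (Num.truncn (a ^- n)).+1%:R <= a ^- n + 1.
Proof.
move=> a0; have : 0 <= a ^- n by rewrite invr_ge0 exprn_ge0// ltW.
move=> /truncn_itv /andP[h1 h2]; rewrite (ltW h2)/= -natr1 lerD2r //.
Qed.

Lemma cvg_step_poly_lt a x : 0 <= x < a -> a <= 1 ->
  (step_poly a n).[x] @[n --> \oo] --> (1 : R).
Proof.
move=> /andP[x0 xa] a1.
have a0 : 0 < a by exact: le_lt_trans xa.
have H n : 1 - ((x / a) ^+ n + x ^+ n) <= (step_poly a n).[x] <= 1.
  rewrite (andP (step_poly_itv a n _)).2 ?andbT; last by apply/andP; split; lra.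
  rewrite step_polyE.
  have xn1 : x ^+ n <= 1 by rewrite exprn_ile1//; lra.
  have xn0 : 0 <= x ^+ n by exact: exprn_ge0.
  apply: le_trans (@bernoulli_ineq (- x ^+ n) _ _); last lra.
  have /andP[_ h] := @truncn_bound a n a0.
  rewrite mulrN lerB// expr_div_n.
  have -> : x ^+ n / a ^+ n + x ^+ n = (a ^- n + 1) * x ^+ n by ring.
  by rewrite ler_wpM2r.
apply: (@squeeze_cvgr _ _ _ _ (fun n => 1 - ((x / a) ^+ n + x ^+ n)) (cst 1)).
- by apply: nearW.
- rewrite -[X in _ --> X](subr0 1) -[X in _ - X](addr0 0).
  apply: cvgB; first exact: cvg_cst.
  apply: cvgD; apply: cvg_expr; rewrite ger0_norm ?divr_ge0 ?(ltW a0)//.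
    by rewrite ltr_pdivrMr// mul1r.
  exact: lt_le_trans a1.
- exact: cvg_cst.
Qed.

(** With y = x^n, the inequality (1 - y)^m (1 + y)^m <= 1 turns the task into a lower bound for (1 +
    y)^m, which is at least m y >= (x / a)^n. *)
Lemma cvg_step_poly_gt a x : 0 < a < x -> x <= 1 ->
  (step_poly a n).[x] @[n --> \oo] --> (0 : R).
Proof.
move=> /andP[a0 ax] x1.
have x0 : 0 < x by lra.
have H n : 0 <= (step_poly a n).[x] <= (a / x) ^+ n.
  rewrite (andP (step_poly_itv a n _)).1/=; last by apply/andP; split; lra.
  rewrite step_polyE; set m := _.+1.
  have xn0 : 0 < x ^+ n by exact: exprn_gt0.
  have an0 : 0 < a ^+ n by exact: exprn_gt0.
  have xn1 : x ^+ n <= 1 by rewrite exprn_ile1//; lra.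
  have hm : (1 - x ^+ n) ^+ m * (1 + x ^+ n) ^+ m <= 1.
    rewrite -exprMn exprn_ile1//; nra.
  have hb : (x / a) ^+ n <= (1 + x ^+ n) ^+ m.
    apply: le_trans (@bernoulli_ineq _ _ _); last lra.
    have /andP[h _] := @truncn_bound a n a0.
    rewrite expr_div_n mulrC; apply: (@le_trans _ _ (m%:R * x ^+ n)); last lra.
    by rewrite ler_wpM2r// ltW.
  have ha : (a / x) ^+ n = ((x / a) ^+ n)^-1 by rewrite -exprVn invf_div.
  have hp : 0 < (x / a) ^+ n by rewrite exprn_gt0// divr_gt0.
  rewrite ha -[leRHS]mul1r ler_pdivlMr//; apply: le_trans hm.
  by rewrite ler_wpM2l// exprn_ge0//; lra.
apply: (@squeeze_cvgr _ _ _ _ (cst 0) (fun n => (a / x) ^+ n)).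
- by apply: nearW.
- exact: cvg_cst.
- apply: cvg_expr; rewrite ger0_norm ?divr_ge0 ?ltW//.
  by rewrite ltr_pdivrMr// mul1r.
Qed.

End step_polynomial.

Lemma cvg_sumr (R : realType) (I : Type) (F : set_system I) (J : Type)
    (r : seq J) (Q : pred J) (u : J -> I -> R) (l : J -> R) : Filter F ->
  (forall j, Q j -> u j i @[i --> F] --> l j) ->
  \sum_(j <- r | Q j) u j i @[i --> F] --> \sum_(j <- r | Q j) l j.
Proof.
move=> FF ul; elim: r => [|j r IH].
  by rewrite (_ : (fun _ => _) = cst 0) ?big_nil; [exact: cvg_cst|
    apply/funext => i; rewrite big_nil].
rewrite big_cons; case: ifP => Qj; last first.
  by rewrite (_ : (fun _ => _) = (fun i => \sum_(j <- r | Q j) u j i))//;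
    apply/funext => i; rewrite big_cons Qj.
rewrite (_ : (fun _ => _) = (fun i => u j i + \sum_(j <- r | Q j) u j i)).
  by apply: cvgD => //; exact: ul.
by apply/funext => i; rewrite big_cons Qj.
Qed.

Section moment_convergence.
Context (R : realType).

Lemma measurable_le_level d (T : measurableType d) (x : T -> R) (a : R) :
  measurable_fun setT x -> measurable [set w | x w <= a].
Proof.
move=> mx; rewrite [X in measurable X](_ : _ = setT `&` x @^-1` `]-oo, a]).
  exact: mx.
by rewrite setTI; apply/seteqP; split => w /=; rewrite in_itv.
Qed.

Lemma measurable_lt_level d (T : measurableType d) (x : T -> R) (a : R) :
  measurable_fun setT x -> measurable [set w | x w < a].
Proof.
move=> mx; rewrite [X in measurable X](_ : _ = setT `&` x @^-1` `]-oo, a[).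
  exact: mx.
by rewrite setTI; apply/seteqP; split => w /=; rewrite in_itv.
Qed.

Section one_variable.
Context d (T : measurableType d) (P : probability T R) (x : T -> R).
Hypotheses (mx : measurable_fun setT x) (x01 : forall w, 0 <= x w <= 1).

Let int_step (b : R) n :
  P.-integrable setT (EFin \o (fun w => (step_poly b n).[x w])).
Proof.
apply: (@integrable_bounded _ _ _ _ 1); first exact: measurable_horner.
move=> w; have /andP[h1 h2] := step_poly_itv b n (x01 w).
by rewrite ger0_norm.
Qed.

Let int_indic (A : set T) : measurable A ->
  P.-integrable setT (EFin \o (\1_A : T -> R)).
Proof.
move=> mA; apply: (@integrable_bounded _ _ _ _ 1) => // w.
by rewrite indicE; case: (w \in A); rewrite ?normr1 ?normr0.
Qed.

(** A two-sided Markov inequality: the polynomial is nonincreasing on [0, 1], so it is at least its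
    value at a on {x <= a} and at most that value elsewhere. The thresholds b and a are
    unrelated. *)
Lemma step_poly_level (b a : R) n : 0 <= a <= 1 ->
  (step_poly b n).[a] * fine (P [set w | x w <= a]) <=
  \int[P]_w (step_poly b n).[x w] <=
  fine (P [set w | x w <= a]) + (step_poly b n).[a].
Proof.
move=> a01; have /andP[a0 a1] := a01.
have mA := measurable_le_level a mx.
have /andP[q0 q1] := step_poly_itv b n a01.
rewrite -Rintegral_indic//; apply/andP; split.
  rewrite -RintegralZl//; last exact: int_indic.
  apply: le_Rintegral => //.
    rewrite (_ : _ \o _ =
       (fun w => ((step_poly b n).[a])%:E * (\1_[set w | x w <= a] w)%:E)%E).
      by apply: integrableZl => //; exact: int_indic.
    by apply/funext => w /=; rewrite EFinM.
  move=> w _; have /andP[h1 h2] := x01 w.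
  rewrite indicE; have [xa|xa] := leP (x w) a.
    by rewrite mem_set// mulr1 step_poly_nincr// h1.
  rewrite memNset/= ?mulr0; last by rewrite /= leNgt xa.
  by have /andP[] := step_poly_itv b n (x01 w).
rewrite -[(step_poly b n).[a]]mulr1 -[X in _ * X](_ : fine (P setT) = 1).
  rewrite -Rintegral_cst// -RintegralD//; last 2 first.
  - exact: int_indic.
  - by apply: (@integrable_bounded _ _ _ _ 1) => // w; rewrite ger0_norm.
  apply: le_Rintegral => //.
    apply: (@integrable_bounded _ _ _ _ 2) => [|w].
      by apply: measurable_funD => //; exact: measurable_indic.
    by rewrite indicE; case: (w \in _) => /=; rewrite ger0_norm//; lra.
  move=> w _; have /andP[h1 h2] := step_poly_itv b n (x01 w).
  rewrite indicE; have [xa|xa] := leP (x w) a.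
    by rewrite mem_set//=; lra.
  rewrite memNset/= ?add0r; last by rewrite /= leNgt xa.
  by apply: step_poly_nincr; [rewrite a0 ltW|have /andP[] := x01 w].
by rewrite probability_setT.
Qed.

Lemma limsup_step_poly (b e : R) : 0 < b -> 0 < e ->
  \forall n \near \oo, \int[P]_w (step_poly b n).[x w] <
    fine (P [set w | x w <= b]) + e.
Proof.
move=> b0 e0; have mA := measurable_le_level b mx.
pose g n w := (step_poly b n).[x w] * \1_[set w | ~ x w <= b] w.
have g1 n w : `|g n w| <= 1.
  rewrite /g indicE; have /andP[h1 h2] := step_poly_itv b n (x01 w).
  by case: (w \in _); rewrite ?mulr1 ?mulr0 ?normr0// ger0_norm.
have mg n : measurable_fun setT (g n).
  apply: measurable_funM; first exact: measurable_horner.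
  by apply: measurable_indic; exact: measurableC.
have gc w : g n w @[n --> \oo] --> (0 : R).
  rewrite /g indicE; have [xb|xb] := leP (x w) b.
    rewrite memNset; last by move=> /(_ xb).
    by rewrite [X in X @ _ --> _](_ : _ = cst 0) ?mulr0;
      [exact: cvg_cst|apply/funext => n; rewrite mulr0].
  rewrite mem_set/=; last by rewrite leNgt xb.
  rewrite -[X in _ --> X](mulr1 0); apply: cvgMl.
  apply: cvg_step_poly_gt; first by rewrite b0.
  by have /andP[] := x01 w.
have := @cvg_Rintegral_bounded _ _ _ P _ _ mg g1 gc.
rewrite Rintegral_cst// mul0r => /cvgrPdist_lt/(_ _ e0); apply: filterS => n.
rewrite sub0r normrN => /(le_lt_trans (ler_norm _)) He.
apply: le_lt_trans (_ : _ <= fine (P [set w | x w <= b]) + \int[P]_w g n w) _.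
  rewrite -Rintegral_indic// -RintegralD//; last 2 first.
  - exact: int_indic.
  - exact: integrable_bounded (g1 n).
  apply: le_Rintegral => //.
    apply: (@integrable_bounded _ _ _ _ 2) => [|w].
      by apply: measurable_funD => //; exact: measurable_indic.
    apply: le_trans (ler_normD _ _) _; rewrite indicE.
    by have := g1 n w; case: (w \in _) => /=; rewrite ?normr1 ?normr0; lra.
  move=> w _; have /andP[h1 h2] := step_poly_itv b n (x01 w).
  rewrite /g !indicE; have [xb|xb] := leP (x w) b.
    by rewrite mem_set// memNset//=; lra.
  by rewrite memNset ?mem_set/= ?leNgt ?xb//; lra.
by rewrite ltrD2l.
Qed.

Lemma liminf_step_poly (b e : R) : b <= 1 -> 0 < e ->
  \forall n \near \oo, fine (P [set w | x w < b]) - e <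
    \int[P]_w (step_poly b n).[x w].
Proof.
move=> b1 e0; have mA := measurable_lt_level b mx.
pose g n w := (step_poly b n).[x w] * \1_[set w | x w < b] w.
have g1 n w : `|g n w| <= 1.
  rewrite /g indicE; have /andP[h1 h2] := step_poly_itv b n (x01 w).
  by case: (w \in _); rewrite ?mulr1 ?mulr0 ?normr0// ger0_norm.
have mg n : measurable_fun setT (g n).
  by apply: measurable_funM; [exact: measurable_horner|exact: measurable_indic].
have gc w : g n w @[n --> \oo] --> (\1_[set w | x w < b] w : R).
  rewrite /g indicE; have [xb|xb] := ltP (x w) b.
    rewrite mem_set//=.
    rewrite -[X in _ --> X](mulr1 1); apply: cvgMl.
    by apply: cvg_step_poly_lt => //; have /andP[->] := x01 w.
  rewrite memNset/=; last by rewrite ltNge xb.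
  by rewrite [X in X @ _ --> _](_ : _ = cst 0);
    [exact: cvg_cst|apply/funext => n; rewrite mulr0].
have := @cvg_Rintegral_bounded _ _ _ P _ _ mg g1 gc.
rewrite Rintegral_indic// => /cvgrPdist_lt/(_ _ e0); apply: filterS => n He.
apply: (@lt_le_trans _ _ (\int[P]_w g n w)).
  by have := le_lt_trans (ler_norm _) He; lra.
apply: le_Rintegral => //; first exact: integrable_bounded (g1 n).
move=> w _; have /andP[h1 h2] := step_poly_itv b n (x01 w).
by rewrite /g indicE; case: (w \in _); rewrite ?mulr1 ?mulr0.
Qed.

(** Without an atom at a, the events {x <= a} and {x < a} have the same probability; dominated
    convergence along 1/(n + 1) gives both one-sided limits, and monotonicity covers every smaller
    b. *)
Lemma cdf_continuity (a e : R) : P [set w | x w = a] = 0%E -> 0 < e ->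
  exists2 s : R, 0 < s & forall b, 0 < b <= s ->
    fine (P [set w | x w <= a + b]) < fine (P [set w | x w <= a]) + e /\
    fine (P [set w | x w <= a]) - e < fine (P [set w | x w < a - b]).
Proof.
move=> Pa0 e0.
have Pa : fine (P [set w | x w <= a]) = fine (P [set w | x w < a]).
  have -> : [set w | x w <= a] = [set w | x w < a] `|` [set w | x w = a].
    apply/seteqP; split => w /=; rewrite le_eqVlt.
      by move=> /predU1P[->|->]; [right|left].
    by case=> [->|->]; rewrite ?orbT ?eqxx.
  have mE : measurable [set w | x w = a].
    rewrite [X in measurable X](_ : _ = setT `&` x @^-1` [set a]).
      exact: mx.
    by rewrite setTI.
  rewrite measureU0//; exact: measurable_lt_level.
clear Pa0.
pose d0 (n : nat) : R := n.+1%:R^-1.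
have d0c : d0 n @[n --> \oo] --> (0 : R) by exact: cvg_harmonic.
have bnd (A : nat -> set T) n w : `|(\1_(A n) w : R)| <= 1.
  by rewrite indicE; case: (w \in _); rewrite ?normr1 ?normr0.
have U : fine (P [set w | x w <= a + d0 n]) @[n --> \oo] -->
    fine (P [set w | x w <= a]).
  have mU b := measurable_le_level b mx.
  rewrite -Rintegral_indic// [X in X @ _ --> _](_ : _ =
    (fun n => \int[P]_w \1_[set w | x w <= a + d0 n] w)); last first.
    by apply/funext => n; rewrite Rintegral_indic.
  apply: cvg_Rintegral_bounded => [n|n w|w].
  - exact: measurable_indic.
  - exact: (bnd (fun n => [set w | x w <= a + d0 n])).
  - rewrite !indicE; have [xa|xa] := leP (x w) a.
      rewrite mem_set//; apply: cvg_near_cst; apply: nearW => n.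
      by rewrite indicE mem_set//= (le_trans xa)// lerDl invr_ge0.
    rewrite memNset/= ?leNgt ?xa//; apply: cvg_near_cst.
    have xa0 : 0 < x w - a by rewrite subr_gt0.
    move/cvgrPdist_lt/(_ _ xa0): d0c; apply: filterS => n.
    rewrite sub0r normrN ger0_norm ?invr_ge0// => h.
    by rewrite indicE memNset//= => h2; lra.
have V : fine (P [set w | x w < a - d0 n]) @[n --> \oo] -->
    fine (P [set w | x w < a]).
  have mU b := measurable_lt_level b mx.
  rewrite -Rintegral_indic// [X in X @ _ --> _](_ : _ =
    (fun n => \int[P]_w \1_[set w | x w < a - d0 n] w)); last first.
    by apply/funext => n; rewrite Rintegral_indic.
  apply: cvg_Rintegral_bounded => [n|n w|w].
  - exact: measurable_indic.
  - exact: (bnd (fun n => [set w | x w < a - d0 n])).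
  - rewrite !indicE; have [xa|xa] := ltP (x w) a; last first.
      rewrite memNset/= ?ltNge ?xa//; apply: cvg_near_cst; apply: nearW => n.
      rewrite indicE memNset//= => h.
      have : 0 <= d0 n by rewrite invr_ge0.
      by move: h xa; lra.
    rewrite mem_set//; apply: cvg_near_cst.
    have xa0 : 0 < a - x w by rewrite subr_gt0.
    move/cvgrPdist_lt/(_ _ xa0): d0c; apply: filterS => n.
    rewrite sub0r normrN ger0_norm ?invr_ge0// => h.
    by rewrite indicE mem_set//=; lra.
have [n [h1 h2]] : exists n,
  fine (P [set w | x w <= a + d0 n]) < fine (P [set w | x w <= a]) + e /\
  fine (P [set w | x w <= a]) - e < fine (P [set w | x w < a - d0 n]).
  near \oo => n; exists n; split.
    have : `|fine (P [set w | x w <= a]) - fine (P [set w | x w <= a + d0 n])|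
        < e by near: n; exact: (cvgrPdist_lt _ _).1 U _ e0.
    by rewrite distrC => /(le_lt_trans (ler_norm _)); lra.
  have : `|fine (P [set w | x w < a]) - fine (P [set w | x w < a - d0 n])|
      < e by near: n; exact: (cvgrPdist_lt _ _).1 V _ e0.
  by rewrite Pa => /(le_lt_trans (ler_norm _)); lra.
exists (d0 n); first by rewrite invr_gt0.
move=> b /andP[b0 bn]; split.
  apply: le_lt_trans h1; apply: fine_le; rewrite ?fin_num_measure//;
    [exact: measurable_le_level|exact: measurable_le_level|].
  apply: le_measure; rewrite ?inE; [exact: measurable_le_level|
    exact: measurable_le_level|].
  by move=> w /=; lra.
apply: lt_le_trans h2 _; apply: fine_le; rewrite ?fin_num_measure//;
  [exact: measurable_lt_level|exact: measurable_lt_level|].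
apply: le_measure; rewrite ?inE; [exact: measurable_lt_level|
  exact: measurable_lt_level|].
by move=> w /=; lra.
Unshelve. all: by end_near. Qed.

End one_variable.

(** The levels [a i] move with i. A step polynomial whose threshold is shifted away from a0 by more
    than [a i] deviates is close to 1 (threshold to the right) or to 0 (to the left) at [a i]; its
    expectation converges since it is a finite combination of moments, and continuity of the limit
    distribution function at a0 absorbs the shift. *)
Theorem cvg_moments_level (I : Type) (F : set_system I) {FF : Filter F}
    (d : I -> measure_display) (T : forall i, measurableType (d i))
    (P : forall i, probability (T i) R) (x : forall i, T i -> R)
    (dQ : measure_display) (TQ : measurableType dQ) (Q : probability TQ R)
    (z : TQ -> R) (a : I -> R) (a0 : R) :
  (\forall i \near F,
     measurable_fun setT (x i) /\ forall w, 0 <= x i w <= 1) ->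
  measurable_fun setT z -> (forall w, 0 <= z w <= 1) ->
  (forall n, \int[P i]_w x i w ^+ n @[i --> F] --> \int[Q]_w z w ^+ n) ->
  0 < a0 <= 1 -> Q [set w | z w = a0] = 0%E ->
  (\forall i \near F, 0 <= a i <= 1) -> a i @[i --> F] --> a0 ->
  fine (P i [set w | x i w <= a i]) @[i --> F] -->
    fine (Q [set w | z w <= a0]).
Proof.
move=> Fx mz z01 cmom /andP[a00 a01] Qa0 Fa01 Fa.
have cpoly (p : {poly R}) :
    \int[P i]_w p.[x i w] @[i --> F] --> \int[Q]_w p.[z w].
  rewrite Rintegral_horner//.
  apply: (@cvg_trans _
      ((fun i => \sum_(j < size p) p`_j * \int[P i]_w x i w ^+ j) @ F)).
    apply: near_eq_cvg; apply: filterS Fx => i [mx x01].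
    by rewrite Rintegral_horner.
  by apply: cvg_sumr => j _; apply: cvgMr; exact: cmom.
have P01 i (A : set (T i)) : measurable A -> 0 <= fine (P i A) <= 1.
  move=> mA; rewrite fine_ge0//= -lee_fin fineK ?fin_num_measure//.
  exact: probability_le1.
apply/cvgrPdist_lt => e e0; have e40 : 0 < e / 4 by rewrite divr_gt0.
have [s s0 cdfs] := cdf_continuity mz Qa0 e40.
set G := fine (Q [set w | z w <= a0]) in cdfs *.
(* The bound [a0 / 2] keeps the left threshold [a0 - h] positive, as [cvg_step_poly_gt] requires. *)
pose h := Num.min s (a0 / 2).
have h0 : 0 < h by rewrite lt_min s0 divr_gt0.
have hs : h <= s by rewrite ge_min lexx.
have ha : h <= a0 / 2 by rewrite ge_min lexx orbT.
have upper : \forall i \near F, fine (P i [set w | x i w <= a i]) < G + e.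
  (* For a0 = 1 there is no room for a threshold to the right, but then G = 1. *)
  have [a1|a1] := ltP a0 1; last first.
    have G1 : G = 1.
      rewrite /G (_ : [set w | _] = setT) ?probability_setT//.
      apply/seteqP; split => // w _ /=; apply: le_trans a1.
      by have /andP[] := z01 w.
    apply: filterS Fx => i [mx x01].
    have /andP[_ h1] := P01 i _ (measurable_le_level (a i) mx).
    by rewrite G1; lra.
  pose k := Num.min h (1 - a0).
  have k0 : 0 < k by rewrite lt_min h0 subr_gt0.
  have kh : k <= h by rewrite ge_min lexx.
  have k1 : k <= 1 - a0 by rewrite ge_min lexx orbT.
  have b0 : 0 < a0 + k by lra.
  have [n [n1 n2]] : exists n,
      \int[Q]_w (step_poly (a0 + k) n).[z w] <
        fine (Q [set w | z w <= a0 + k]) + e / 4 /\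
      1 - e / 4 < (step_poly (a0 + k) n).[a0 + k / 2].
    near \oo => n; exists n; split.
      by near: n; apply: limsup_step_poly.
    near: n; have : (step_poly (a0 + k) n).[a0 + k / 2] @[n --> \oo] --> (1 : R).
      by apply: cvg_step_poly_lt; lra.
    move/cvgrPdist_lt/(_ _ e40); apply: filterS => n.
    by move/(le_lt_trans (ler_norm _)); lra.
  have ks : 0 < k <= s by rewrite k0 (le_trans kh).
  have [c1 _] := cdfs k ks.
  have k20 : 0 < k / 2 by rewrite divr_gt0.
  near=> i.
  have [mx x01] : measurable_fun setT (x i) /\ forall w, 0 <= x i w <= 1.
    by near: i.
  have ai : 0 <= a i <= 1 by near: i.
  have d1 : `|\int[Q]_w (step_poly (a0 + k) n).[z w] -
      \int[P i]_w (step_poly (a0 + k) n).[x i w]| < e / 4.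
    by near: i; exact: (cvgrPdist_lt _ _).1 (cpoly _) _ e40.
  have d2 : `|a0 - a i| < k / 2.
    by near: i; exact: (cvgrPdist_lt _ _).1 Fa _ k20.
  have /andP[l1 _] := step_poly_level (P i) mx x01 (a0 + k) n ai.
  have /andP[p0 p1] := P01 i _ (measurable_le_level (a i) mx).
  have q1 : (step_poly (a0 + k) n).[a0 + k / 2] <= (step_poly (a0 + k) n).[a i].
    move: d2; rewrite ltr_norml => /andP[d3 d4].
    by apply: step_poly_nincr; [case/andP: ai => ->/=|]; lra.
  move: d1; rewrite ltr_norml => /andP[d3 d4].
  move: l1 p0 p1 q1 d3 d4 n1 n2 c1; rewrite -/G.
  move: (fine (P i _)) (fine (Q _)) (_.[a i]) => p q r.
  move: (\int[P i]_w _) (\int[Q]_w _) => u v; nra.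
have lower : \forall i \near F, G - e < fine (P i [set w | x i w <= a i]).
  have b1 : a0 - h <= 1 by lra.
  have [n [n1 n2]] : exists n,
      fine (Q [set w | z w < a0 - h]) - e / 4 <
        \int[Q]_w (step_poly (a0 - h) n).[z w] /\
      (step_poly (a0 - h) n).[a0 - h / 2] < e / 4.
    near \oo => n; exists n; split.
      by near: n; apply: liminf_step_poly.
    near: n; have : (step_poly (a0 - h) n).[a0 - h / 2] @[n --> \oo] --> (0 : R).
      by apply: cvg_step_poly_gt; lra.
    move/cvgrPdist_lt/(_ _ e40); apply: filterS => n.
    by rewrite distrC => /(le_lt_trans (ler_norm _)); lra.
  have hs' : 0 < h <= s by rewrite h0.
  have [_ c1] := cdfs h hs'.
  have h20 : 0 < h / 2 by rewrite divr_gt0.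
  near=> i.
  have [mx x01] : measurable_fun setT (x i) /\ forall w, 0 <= x i w <= 1.
    by near: i.
  have ai : 0 <= a i <= 1 by near: i.
  have d1 : `|\int[Q]_w (step_poly (a0 - h) n).[z w] -
      \int[P i]_w (step_poly (a0 - h) n).[x i w]| < e / 4.
    by near: i; exact: (cvgrPdist_lt _ _).1 (cpoly _) _ e40.
  have d2 : `|a0 - a i| < h / 2.
    by near: i; exact: (cvgrPdist_lt _ _).1 Fa _ h20.
  have /andP[_ l1] := step_poly_level (P i) mx x01 (a0 - h) n ai.
  have q1 : (step_poly (a0 - h) n).[a i] <= (step_poly (a0 - h) n).[a0 - h / 2].
    move: d2; rewrite ltr_norml => /andP[d3 d4].
    by apply: step_poly_nincr; [apply/andP; split|case/andP: ai]; lra.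
  move: d1; rewrite ltr_norml => /andP[d3 d4].
  move: l1 q1 d3 d4 n1 n2 c1; rewrite -/G.
  move: (fine (P i _)) (fine (Q _)) (_.[a i]) => p q r.
  move: (\int[P i]_w _) (\int[Q]_w _) => u v; lra.
near=> i.
have u : fine (P i [set w | x i w <= a i]) < G + e by near: i.
have l : G - e < fine (P i [set w | x i w <= a i]) by near: i.
by rewrite ltr_norml; apply/andP; split; lra.
Unshelve. all: by end_near. Qed.

End moment_convergence.

(** * Exponential variables *)

Section density.
Local Open Scope ereal_scope.
Context (R : realType) (d : measure_display) (T : measurableType d).
Variables (mu nu : {measure set T -> \bar R}) (g : T -> R).
Hypotheses (g_ge0 : forall x, (0 <= g x)%R) (mg : measurable_fun setT g)
  (nuE : forall A, measurable A -> nu A = \int[mu]_(x in A) (g x)%:E).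

Import HBNNSimple.

Let integral_density_nnsfun (h : {nnsfun T >-> R}) :
  \int[nu]_x (h x)%:E = \int[mu]_x ((g x)%:E * (h x)%:E).
Proof.
have mEg : measurable_fun setT (EFin \o g) by exact/measurable_EFinP.
under [LHS]eq_integral do rewrite fimfunE -fsumEFin//.
rewrite [LHS]ge0_integral_fsum//; last 2 first.
  - by move=> r; exact/measurable_EFinP/measurableT_comp.
  - by move=> n x _; rewrite EFinM nnfun_muleindic_ge0.
under [RHS]eq_integral.
  move=> x xD; rewrite fimfunE -fsumEFin// ge0_mule_fsumr; last first.
    by move=> r; rewrite EFinM nnfun_muleindic_ge0.
  over.
rewrite [RHS]ge0_integral_fsum//; last 2 first.
  - move=> r; apply: emeasurable_funM => //.
    by apply/measurable_EFinP; do 2 apply/measurableT_comp => //.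
  - move=> n x _; apply: mule_ge0; first by rewrite lee_fin.
    by rewrite EFinM nnfun_muleindic_ge0.
apply: eq_fsbigr => r _.
have mr : measurable (h @^-1` [set r]) by exact: measurable_sfunP.
rewrite integralZl_indic_nnsfun// integral_indic// setIT nuE//.
have [r0|r0] := ltP r 0%R.
  rewrite preimage_nnfun0// integral_set0 mule0.
  by under eq_integral do rewrite indic0 mulr0 mule0; rewrite integral0.
rewrite [RHS](_ : _ = \int[mu]_x
    (r%:E * ((g x)%:E * (\1_(h @^-1` [set r]) x)%:E))); last first.
  by apply: eq_integral => x _; rewrite EFinM muleCA.
rewrite ge0_integralZl//; last 2 first.
- apply: emeasurable_funM => //.
  by apply/measurable_EFinP; exact: measurable_indic.
- by move=> x _; rewrite mule_ge0// lee_fin.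
congr (_ * _); rewrite integral_mkcond; apply: eq_integral => x _.
by rewrite patchE indicE; case: ifPn => _; rewrite ?mule1 ?mule0.
Qed.

Lemma ge0_integral_density (f : T -> \bar R) : measurable_fun setT f ->
  (forall x, 0 <= f x) -> \int[nu]_x f x = \int[mu]_x ((g x)%:E * f x).
Proof.
move=> mf f0; pose f_ := nnsfun_approx measurableT mf.
transitivity (lim (\int[nu]_x (f_ n x)%:E @[n --> \oo])).
  rewrite -monotone_convergence//=.
  - apply: eq_integral => ? /[!inE] xD; apply/esym/cvg_lim => //=.
    exact: cvg_nnsfun_approx.
  - by move=> n; exact/measurable_EFinP/measurable_funTS.
  - by move=> n ? _; rewrite lee_fin.
  - by move=> ? _ ? ? mn; rewrite lee_fin; exact/lefP/nd_nnsfun_approx.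
under eq_fun do rewrite integral_density_nnsfun.
rewrite -monotone_convergence//=.
- apply: eq_integral => x _; apply/cvg_lim => //=.
  by apply: cvgeZl => //; exact: cvg_nnsfun_approx.
- move=> n; apply: emeasurable_funM; first exact/measurable_EFinP.
  by apply/measurable_EFinP/measurable_funTS.
- by move=> n x _; rewrite mule_ge0// lee_fin.
- move=> x _ m n mn; rewrite lee_wpmul2l// lee_fin//.
  exact/lefP/nd_nnsfun_approx.
Qed.

End density.

Lemma ge0_integral_law (R : realType) d0 (T0 : measurableType d0) d
    (T : measurableType d) (P : {measure set T0 -> \bar R})
    (mu : {measure set T -> \bar R}) (X : T0 -> T) (g : T -> R)
    (f : T -> \bar R) : measurable_fun setT X ->
  (forall x, 0 <= g x) -> measurable_fun setT g ->
  (forall A, measurable A -> P (X @^-1` A) = \int[mu]_(x in A) (g x)%:E)%E ->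
  measurable_fun setT f -> (forall x, 0 <= f x)%E ->
  (\int[P]_w f (X w) = \int[mu]_x ((g x)%:E * f x))%E.
Proof.
move=> mX g0 mg PX mf f0.
rewrite -(@ge0_integral_density _ _ _ _ (pushforward P X))//.
by rewrite (ge0_integral_pushforward mX)// => y _; exact: f0.
Qed.

Section exponential_variable.
Context (R : realType) (d : measure_display) (T : measurableType d)
  (P : probability T R) (Y : {RV P >-> R}).
Hypothesis Y_exp : forall A : set R, measurable A ->
  distribution P Y A = exponential_prob 1 A.

Lemma exponential_ge0_ae : P [set w | Y w < 0] = 0%E.
Proof.
rewrite -[LHS]/(distribution P Y [set y | y < 0]) Y_exp; last first.
  rewrite [X in measurable X](_ : _ = `]-oo, 0[%classic)//.
rewrite /exponential_prob integral0_eq// => y /= y0.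
by rewrite lt0_exponential_pdf.
Qed.

Lemma exponential_atomless (y : R) : P [set w | Y w = y] = 0%E.
Proof.
rewrite -[LHS]/(distribution P Y [set y]) Y_exp//.
by rewrite /exponential_prob integral_set1.
Qed.

(* The positive part of [Y] is taken so that the variable stays bounded. *)
Lemma laplace_exponential (s : R) : 0 <= s ->
  \int[P]_w expR (- s * Num.max 0 (Y w)) = (1 + s)^-1.
Proof.
move=> s0; rewrite /Rintegral.
pose f (y : R) := (expR (- s * Num.max 0 y))%:E.
have mf : measurable_fun setT (f : measurableTypeR R -> \bar R).
  apply/measurable_EFinP; apply: measurableT_comp => //.
  by apply: measurable_funM => //; apply: measurable_maxr.
have f0 y : (0 <= f y)%E by rewrite lee_fin expR_ge0.
have mY : measurable_fun setT (Y : T -> measurableTypeR R).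
  exact: (measurable_funPT Y).
rewrite (@ge0_integral_law _ _ _ _ _ P lebesgue_measure _ (exponential_pdf 1)
  f mY)//.
- have s1 : 0 < 1 + s by rewrite ltr_pwDl.
  (* Exponential tilting: the density of rate 1 times exp(-s x) is (1 + s)^-1 times the density of
     rate 1 + s. *)
  rewrite (_ : (fun _ => _) =
      (fun x => ((1 + s)^-1)%:E * (exponential_pdf (1 + s) x)%:E)%E); last first.
    apply/funext => x; rewrite /f -!EFinM; congr EFin.
    have [x0|x0] := ltP x 0.
      by rewrite !lt0_exponential_pdf// mul0r mulr0.
    rewrite !exponential_pdfE// mul1r -expRD mulrA mulVf ?gt_eqF// mul1r.
    by congr expR; ring.
  rewrite ge0_integralZl//.
  + by rewrite integral_exponential_pdf// mule1.
  + by apply/measurable_EFinP; exact: measurable_exponential_pdf.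
  + by move=> x _; rewrite lee_fin exponential_pdf_ge0// ltW.
  + by rewrite lee_fin invr_ge0 ltW.
- by move=> x; exact: exponential_pdf_ge0.
- exact: measurable_exponential_pdf.
Qed.

End exponential_variable.

(** The joint law agrees with the product of the marginals on rectangles, hence everywhere, and
    Tonelli's theorem factors the integral. *)
Lemma independent_expectation (R : realType) (d : measure_display)
    (T : measurableType d) (P : probability T R) (Y W : {RV P >-> R})
    (f g : R -> \bar R) : independent_RV Y W ->
  measurable_fun setT f -> (forall y, 0 <= f y)%E ->
  measurable_fun setT g -> (forall y, 0 <= g y)%E ->
  (\int[P]_w (f (Y w) * g (W w)) =
   \int[P]_w f (Y w) * \int[P]_w g (W w))%E.
Proof.
move=> YW mf f0 mg g0; pose YW2 w := (Y w, W w).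
have mYW : measurable_fun setT YW2 by apply: measurable_fun_pair.
pose h (z : R * R) := (f z.1 * g z.2)%E.
have mh : measurable_fun setT h.
  by apply: emeasurable_funM; exact: measurableT_comp.
have h0 z : (0 <= h z)%E by rewrite mule_ge0.
have -> : (\int[P]_w (f (Y w) * g (W w)) = \int[pushforward P YW2]_z h z)%E.
  by rewrite ge0_integral_pushforward.
rewrite (eq_measure_integral (distribution P Y \x distribution P W)%E).
  rewrite fubini_tonelli1// /fubini_F /h /=.
  under eq_integral do rewrite ge0_integralZl//.
  rewrite ge0_integralZr// ?integral_ge0//.
  by rewrite !ge0_integral_distribution.
by move=> A mA _; apply/esym/product_measure_unique => // B C mB mC; exact: YW.
Qed.

(** * Peak polynomials and their smoothing by exponential variables *)

Section exponential_mixture.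
Context (R : realType).

(* If [x^i] has expectation [phi i] and [V] is an independent exponential
   variable of rate [lam], then [(x e^-V)^i] has expectation
   [lam / (lam + i) * phi i]. *)
Definition exp_mix (lam : R) (p : {poly R}) : {poly R} :=
  \poly_(i < size p) (p`_i * (lam / (lam + i%:R))).

(** Exactly what dominated convergence needs in order to send the expectations to 0 for any variable
    with values in [0, 1]; the class is stable under [exp_mix]. *)
Definition null_polys (u : nat -> {poly R}) : Prop :=
  (forall N (x : R), 0 <= x <= 1 -> `|(u N).[x]| <= 1) /\
  (forall x : R, 0 <= x <= 1 -> (u N).[x] @[N --> \oo] --> (0 : R)).

Definition peak_poly (a : R) (N : nat) : {poly R} := (1 - ('X - a%:P) ^+ 2) ^+ N.

Lemma peak_polyE a N x : (peak_poly a N).[x] = (1 - (x - a) ^+ 2) ^+ N.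
Proof. by rewrite !hornerE. Qed.

Lemma peak_poly_itv a N x : 0 <= a <= 1 -> 0 <= x <= 1 -> 0 <= (peak_poly a N).[x] <= 1.
Proof.
move=> /andP[a0 a1] /andP[x0 x1]; rewrite peak_polyE.
have : (x - a) ^+ 2 <= 1 by nra.
have := sqr_ge0 (x - a).
by move=> h1 h2; rewrite exprn_ge0 ?exprn_ile1; lra.
Qed.

Lemma cvg_peak a x : 0 <= a <= 1 -> 0 <= x <= 1 -> x != a ->
  (peak_poly a N).[x] @[N --> \oo] --> (0 : R).
Proof.
move=> /andP[a0 a1] /andP[x0 x1] xa; under eq_fun do rewrite peak_polyE.
apply: cvg_expr.
have h0 : 0 < (x - a) ^+ 2 by rewrite exprn_even_gt0//= subr_eq0.
have h1 : (x - a) ^+ 2 <= 1 by nra.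
by rewrite ger0_norm; lra.
Qed.

Section variable.
Context (d : measure_display) (T : measurableType d) (P : probability T R).

Lemma null_polys_expectation (z : T -> R) u : null_polys u ->
  measurable_fun setT z -> (forall w, 0 <= z w <= 1) ->
  \int[P]_w (u N).[z w] @[N --> \oo] --> (0 : R).
Proof.
move=> [u1 u0] mz z01.
rewrite -[X in _ --> X](_ : \int[P]_(_ in setT) (0 : R) = 0).
  apply: cvg_Rintegral_bounded => [N|N w|w]; [exact: measurable_horner|
    exact: u1|exact: u0].
by rewrite Rintegral_cst// mul0r.
Qed.

Lemma atom_le_peak (z : T -> R) a N : 0 <= a <= 1 ->
  measurable_fun setT z -> (forall w, 0 <= z w <= 1) ->
  fine (P [set w | z w = a]) <= \int[P]_w (peak_poly a N).[z w].
Proof.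
move=> a01 mz z01; have mE : measurable [set w | z w = a].
  rewrite [X in measurable X](_ : _ = setT `&` z @^-1` [set a]); first exact: mz.
  by rewrite setTI.
rewrite -Rintegral_indic//; apply: le_Rintegral => //.
- apply: (@integrable_bounded _ _ _ _ 1) => // w.
  by rewrite indicE; case: (w \in _); rewrite ?normr1 ?normr0.
- apply: (@integrable_bounded _ _ _ _ 1) => [|w]; first exact: measurable_horner.
  by have /andP[h1 h2] := peak_poly_itv N a01 (z01 w); rewrite ger0_norm.
- move=> w _; rewrite indicE; have [zw|zw] := eqVneq (z w) a.
    by rewrite mem_set// peak_polyE zw subrr expr0n subr0 expr1n.
  rewrite memNset/=; first by have /andP[] := peak_poly_itv N a01 (z01 w).
  by move/eqP: zw.
Qed.

Context (Y : {RV P >-> R}).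
Hypothesis Y_exp : forall A : set R, measurable A ->
  distribution P Y A = exponential_prob 1 A.
Variable lam : R.
Hypothesis lam0 : 0 < lam.

(** [Y / lam] is an exponential variable of rate [lam]. Only its law matters: x is a fixed number in
    the integrals below, which stands for independence. *)
Let U w := expR (- lam^-1 * Num.max 0 (Y w)).

Let mU : measurable_fun setT U.
Proof.
apply: measurableT_comp => //.
by apply: measurable_funM => //; apply: measurable_maxr.
Qed.

Let U01 w : 0 < U w <= 1.
Proof.
rewrite expR_gt0/= -expR0 ler_expR mulNr oppr_le0 mulr_ge0 ?invr_ge0 ?(ltW lam0)//.
by rewrite le_max lexx.
Qed.

Lemma horner_exp_mix p x : 0 <= x <= 1 ->
  (exp_mix lam p).[x] = \int[P]_w p.[x * U w].
Proof.
move=> /andP[x0 x1]; rewrite horner_poly Rintegral_horner.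
- apply: eq_bigr => i _; rewrite -mulrA; congr (_ * _).
  under eq_Rintegral do rewrite exprMn.
  rewrite RintegralZl//; last first.
    apply: (@integrable_bounded _ _ _ _ 1) => [|w]; first exact: measurable_funX.
    have /andP[h0 h1] := U01 w.
    by rewrite ger0_norm ?exprn_ge0 ?exprn_ile1// ltW.
  have s0 : 0 <= i%:R / lam by rewrite divr_ge0// ltW.
  have -> : \int[P]_w U w ^+ i = (1 + i%:R / lam)^-1.
    rewrite -(laplace_exponential Y_exp s0).
    apply: eq_Rintegral => w _; rewrite /U -expRM_natl.
    by congr expR; field; rewrite gt_eqF.
  have l1 : lam != 0 by rewrite gt_eqF.
  have l2 : lam + i%:R != 0 by rewrite gt_eqF// ltr_wpDr.
  by field; rewrite l1 l2.
- by apply: measurable_funM.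
- move=> w; have /andP[h0 h1] := U01 w.
  by rewrite mulr_ge0 ?mulr_ile1// ltW.
Qed.

Lemma null_polys_exp_mix u : null_polys u -> null_polys (exp_mix lam \o u).
Proof.
move=> [u1 u0].
have xU x w : 0 <= x <= 1 -> 0 <= x * U w <= 1.
  move=> /andP[x0 x1]; have /andP[h0 h1] := U01 w.
  by rewrite mulr_ge0 ?mulr_ile1// ltW.
have mxU x p : measurable_fun setT (fun w => p.[x * U w]).
  by apply: measurable_horner; apply: measurable_funM.
split=> [N x x01|x x01] /=.
  rewrite horner_exp_mix// ler_norml; apply/andP; split.
    rewrite -[leLHS]mulr1 -[X in _ * X](_ : fine (P setT) = 1);
      last by rewrite probability_setT.
    rewrite -Rintegral_cst//; apply: le_Rintegral => //.
    - by apply: (@integrable_bounded _ _ _ _ 1) => // w; rewrite normrN1.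
    - by apply: (@integrable_bounded _ _ _ _ 1) => // w; exact/u1/xU.
    - by move=> w _; have := u1 N _ (xU _ w x01); rewrite ler_norml => /andP[].
  rewrite -[leRHS]mulr1 -[X in _ * X](_ : fine (P setT) = 1);
    last by rewrite probability_setT.
  rewrite -Rintegral_cst//; apply: le_Rintegral => //.
  - by apply: (@integrable_bounded _ _ _ _ 1) => // w; exact/u1/xU.
  - by apply: (@integrable_bounded _ _ _ _ 1) => // w; rewrite normr1.
  - by move=> w _; have := u1 N _ (xU _ w x01); rewrite ler_norml => /andP[].
rewrite (_ : (fun N => _) = (fun N => \int[P]_w (u N).[x * U w])); last first.
  by apply/funext => N; rewrite horner_exp_mix.
rewrite -[X in _ --> X](_ : \int[P]_(_ in setT) (0 : R) = 0).
  apply: cvg_Rintegral_bounded => // [N w|w]; [exact/u1/xU|exact/u0/xU].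
by rewrite Rintegral_cst// mul0r.
Qed.

(** The peaks themselves do not vanish at a, but their averages do: for fixed x the event {x U = a}
    is null, because U takes each value below 1 at a single value of Y, and the value 1 only for Y
    <= 0. *)
Lemma null_polys_exp_mix_peak a : 0 < a <= 1 ->
  null_polys (fun N => exp_mix lam (peak_poly a N)).
Proof.
move=> /andP[a0 a1]; have a01 : 0 <= a <= 1 by rewrite ltW.
have xU x w : 0 <= x <= 1 -> 0 <= x * U w <= 1.
  move=> /andP[x0 x1]; have /andP[h0 h1] := U01 w.
  by rewrite mulr_ge0 ?mulr_ile1// ltW.
have mxU x p : measurable_fun setT (fun w => p.[x * U w]).
  by apply: measurable_horner; apply: measurable_funM.
have b1 N x w : 0 <= x <= 1 -> `|(peak_poly a N).[x * U w]| <= 1.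
  move=> x01; have /andP[h1 h2] := peak_poly_itv N a01 (xU _ w x01).
  by rewrite ger0_norm.
split=> [N x x01|x x01] /=.
  rewrite horner_exp_mix// ger0_norm; last first.
    apply: Rintegral_ge0 => w _.
    by have /andP[] := peak_poly_itv N a01 (xU _ w x01).
  rewrite -[leRHS]mulr1 -[X in _ * X](_ : fine (P setT) = 1);
    last by rewrite probability_setT.
  rewrite -Rintegral_cst//; apply: le_Rintegral => //.
  - by apply: (@integrable_bounded _ _ _ _ 1) => // w; exact: b1.
  - by apply: (@integrable_bounded _ _ _ _ 1) => // w; rewrite normr1.
  - move=> w _; by have /andP[] := peak_poly_itv N a01 (xU _ w x01).
rewrite (_ : (fun N => _) =
    (fun N => \int[P]_w (peak_poly a N).[x * U w])); last first.
  by apply/funext => N; rewrite horner_exp_mix.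
pose A := [set w | x * U w = a].
have mA : measurable A.
  rewrite [X in measurable X](_ : _ = setT `&` (fun w => x * U w) @^-1` [set a]).
    by apply: (measurable_funM (measurable_cst x) mU).
  by rewrite setTI.
have PA : P A = 0%E.
  have [N0 mN0 PN0] : exists2 B : set T, measurable B & P B = 0%E /\ A `<=` B.
    (* The only nonnegative value of Y with x U = a when x > 0. For x = 0 it is a default value, and
       A is empty since a > 0. *)
    pose y := - lam * ln (a / x).
    have mE b : measurable [set w | Y w = b].
      rewrite [X in measurable X](_ : _ = setT `&` Y @^-1` [set b]).
        exact: (measurable_funPT Y).
      by rewrite setTI.
    have mL : measurable [set w | Y w < 0].
      by apply: measurable_lt_level; exact: (measurable_funPT Y).
    exists ([set w | Y w = y] `|` [set w | Y w < 0]).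
      exact: measurableU.
    split.
      rewrite measureU0//; first exact: (exponential_atomless Y_exp).
      exact: (exponential_ge0_ae Y_exp).
    move=> w; rewrite /A /= => xUa; have [Y0|Y0] := ltP (Y w) 0; [by right|left].
    have x0 : 0 < x.
      rewrite lt_neqAle (andP x01).1 andbT; apply/eqP => x0.
      by move: xUa a0; rewrite -x0 mul0r => <-; rewrite ltxx.
    rewrite /y; have -> : a / x = U w by rewrite -xUa mulrAC divff ?mul1r// gt_eqF.
    by rewrite /U expRK max_r// mulrA mulrNN divff ?mul1r// gt_eqF.
  case: PN0 => PN0 AN0; apply/eqP; rewrite eq_le measure_ge0 andbT -PN0.
  by apply: le_measure; rewrite ?inE.
rewrite -[X in _ --> X](_ : fine (P A) = 0); last by rewrite PA.
rewrite -Rintegral_indic//.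
apply: cvg_Rintegral_bounded => // [N w|w]; first exact: b1.
rewrite indicE; have [xa|xa] := eqVneq (x * U w) a.
  rewrite mem_set// xa; apply: cvg_near_cst; apply: nearW => N.
  by rewrite peak_polyE subrr expr0n subr0 expr1n.
rewrite memNset; last by apply/eqP.
by apply: cvg_peak => //; exact: xU.
Qed.

End variable.
End exponential_mixture.

(** * The limit law *)

Section limit_law.
Context (R : realType) (d : measure_display) (T : measurableType d)
  (P : probability T R) (Y W : {RV P >-> R}).
Hypothesis Y_exp : forall A : set R, measurable A ->
  distribution P Y A = exponential_prob 1 A.
Hypothesis YW : independent_RV Y W.
Variable h : R -> R.
Hypothesis W_laplace : forall s : R, 0 <= s ->
  ('E_P[fun w => expR (- s * W w)] = (h s)%:E)%E.
Hypothesis h_le1 : forall s, 0 <= s -> h s <= 1.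

Lemma integral_laplace s : 0 <= s ->
  (\int[P]_w (expR (- s * W w))%:E = (h s)%:E)%E.
Proof. by move=> s0; rewrite -W_laplace// unlock. Qed.

Let mW : measurable_fun setT W := measurable_funPT W.
Let mY : measurable_fun setT Y := measurable_funPT Y.

(** Chernoff's bound: E exp(-m W) = h m <= 1 gives P(W <= -e) <= exp(-m e) for every natural m. *)
Lemma laplace_ge0_ae : P [set w | W w < 0] = 0%E.
Proof.
have W_lt (n : nat) : P [set w | W w <= - n.+1%:R^-1] = 0%E.
  set e := n.+1%:R^-1; have e0 : 0 < e by rewrite invr_gt0.
  have mE : measurable [set w | W w <= - e] by exact: measurable_le_level.
  have bound (m : nat) : fine (P [set w | W w <= - e]) <= expR (- e) ^+ m.
    have m0 : (0 : R) <= m%:R by [].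
    rewrite -lee_fin fineK ?fin_num_measure//.
    have -> : expR (- e) ^+ m = expR (- (m%:R * e)).
      by rewrite -expRM_natl -mulr_natl mulrN.
    rewrite -(@lee_pmul2l _ (expR (m%:R * e))%:E) ?lte_fin ?expR_gt0//.
    rewrite -EFinM expRN divff ?gt_eqF ?expR_gt0//.
    apply: (@le_trans _ _ (\int[P]_w (expR (- m%:R * W w))%:E)%E); last first.
      by rewrite integral_laplace// lee_fin h_le1.
    rewrite (_ : P _ = \int[P]_w (\1_[set w | W w <= - e] w)%:E)%E; last first.
      by rewrite integral_indic// setIT.
    rewrite -ge0_integralZl//; last exact/measurable_EFinP/measurable_indic.
    apply: ge0_le_integral => //.
    - apply: emeasurable_funM => //.
      exact/measurable_EFinP/measurable_indic.
    - apply/measurable_EFinP; apply: measurableT_comp => //.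
      exact: measurable_funM.
    - move=> w _; rewrite -EFinM lee_fin indicE.
      have [We|We] := leP (W w) (- e).
        rewrite mem_set// mulr1 ler_expR mulNr -mulrN ler_wpM2l//.
        by rewrite lerNr.
      by rewrite memNset/= ?mulr0 ?expR_ge0// leNgt We.
  have c : expR (- e) ^+ m @[m --> \oo] --> (0 : R).
    apply: cvg_expr; rewrite ger0_norm ?expR_ge0// -expR0 ltr_expR.
    by rewrite oppr_lt0.
  apply/eqP; rewrite eq_le measure_ge0 andbT -[P _]fineK ?fin_num_measure//.
  rewrite lee_fin -(cvg_lim (@Rhausdorff R) c).
  by apply: limr_ge; [apply/cvg_ex; exists 0|apply: nearW].
rewrite (_ : [set w | W w < 0] = \bigcup_n [set w | W w <= - n.+1%:R^-1]).
  have mL n : measurable [set w | W w <= - n.+1%:R^-1].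
    exact: measurable_le_level.
  apply/negligibleP; first exact: bigcupT_measurable.
  by apply: negligible_bigcup => n; apply/negligibleP; [exact: mL|exact: W_lt].
apply/seteqP; split=> [w /= W0|w [n _] /= Wn]; last first.
  by apply: le_lt_trans Wn _; rewrite oppr_lt0 invr_gt0.
have [n Hn] : exists n : nat, n.+1%:R^-1 < - W w.
  have W0' : 0 < - W w by rewrite oppr_gt0.
  have := @cvg_harmonic R; move/cvgrPdist_lt/(_ _ W0').
  case=> n _ /(_ n (leqnn n)) /=; rewrite sub0r normrN ger0_norm ?invr_ge0//.
  by exists n.
by exists n => //=; rewrite lerNr ltW.
Qed.

Variable alpha : R.
Hypothesis alpha01 : 0 <= alpha <= 1.

Let V w := Num.max 0 (alpha * Y w + (1 - alpha) * W w).

(* [e^-Z], with [Z] replaced by its positive part so that the values are in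
   [0, 1]; [Z] is almost surely nonnegative. *)
Definition exp_mixture w : R := expR (- V w).
Local Notation z := exp_mixture.

Let mV : measurable_fun setT V.
Proof.
apply: measurable_maxr => //.
by apply: measurable_funD; apply: measurable_funM.
Qed.

Lemma measurable_exp_mixture : measurable_fun setT z.
Proof. by apply: measurableT_comp => //; exact: measurableT_comp. Qed.

Lemma exp_mixture_itv w : 0 <= z w <= 1.
Proof.
by rewrite /z expR_ge0/= -expR0 ler_expR oppr_le0 /V le_max lexx.
Qed.

Let W0_ae : (\forall w \ae P, 0 <= W w)%R.
Proof.
exists [set w | W w < 0]; split; first exact: measurable_lt_level.
  exact: laplace_ge0_ae.
by move=> w /= /negP; rewrite -ltNge.
Qed.

Let Y0_ae : (\forall w \ae P, 0 <= Y w)%R.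
Proof.
exists [set w | Y w < 0]; split; first exact: measurable_lt_level.
  exact: (exponential_ge0_ae Y_exp).
by move=> w /= /negP; rewrite -ltNge.
Qed.

(** Y and W are almost surely nonnegative, so the positive parts drop out and exp(-n Z) factors by
    independence. *)
Lemma exp_mixture_moment n :
  \int[P]_w z w ^+ n = (1 + alpha * n%:R)^-1 * h ((1 - alpha) * n%:R).
Proof.
have [a0 a1] := andP alpha01.
have s1 : 0 <= alpha * n%:R by rewrite mulr_ge0.
have s2 : 0 <= (1 - alpha) * n%:R by rewrite mulr_ge0// subr_ge0.
pose f (y : R) := (expR (- (alpha * n%:R) * Num.max 0 y))%:E.
pose g (y : R) := (expR (- ((1 - alpha) * n%:R) * y))%:E.
have mf : measurable_fun setT f.
  apply/measurable_EFinP; apply: measurableT_comp => //.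
  by apply: measurable_funM => //; apply: measurable_maxr.
have mg : measurable_fun setT g.
  by apply/measurable_EFinP; apply: measurableT_comp.
have f0 y : (0 <= f y)%E by rewrite lee_fin expR_ge0.
have g0 y : (0 <= g y)%E by rewrite lee_fin expR_ge0.
have H := independent_expectation YW mf f0 mg g0.
have -> : \int[P]_w z w ^+ n = fine (\int[P]_w (f (Y w) * g (W w)))%E.
  congr fine; apply: ae_eq_integral => //.
  - by apply/measurable_EFinP; apply: measurable_funX; exact: measurable_exp_mixture.
  - by apply: emeasurable_funM; [exact: (measurableT_comp mf)|exact: (measurableT_comp mg)].
  - near=> w => _.
    have Y0 : 0 <= Y w by near: w; exact: Y0_ae.
    have W0 : 0 <= W w by near: w; exact: W0_ae.
    rewrite /f /g -EFinM -expRD max_r// /z -expRM_natl /V max_r.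
      by congr EFin; congr expR; ring.
    by rewrite addr_ge0// mulr_ge0// subr_ge0.
have Eg : (\int[P]_w g (W w) = (h ((1 - alpha) * n%:R))%:E)%E.
  exact: integral_laplace.
rewrite H Eg; have Ef := laplace_exponential Y_exp s1.
rewrite -Ef fineM; [by []| |by []].
apply: integrable_fin_num; first exact: measurableT.
apply: (@integrable_bounded _ _ _ _ 1 (fun w => expR (- (alpha * n%:R) * Num.max 0 (Y w)))).
  by apply/measurable_EFinP; exact: (measurableT_comp mf).
move=> w; rewrite ger0_norm ?expR_ge0// -[leRHS]expR0 ler_expR mulNr oppr_le0.
by rewrite mulr_ge0// le_max lexx.
Unshelve. all: by end_near. Qed.

Lemma le_level_exp_mixture (omega : R) :
  (P [set w | omega <= alpha * Y w + (1 - alpha) * W w]%R <=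
   P [set w | z w <= expR (- omega)]%R)%E.
Proof.
apply: le_measure; rewrite ?inE.
- rewrite [X in measurable X](_ : _ = ~` [set w | alpha * Y w + (1 - alpha) * W w < omega]).
    apply: measurableC; apply: measurable_lt_level.
    by apply: measurable_funD; apply: measurable_funM.
  by apply/seteqP; split => w /=; rewrite leNgt => /negP.
- by apply: measurable_le_level; exact: measurable_exp_mixture.
- by move=> w /= Zw; rewrite ler_expR lerN2 /V le_max Zw orbT.
Qed.

Lemma atom_exp_mixture1 :
  P [set w | alpha * Y w + (1 - alpha) * W w = 0] = 0%E ->
  P [set w | z w = 1] = 0%E.
Proof.
move=> Z0; have [a0 a1] := andP alpha01.
have mZ : measurable_fun setT (fun w => alpha * Y w + (1 - alpha) * W w).
  by apply: measurable_funD; apply: measurable_funM.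
have mZ0 : measurable [set w | alpha * Y w + (1 - alpha) * W w = 0].
  rewrite [X in measurable X](_ : _ =
    setT `&` (fun w => alpha * Y w + (1 - alpha) * W w) @^-1` [set 0]).
    exact: mZ.
  by rewrite setTI.
have mz1 : measurable [set w | z w = 1].
  rewrite [X in measurable X](_ : _ = setT `&` z @^-1` [set 1]).
    exact: measurable_exp_mixture.
  by rewrite setTI.
have mY0 := measurable_lt_level 0 mY.
have mW0 := measurable_lt_level 0 mW.
apply/eqP; rewrite eq_le measure_ge0 andbT.
rewrite -(exponential_ge0_ae Y_exp).
rewrite -(measureU0 mY0 mW0 laplace_ge0_ae).
rewrite -(measureU0 (measurableU _ _ mY0 mW0) mZ0 Z0).
apply: le_measure; rewrite ?inE//.
  by apply: measurableU => //; exact: measurableU.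
move=> w /=; rewrite /z -[RHS]expR0 => /expR_inj /eqP; rewrite oppr_eq0 /V => /eqP Vw.
have [Yw|Yw] := ltP (Y w) 0; first by left; left.
have [Ww|Ww] := ltP (W w) 0; first by left; right.
right; apply/eqP; rewrite eq_le; apply/andP; split; last first.
  by rewrite addr_ge0// mulr_ge0// subr_ge0.
by rewrite -[leRHS]Vw le_max lexx orbT.
Qed.

End limit_law.

(** * Absence of atoms of the limit in (0, 1) *)

Section limit_law_atomless.
Context (R : realType) (d : measure_display) (T : measurableType d)
  (P : probability T R) (Y W : {RV P >-> R}).
Hypothesis Y_exp : forall A : set R, measurable A ->
  distribution P Y A = exponential_prob 1 A.
Hypothesis YW : independent_RV Y W.
Context (J : finType) (b lam : J -> R) (gS : R).
Hypotheses (b0 : forall j, 0 <= b j) (lam0 : forall j, 0 < lam j)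
  (gS0 : 0 <= gS).

(** The Laplace transform, at an independent exponential time of mean 1, of a subordinator with
    drift [gS] and jumps of rate [b j], each exponential of rate [lam j]. *)
Definition laplace_mixture (s : R) : R :=
  (1 + \sum_j b j * s / (lam j + s) + s * gS)^-1.
Local Notation h := laplace_mixture.

Hypothesis W_laplace : forall s : R, 0 <= s ->
  ('E_P[fun w => expR (- s * W w)] = (h s)%:E)%E.
Variable alpha : R.
Hypothesis alpha01 : 0 <= alpha <= 1.

Let den_ge1 s : 0 <= s -> 1 <= 1 + \sum_j b j * s / (lam j + s) + s * gS.
Proof.
move=> s0; rewrite -addrA lerDl addr_ge0 ?mulr_ge0// sumr_ge0// => j _.
by rewrite divr_ge0 ?mulr_ge0// addr_ge0// ltW.
Qed.

Lemma laplace_mixture_le1 s : 0 <= s -> h s <= 1.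
Proof.
move=> s0; have := den_ge1 s0 => d1.
by rewrite /h invf_le1//; apply: lt_le_trans d1.
Qed.

Local Notation z := (exp_mixture Y W alpha).

Let mz := measurable_exp_mixture Y W alpha.
Let z01 := exp_mixture_itv Y W alpha.

Let zmoment := exp_mixture_moment Y_exp YW W_laplace laplace_mixture_le1 alpha01.

Lemma Rintegral_horner_wide (x : T -> R) (p : {poly R}) n : (size p <= n)%N ->
  measurable_fun setT x -> (forall w, 0 <= x w <= 1) ->
  \int[P]_w p.[x w] = \sum_(i < n) p`_i * \int[P]_w x w ^+ i.
Proof.
move=> pn mx x01; rewrite Rintegral_horner//.
rewrite (big_ord_widen _ (fun i => p`_i * \int[P]_w x w ^+ i) pn).
rewrite big_mkcond; apply: eq_bigr => i _; case: ltnP => // pi.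
by rewrite nth_default// mul0r.
Qed.

Let coef_exp_mix (l : R) (p : {poly R}) i :
  (exp_mix l p)`_i = p`_i * (l / (l + i%:R)).
Proof.
rewrite coef_poly; case: ltnP => // pi.
by rewrite nth_default// mul0r.
Qed.

Let size_exp_mix (l : R) (p : {poly R}) : (size (exp_mix l p) <= size p)%N.
Proof. exact: size_poly. Qed.

Let cvg0_atom a (C : R) (u : nat -> R) : 0 <= a <= 1 -> 0 < C ->
  (forall N, C * \int[P]_w (peak_poly a N).[z w] = u N) ->
  u N @[N --> \oo] --> (0 : R) -> P [set w | z w = a] = 0%E.
Proof.
move=> a01 C0 Cu u0.
have mE : measurable [set w | z w = a].
  rewrite [X in measurable X](_ : _ = setT `&` z @^-1` [set a]); first exact: mz.
  by rewrite setTI.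
apply/eqP; rewrite eq_le measure_ge0 andbT -[P _]fineK ?fin_num_measure//.
rewrite lee_fin -(pmulr_rle0 _ C0) -(cvg_lim (@Rhausdorff R) u0).
apply: limr_ge; first by apply/cvg_ex; exists 0.
by apply: nearW => N; rewrite -Cu ler_wpM2l ?(ltW C0)// atom_le_peak.
Qed.

(** Almost surely z is exp(-(1 - alpha) W) times exp(-alpha Y), and alpha Y is exponential of rate 1
    / alpha: the peaks integrated against z are smoothed peaks integrated against the first factor,
    [z1]. *)
Let atomless_pos a : 0 < a <= 1 -> 0 < alpha -> P [set w | z w = a] = 0%E.
Proof.
move=> a01 al0; have a01' : 0 <= a <= 1 by case/andP: a01 => /ltW ->.
have [_ al1] := andP alpha01.
pose z1 := exp_mixture (cst 0 : T -> R) W alpha.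
have mz1 : measurable_fun setT z1.
  apply: measurableT_comp => //; apply: measurableT_comp => //.
  apply: measurable_maxr => //; apply: measurable_funD.
    exact: measurable_funM.
  by apply: measurable_funM => //; exact: measurable_funPT.
have z101 w : 0 <= z1 w <= 1 by exact: exp_mixture_itv.
have z1m n : \int[P]_w z1 w ^+ n = h ((1 - alpha) * n%:R).
  have s2 : 0 <= (1 - alpha) * n%:R by rewrite mulr_ge0// subr_ge0.
  rewrite -[RHS]/(fine (h ((1 - alpha) * n%:R))%:E) -(integral_laplace W_laplace)//.
  congr fine; apply: ae_eq_integral => //.
  - by apply/measurable_EFinP; apply: measurable_funX.
  - apply/measurable_EFinP; apply: measurableT_comp => //.
    by apply: measurable_funM => //; exact: measurable_funPT.
  - exists [set w | W w < 0]; split.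
    + by apply: measurable_lt_level; exact: measurable_funPT.
    + exact: (laplace_ge0_ae W_laplace laplace_mixture_le1).
    + move=> w /=; apply: contra_notP => /negP; rewrite -leNgt => W0 _.
      rewrite /z1 /exp_mixture -expRM_natl mulr0 add0r max_r.
        by congr EFin; congr expR; ring.
      by rewrite mulr_ge0// subr_ge0.
have al0' : 0 < alpha^-1 by rewrite invr_gt0.
apply: (@cvg0_atom a 1 (fun N => \int[P]_w (exp_mix alpha^-1 (peak_poly a N)).[z1 w])) => //.
  move=> N; rewrite mul1r (Rintegral_horner_wide (leqnn _) mz z01).
  rewrite (Rintegral_horner_wide (size_exp_mix _ _) mz1 z101).
  apply: eq_bigr => i _; rewrite zmoment coef_exp_mix z1m mulrA; congr (_ * _ * _).
  have l2 : 1 + alpha * i%:R != 0 by rewrite gt_eqF// ltr_pwDl// mulr_ge0// ltW.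
  have -> : alpha^-1 + i%:R = (1 + alpha * i%:R) / alpha.
    by rewrite mulrDl mul1r mulrAC divff ?mul1r// gt_eqF.
  by rewrite invf_div mulrA mulVf ?mul1r// gt_eqF.
apply: null_polys_expectation => //.
exact: (null_polys_exp_mix_peak Y_exp al0' a01).
Qed.

(* The moments [m i = h i] satisfy
   [(1 + \sum_j b j + i gS) m i = 1 + \sum_j b j lam j / (lam j + i) m i]: the
   variable is [1] or [z e^-V_j], with [V_j] exponential of rate [lam j], smoothed
   by an exponential of rate [(1 + \sum_j b j) / gS] if [gS > 0]. *)
Let atomless_zero a : 0 < a < 1 -> alpha = 0 -> P [set w | z w = a] = 0%E.
Proof.
move=> /andP[a0 a1] al0.
have a01 : 0 < a <= 1 by rewrite a0 ltW.
have a01' : 0 <= a <= 1 by rewrite !ltW.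
pose B := 1 + \sum_j b j.
have B0 : 0 < B by rewrite ltr_pwDl// sumr_ge0.
(* Chosen so that B p_i = q_i (B + i gS) for the coefficients p_i of the peak, which removes the
   drift from the relation between the moments. *)
pose q N := if gS == 0 then peak_poly a N else exp_mix (B / gS) (peak_poly a N).
have zm i : \int[P]_w z w ^+ i = h i%:R.
  by rewrite zmoment al0 mul0r addr0 invr1 mul1r subr0 mul1r.
have sq N : (size (q N) <= size (peak_poly a N))%N.
  by rewrite /q; case: ifP => // _; exact: size_exp_mix.
(* The moment relation multiplied by q_i. Summed over i, the first term is the value of q at 1, the
   others are expectations of smoothed polynomials. *)
have lamE N i : B * ((peak_poly a N)`_i * h i%:R) =
    (q N)`_i + \sum_j b j * ((exp_mix (lam j) (q N))`_i * h i%:R).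
  have i0 : (0 : R) <= i%:R by [].
  have hh : h i%:R * (B + i%:R * gS) =
      1 + \sum_j b j * (lam j / (lam j + i%:R)) * h i%:R.
    have d0 := lt_le_trans (@ltr01 R) (den_ge1 i0).
    apply: (@mulIf _ (1 + \sum_j b j * i%:R / (lam j + i%:R) + i%:R * gS)).
      by rewrite gt_eqF.
    rewrite mulrAC /h mulVf ?gt_eqF// mul1r mulrDl mul1r.
    rewrite -mulr_suml -mulrA mulVf ?gt_eqF// mulr1.
    have -> : B = 1 + (\sum_j b j * i%:R / (lam j + i%:R) +
        \sum_j b j * (lam j / (lam j + i%:R))).
      rewrite -big_split; congr (_ + _); apply: eq_bigr => j _ /=.
      have l2 : lam j + i%:R != 0 by rewrite gt_eqF// ltr_pwDl.
      by rewrite mulrA -mulrDl -mulrDr addrC mulfK.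
    by move: (\sum_j _) (\sum_j _) => u v; ring.
  have qE : B * (peak_poly a N)`_i = (q N)`_i * (B + i%:R * gS).
    rewrite /q; case: ifPn => gS0'; first by rewrite (eqP gS0') mulr0 addr0 mulrC.
    rewrite coef_exp_mix; have d0 : B + i%:R * gS != 0.
      by rewrite gt_eqF// ltr_pwDl// mulr_ge0.
    have d1 : B / gS + i%:R = (B + i%:R * gS) / gS by field.
    by rewrite d1; field; rewrite gS0' d0.
  rewrite mulrA qE -mulrA [_ * h _]mulrC hh mulrDr mulr1; congr (_ + _).
  by rewrite mulr_sumr; apply: eq_bigr => j _; rewrite coef_exp_mix; ring.
apply: (@cvg0_atom a B (fun N => (q N).[1] +
   \sum_j b j * \int[P]_w (exp_mix (lam j) (q N)).[z w])) => //.
  move=> N; rewrite (Rintegral_horner_wide (leqnn _) mz z01).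
  rewrite mulr_sumr; under eq_bigr do rewrite zm lamE.
  rewrite big_split/=; congr (_ + _).
    rewrite (horner_coef_wide _ (sq N)).
    by apply: eq_bigr => i _; rewrite expr1n mulr1.
  rewrite exchange_big; apply: eq_bigr => j _ /=.
  rewrite (Rintegral_horner_wide (leq_trans (size_exp_mix _ _) (sq N)) mz z01).
  by rewrite mulr_sumr; apply: eq_bigr => i _; rewrite zm.
have nq : (q N).[1] @[N --> \oo] --> (0 : R) /\
    forall j, null_polys (fun N => exp_mix (lam j) (q N)).
  rewrite /q; have [gS0'|gS0'] := eqVneq gS 0.
    split=> [|j]; last exact: (null_polys_exp_mix_peak Y_exp (lam0 j) a01).
    (* Without drift the peak itself is evaluated at 1, and tends to 0 there because a < 1. *)
    by apply: cvg_peak; rewrite ?ler01 ?lexx ?gt_eqF.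
  have gS1 : 0 < gS by rewrite lt_neqAle eq_sym gS0'.
  have H := null_polys_exp_mix_peak Y_exp (divr_gt0 B0 gS1) a01.
  split=> [|j]; first by have [_ H0] := H; apply: H0; rewrite ler01 lexx.
  exact: (null_polys_exp_mix Y_exp (lam0 j) H).
have [q1 qn] := nq.
rewrite -[X in _ --> X]addr0; apply: cvgD => //.
rewrite -[X in _ --> X](_ : \sum_(j : J) b j * 0 = 0 :> R); last first.
  by rewrite big1// => j _; rewrite mulr0.
apply: cvg_sumr => j _; apply: cvgMr.
exact: (null_polys_expectation P (qn j) mz z01).
Qed.

Lemma exp_mixture_atomless a : 0 < a < 1 -> P [set w | z w = a] = 0%E.
Proof.
move=> a01; have [] := andP alpha01; rewrite le_eqVlt => /predU1P[al0 _|al0 _].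
  exact: atomless_zero.
by apply: atomless_pos => //; case/andP: a01 => -> /ltW.
Qed.

End limit_law_atomless.

(** * Hitting times *)

Lemma cvg_harmonic_right (R : realType) :
  n.+1%:R^-1 @[n --> \oo] --> ((0 : R)^'+).
Proof.
move=> A [e /= e0 He].
have := @cvg_harmonic R => /cvgrPdist_lt/(_ _ e0); apply: filterS => n hn.
by apply: He => //=; rewrite invr_gt0.
Qed.

Section skeleton.
Context (R : realType) (S : finType) (q : S -> S -> R) (p : R -> S -> S -> R).
Hypothesis tp : transition_function q p.
Variable B : pred S.
Implicit Types (g : S -> R) (a b c : S).

(** The generator applied to g, with differences in place of the diagonal entry. *)
Definition drift g b : R := \sum_(c | c != b) q b c * (g c - g b).

Lemma cvg_expR_quotient (sigma : R) : 0 <= sigma ->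
  (expR (- sigma * t) - 1) / t @[t --> 0^'+] --> - sigma.
Proof.
move=> s0.
apply: (@squeeze_cvgr _ _ _ _ (cst (- sigma)) (fun t => - sigma / (1 + sigma * t))).
- near=> t; have t0 : 0 < t by near: t; exact: nbhs_right_gt.
  have d0 : 0 < 1 + sigma * t by rewrite ltr_pwDl// mulr_ge0// ltW.
  rewrite ler_pdivlMr// ler_pdivrMr// mulNr; apply/andP; split.
    by have := expR_ge1Dx (- (sigma * t)); lra.
  have h : expR (- (sigma * t)) <= (1 + sigma * t)^-1.
    by rewrite expRN lef_pV2 ?posrE ?expR_gt0//; exact: expR_ge1Dx.
  rewrite lerBlDr; apply: le_trans h _; rewrite le_eqVlt; apply/orP; left.
  by apply/eqP; field; rewrite gt_eqF.
- exact: cvg_cst.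
- rewrite -[X in _ --> X](_ : - sigma / (1 + sigma * 0) = _); last first.
    by rewrite mulr0 addr0 divr1.
  apply: cvg_at_right_filter; apply: cvgM; first exact: cvg_cst.
  apply: cvgV; first by rewrite mulr0 addr0.
  by apply: cvgD; [exact: cvg_cst|apply: cvgMr; exact: cvg_id].
Unshelve. all: by end_near. Qed.

(** The right derivative at 0 of the discounted expectation of g, by the product rule applied to
    exp(-sigma t) and p_t. *)
Lemma cvg_drift (sigma : R) g b : 0 <= sigma ->
  (expR (- sigma * t) * (\sum_c p t b c * g c) - g b) / t @[t --> 0^'+] -->
  drift g b - sigma * g b.
Proof.
move=> s0; have [_ _ p0 _ pq] := tp.
have H : (fun t => expR (- sigma * t) * (\sum_c (p t b c - (b == c)%:R) / t * g c)
    + (expR (- sigma * t) - 1) / t * g b) t @[t --> 0^'+] -->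
  expR (- sigma * 0) * (\sum_c generator q b c * g c) + (- sigma) * g b.
  apply: cvgD.
    apply: cvgM.
      apply: cvg_at_right_filter.
      apply: (@continuous_comp _ _ _ (fun t : R => - sigma * t) expR).
        by apply: cvgMr; exact: cvg_id.
      exact: continuous_expR.
    by apply: cvg_sumr => c _; apply: cvgMl; exact: pq.
  by apply: cvgMl; exact: cvg_expR_quotient.
have -> : drift g b - sigma * g b =
    expR (- sigma * 0) * (\sum_c generator q b c * g c) + (- sigma) * g b.
  rewrite mulr0 expR0 mul1r mulNr; congr (_ - _).
  rewrite (bigD1 b)//= {1}/generator eqxx mulNr mulr_suml addrC -sumrB /drift.
  by apply: eq_bigr => c cb; rewrite /generator eq_sym (negbTE cb) mulrBr.
apply: cvg_trans H; apply: near_eq_cvg; near=> t.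
have t0 : t != 0 by rewrite gt_eqF//; near: t; exact: nbhs_right_gt.
rewrite (bigD1 b)//= [X in _ = (_ * X - _) / _](bigD1 b)//= eqxx.
rewrite (eq_bigr (fun c => (p t b c * g c) / t)); last first.
  by move=> c cb; rewrite eq_sym (negbTE cb) subr0 mulrAC.
rewrite -mulr_suml; set s := \sum_(_ | _) _; set e := expR _.
by rewrite mulr1n; field.
Unshelve. all: by end_near. Qed.

(** Probability that the skeleton from b avoids B at steps 1 to n. Step 0 is not tested. *)
Fixpoint survival (delta : R) n b : R :=
  if n is m.+1 then \sum_(c | ~~ B c) p delta b c * survival delta m c else 1.

(** A truncated Riemann sum of the integral of exp(-sigma t) P(H > t), which equals (1 - E
    exp(-sigma H)) / sigma. *)
Definition discounted (sigma delta : R) N b : R :=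
  delta * \sum_(n < N) expR (- sigma * delta) ^+ n * survival delta n b.

Lemma discountedS sigma delta N b : discounted sigma delta N.+1 b =
  delta + expR (- sigma * delta) *
    \sum_(c | ~~ B c) p delta b c * discounted sigma delta N c.
Proof.
rewrite /discounted big_ord_recl/= expr0 mul1r mulrDr mulr1; congr (_ + _).
transitivity (delta * \sum_(n < N) \sum_(c | ~~ B c)
    expR (- sigma * delta) ^+ n.+1 * (p delta b c * survival delta n c)).
  by congr (_ * _); apply: eq_bigr => n _; rewrite mulr_sumr.
rewrite exchange_big !mulr_sumr; apply: eq_bigr => c _ /=.
rewrite !mulr_sumr; apply: eq_bigr => n _.
by rewrite exprS; ring.
Qed.

Section comparison.
Variables (sigma delta eps : R) (g : S -> R).
Hypotheses (sigma0 : 0 <= sigma) (delta0 : 0 <= delta)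
  (geps : forall b, ~~ B b ->
    `|expR (- sigma * delta) * (\sum_c p delta b c * g c) - g b
      - delta * (drift g b - sigma * g b)| <= eps * delta).

Let p_ge0 b c : 0 <= p delta b c.
Proof. by case: tp => + _ _ _ _; exact. Qed.

Let p_sum b : \sum_c p delta b c = 1.
Proof. by case: tp => _ + _ _ _; exact. Qed.

Let split_sum b (h : S -> R) : \sum_c p delta b c * h c =
  \sum_(c | ~~ B c) p delta b c * h c + \sum_(c | B c) p delta b c * h c.
Proof. by rewrite (bigID B) addrC. Qed.

(** Induction on the first step. Over one step g loses at least [delta], up to the discretization
    defect [eps * delta]; the factor 1 - eps pays for it. *)
Lemma discounted_le N b : eps <= 1 -> (forall c, B c -> 0 <= g c) ->
  (forall c, ~~ B c -> 0 <= g c /\ drift g c - sigma * g c <= -1) ->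
  ~~ B b -> (1 - eps) * discounted sigma delta N b <= g b.
Proof.
move=> eps1 gB gD; elim: N b => [|N IH] b Bb.
  by rewrite /discounted big_ord0 !mulr0; case: (gD _ Bb).
rewrite discountedS mulrDr mulrCA mulr_sumr.
have h1 : \sum_(c | ~~ B c) (1 - eps) * (p delta b c * discounted sigma delta N c)
    <= \sum_c p delta b c * g c.
  rewrite split_sum -[leLHS]addr0 lerD ?sumr_ge0//; last first.
    by move=> c Bc; rewrite mulr_ge0// gB.
  by apply: ler_sum => c Bc; rewrite mulrCA ler_wpM2l// IH.
have h2 := ler_wpM2l (expR_ge0 (- sigma * delta)) h1.
have := geps Bb; rewrite ler_norml => /andP[_ h3].
have [_ h4] := gD _ Bb.
have h5 := ler_wpM2l delta0 h4.
lra.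
Qed.

(** The same induction reversed. As the sum stops at N, what g still accounts for after step N has
    to be removed: at most C, discounted N times. *)
Lemma discounted_ge N b C : (forall c, B c -> g c <= 0) ->
  (forall c, ~~ B c -> -1 <= drift g c - sigma * g c) ->
  0 <= C -> (forall c, g c <= C) -> 0 <= eps ->
  ~~ B b -> g b - C * expR (- sigma * delta) ^+ N <=
    (1 + eps) * discounted sigma delta N b.
Proof.
move=> gB gD C0 gC eps0; elim: N b => [|N IH] b Bb.
  by rewrite /discounted big_ord0 !mulr0 expr0 mulr1 subr_le0.
rewrite discountedS mulrDr mulrCA mulr_sumr.
set e := expR _ in IH *; have e0 : 0 <= e ^+ N by rewrite exprn_ge0// expR_ge0.
have h1 : \sum_c p delta b c * g c - C * e ^+ N <=
    \sum_(c | ~~ B c) (1 + eps) * (p delta b c * discounted sigma delta N c).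
  have -> : C * e ^+ N = \sum_c p delta b c * (C * e ^+ N).
    by rewrite -mulr_suml p_sum mul1r.
  rewrite -sumrB (bigID B)/= [leLHS]addrC -[leRHS]addr0 lerD//.
    by apply: ler_sum => c Bc; rewrite -mulrBr mulrCA ler_wpM2l// IH.
  apply: sumr_le0 => c Bc; rewrite -mulrBr mulr_ge0_le0//.
  by rewrite subr_le0 (le_trans (gB _ Bc))// mulr_ge0.
have h2 := ler_wpM2l (expR_ge0 (- sigma * delta)) h1.
have := geps Bb; rewrite ler_norml => /andP[h3 _].
have h4 := gD _ Bb.
have h5 := ler_wpM2l delta0 h4.
rewrite exprS; move: h2 h3 h5; rewrite -/e; lra.
Qed.

End comparison.
End skeleton.

(** * Laplace transform and mean of a hitting time in continuous time *)

Section hitting.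
Context (R : realType) (S : finType) (d : measure_display)
  (T : measurableType d) (P : probability T R) (q : S -> S -> R)
  (X : R -> T -> S).
Hypothesis MX : markov_process P q X.
Variables (a : S) (B : pred S).
Hypotheses (X0 : P [set w | X 0 w = a] = 1%E) (aB : ~~ B a).

Definition avoid (delta : R) n : set T :=
  [set w | forall i, (i <= n)%N -> ~~ B (X (i%:R * delta) w)].

Let mX t c : 0 <= t -> measurable [set w | X t w = c].
Proof. by move=> t0; case: MX => + _ _; exact. Qed.

Let mXB t (C : pred S) : 0 <= t -> measurable [set w | C (X t w)].
Proof.
move=> t0; rewrite (_ : [set w | _] =
    \big[setU/set0]_(c <- enum C) [set w | X t w = c]).
  by apply: bigsetU_measurable => c _; exact: mX.
rewrite -bigcup_seq; apply/seteqP; split => w /=.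
  by move=> CX; exists (X t w) => //=; rewrite mem_enum.
by move=> [c /= + ->]; rewrite mem_enum.
Qed.

Lemma measurable_avoid delta n : 0 <= delta -> measurable (avoid delta n).
Proof.
move=> d0; rewrite (_ : avoid delta n =
    \bigcap_(i in [set i | (i <= n)%N]) [set w | ~~ B (X (i%:R * delta) w)]).
  apply: bigcap_measurable; first by exists 0%N.
  by move=> i _; apply: (mXB (fun c => ~~ B c)); rewrite mulr_ge0.
by apply/seteqP; split => w /=.
Qed.

(** The transition function is hidden in [markov_process], hence the existential. The Markov
    property speaks of fully prescribed paths, so the avoidance event is split according to the
    states visited, one step at a time. *)
Lemma probability_avoid : exists2 p, transition_function q p &
  forall delta, 0 <= delta -> forall n,
    P (avoid delta n) = (survival p B delta n a)%:E.
Proof.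
case: MX => _ _ [p tp fdd]; exists p => // delta d0 n.
pose u (i : nat) := i%:R * delta.
have u_homo : {homo u : i j / (i <= j)%N >-> i <= j}.
  by move=> i j ij; rewrite ler_wpM2r// ler_nat.
have u0 : 0 <= u 0%N by rewrite /u mul0r.
have ui i : 0 <= u i by rewrite mulr_ge0.
pose path m (x : nat -> S) := [set w | forall i, (i <= m)%N -> X (u i) w = x i].
(* Path prescribed up to step m, then only required to avoid B during k steps: the form in which the
   induction on k, for all m and x, goes through. *)
pose E m k x := path m x `&`
  [set w | forall i, (m < i <= m + k)%N -> ~~ B (X (u i) w)].
have mpath m x : measurable (path m x).
  rewrite (_ : path m x =
      \bigcap_(i in [set i | (i <= m)%N]) [set w | X (u i) w = x i]).
    apply: bigcap_measurable; first by exists 0%N.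
    by move=> i _; exact: mX.
  by apply/seteqP; split => w /=.
have mE m k x : measurable (E m k x).
  apply: measurableI => //.
  have [->|k0] := posnP k.
    rewrite addn0 (_ : [set w | _] = setT)//; apply/seteqP; split => w //= _ i.
    by rewrite andbC leqNgt => /andP[/negP].
  rewrite (_ : [set w | _] =
    \bigcap_(i in [set i | (m < i <= m + k)%N]) [set w | ~~ B (X (u i) w)]).
    apply: bigcap_measurable.
      by exists m.+1 => /=; rewrite ltnSn/= -addn1 leq_add2l.
    by move=> i _; exact: (mXB (fun c => ~~ B c)).
  by apply/seteqP; split => w /=.
have EE k : forall m x, P (E m k x) = (P (path m x) *
    (survival p B delta k (x m))%:E)%E.
  elim: k => [|k IH] m x /=.
    rewrite mule1; congr (P _); apply/seteqP; split => w; first by case.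
    by split=> // i; rewrite addn0 andbC leqNgt => /andP[/negP].
  pose x' c := fun i => if i == m.+1 then c else x i.
  pose s := enum (fun c => ~~ B c).
  have Es : E m k.+1 x = \bigcup_(c in [set` s]) E m.+1 k (x' c).
    apply/seteqP; split=> w /=.
      move=> [xw Bw]; exists (X (u m.+1) w) => /=.
        by rewrite mem_enum; apply: Bw; rewrite ltnSn/= addnS ltnS leq_addr.
      split=> i; last by move=> /andP[mi ik]; apply: Bw; rewrite (ltnW mi) addnS.
      by rewrite leq_eqVlt /x' => /predU1P[->|im]; [rewrite eqxx|
        rewrite ltn_eqF//; exact: xw].
    move=> [c /=]; rewrite mem_enum => Bc [xw Bw].
    have xm : X (u m.+1) w = c by rewrite xw// /x' eqxx.
    split=> i im; first by rewrite xw ?(leqW im)// /x' ltn_eqF.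
    have [->|im1] := eqVneq i m.+1; first by rewrite xm.
    by move: im => /andP[mi ik]; apply: Bw; rewrite ltn_neqAle eq_sym im1 mi addSnnS.
  rewrite Es measure_fin_bigcup//; last first.
    move=> c c' _ _ [w [[h1 _] [h2 _]]].
    by have := h1 m.+1 (leqnn _); rewrite h2// /x' eqxx.
  rewrite -fsbig_seq ?enum_uniq// big_enum/=.
  rewrite -[P (path m x)]fineK ?fin_num_measure// -EFinM mulr_sumr -sumEFin.
  apply: eq_bigr => c _; rewrite IH /path fdd// /x' eqxx ltn_eqF//.
  have -> : u m.+1 - u m = delta by rewrite /u -natr1; ring.
  rewrite (_ : [set w | _] = path m x); last first.
    by apply/seteqP; split=> w /= + i im => /(_ i im); rewrite ltn_eqF.
  by rewrite -[P (path m x)]fineK ?fin_num_measure// -!EFinM mulrA.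
have mA := measurable_avoid n d0.
have mD : measurable [set w | X 0 w = a] by exact: mX.
have PD : P (~` [set w | X 0 w = a]) = 0%E.
  by rewrite probability_setC// X0 subee.
have <- : P (E 0%N n (fun=> a)) = (survival p B delta n a)%:E.
  rewrite EE (_ : path 0%N _ = [set w | X 0 w = a]) ?X0 ?mul1e//.
  apply/seteqP; split=> w /=.
    by move=> /(_ 0%N (leqnn _)); rewrite /u mul0r.
  by move=> Xa i; rewrite leqn0 => /eqP ->; rewrite /u mul0r.
have E0 : E 0%N n (fun=> a) = avoid delta n `&` [set w | X 0 w = a].
  apply/seteqP; split=> w /=.
    move=> [h1 h2]; have Xa : X 0 w = a by have := h1 0%N (leqnn _); rewrite /u mul0r.
    split=> // i il; have [->|i0] := posnP i; first by rewrite mul0r Xa.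
    by apply: h2; rewrite i0.
  move=> [h1 Xa]; split=> i /=; last by move=> /andP[_]; rewrite add0n; exact: h1.
  by rewrite leqn0 => /eqP ->; rewrite /u mul0r.
have mAD : measurable (avoid delta n `&` [set w | X 0 w = a]) by exact: measurableI.
have mC : measurable (~` [set w | X 0 w = a]) by exact: measurableC.
apply/eqP; rewrite E0 eq_le; apply/andP; split.
  rewrite -(measureU0 mAD mC PD); apply: le_measure; rewrite ?inE//.
    exact: measurableU.
  by move=> w /= Aw; have [Xa|Xa] := pselect (X 0 w = a); [left|right].
by apply: le_measure; rewrite ?inE// => w [].
Qed.

(** Time 0 is included here and excluded in [transition_time]; [transition_timeE] reconciles the
    two. *)
Definition hitting_time (w : T) : \bar R :=
  ereal_inf [set t%:E | t in [set t : R | 0 <= t /\ B (X t w)]].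

(** exp(-sigma h), with value 0 at infinity. The value at -oo is a default one, as hitting times are
    nonnegative. *)
Definition discount (sigma : R) (h : \bar R) : R :=
  if h is r%:E then expR (- sigma * r) else 0.

Let rightX w t : 0 <= t -> exists2 e : R, 0 < e &
  forall s, t <= s < t + e -> X s w = X t w.
Proof.
move=> t0; case: MX => _ /(_ w _ t0) [e /= e0 He] _; exists e => // s /andP[ts se].
have [->//|ts'] := eqVneq s t.
apply: He => /=; last by rewrite lt_neqAle eq_sym ts'.
by rewrite distrC ger0_norm ?subr_ge0// ltrBlDl.
Qed.

Lemma hitting_time_ge0 w : (0 <= hitting_time w)%E.
Proof. by apply: le_ereal_inf_tmp => _ [t [t0 _] <-]; rewrite lee_fin. Qed.

Lemma le_hitting_time w (s : R) :
  (s%:E <= hitting_time w)%E <-> forall t, 0 <= t < s -> ~~ B (X t w).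
Proof.
split=> [sH t /andP[t0 ts]|H].
  apply/negP => BX; suff : (hitting_time w <= t%:E)%E.
    by move/(le_trans sH); rewrite lee_fin leNgt ts.
  by apply: ereal_inf_lbound; exists t.
apply: le_ereal_inf_tmp => _ [t [t0 Bt] <-]; rewrite lee_fin leNgt; apply/negP => ts.
by have := H t; rewrite t0 ts Bt => /(_ isT).
Qed.

(** Right continuity in a discrete space: the infimum is attained and the path stays in B for some
    time, so a fine enough skeleton sees the visit. *)
Lemma hitting_time_attained w (h : R) : hitting_time w = h%:E ->
  exists2 e : R, 0 < e & forall s, h <= s < h + e -> B (X s w).
Proof.
move=> Hh; have h0 : 0 <= h by rewrite -lee_fin -Hh hitting_time_ge0.
have [e e0 He] := rightX w h0; exists e => // s hs; rewrite He//.
apply: contrapT => /negP nB.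
suff : ((h + e)%:E <= hitting_time w)%E by rewrite Hh lee_fin gerDl leNgt e0.
apply/le_hitting_time => t /andP[t0 te]; have [th|ht] := ltP t h; last first.
  by rewrite He// ht.
have : (h%:E <= hitting_time w)%E by rewrite Hh.
by move/le_hitting_time; apply; rewrite t0.
Qed.

(** A geometric sum: if i <= N is the first index at which the skeleton is in B, it equals 1 -
    exp(-sigma i delta). *)
Definition discounted_path (sigma delta : R) N (w : T) : R :=
  (1 - expR (- sigma * delta)) *
    \sum_(n < N) expR (- sigma * delta) ^+ n * \1_(avoid delta n) w.

Let avoid_indic delta n w : 0 <= delta ->
  ((n%:R * delta)%:E < hitting_time w)%E -> avoid delta n w.
Proof.
move=> d0 nH i il.
have : ((i%:R * delta)%:E < hitting_time w)%E.
  by apply: le_lt_trans nH; rewrite lee_fin ler_wpM2r// ler_nat.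
move=> iH; apply/negP => BX; move: iH; rewrite ltNge => /negP; apply.
by apply: ereal_inf_lbound; exists (i%:R * delta) => //; split; rewrite ?mulr_ge0.
Qed.

(** The mesh 1/(n + 1) and the number (n + 1)^2 of points are such that the mesh tends to 0 while
    the grid covers a window of length n + 1, which tends to infinity. *)
Lemma cvg_discounted_path (sigma : R) w : 0 < sigma ->
  discounted_path sigma n.+1%:R^-1 (n.+1 ^ 2) w @[n --> \oo] -->
  1 - discount sigma (hitting_time w).
Proof.
move=> s0.
pose dl (n : nat) : R := n.+1%:R^-1.
have dl0 n : 0 < dl n by rewrite invr_gt0.
have geo (x : R) N : (1 - x) * \sum_(n < N) x ^+ n = 1 - x ^+ N.
  by rewrite -[1 - x ^+ N]opprB subrX1 -mulNr opprB.
have expE (n i : nat) : expR (- sigma * dl n) ^+ i = expR (- sigma * (i%:R * dl n)).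
  by rewrite -expRM_natl; congr expR; rewrite -mulr_natl; ring.
have dlc : dl n @[n --> \oo] --> (0 : R) by exact: cvg_harmonic.
have dlN n : (n.+1 ^ 2)%:R * dl n = n.+1%:R :> R.
  by rewrite natrX expr2 -mulrA /dl divff ?mulr1.
case Hh : (hitting_time w) => [h| |]; last first.
- by have := hitting_time_ge0 w; rewrite Hh.
- rewrite /= subr0.
  have H n : discounted_path sigma n.+1%:R^-1 (n.+1 ^ 2) w =
      1 - expR (- sigma) ^+ n.+1.
    rewrite /discounted_path -[RHS](_ : 1 - expR (- sigma * dl n) ^+ (n.+1 ^ 2) = _).
      rewrite -geo; congr (_ * _); apply: eq_bigr => i _.
      rewrite indicE mem_set/= ?mulr1//; apply: avoid_indic; first exact: ltW.
      by rewrite Hh ltry.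
    by rewrite expE dlN -expRM_natl; congr (_ - expR _); rewrite -mulr_natl; ring.
  rewrite (_ : (fun n => _) = (fun n => 1 - expR (- sigma) ^+ n.+1)); last first.
    exact/funext.
  rewrite -[X in _ --> X]subr0; apply: cvgB; first exact: cvg_cst.
  have e1 : `|expR (- sigma)| < 1.
    by rewrite ger0_norm ?expR_ge0// -[ltRHS]expR0 ltr_expR oppr_lt0.
  by have := cvg_expr e1; rewrite -(cvg_shiftS (fun n => expR (- sigma) ^+ n)).
have h0 : 0 <= h by rewrite -lee_fin -Hh hitting_time_ge0.
have [e e0 He] := hitting_time_attained Hh.
rewrite /=.
apply: (@squeeze_cvgr _ _ _ _ (cst (1 - expR (- sigma * h)))
  (fun n => 1 - expR (- sigma * (h + dl n)))).
- near=> n.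
  have dn : dl n < e.
    near: n; move/cvgrPdist_lt/(_ _ e0): dlc; apply: filterS => n.
    by rewrite sub0r normrN ger0_norm// ltW.
  have hn : h + 1 <= n.+1%:R 
    by near: n; apply: filterS (nbhs_infty_ger (h + 1)) => n /le_trans; apply;
      rewrite ler_nat.
  (* i is h / [dl n] rounded up. Since [dl n < e], this grid point lies in the interval that the
     path spends in B after h. *)
  have [i /andP[hi1 hi2]] : exists i : nat, h <= i%:R * dl n < h + dl n.
    have : 0 <= h / dl n by rewrite divr_ge0// ltW.
    move=> /truncn_itv; set t := Num.truncn _ => /andP[t1 t2].
    have [th|th] := eqVneq (t%:R : R) (h / dl n).
      by exists t; rewrite th divfK ?gt_eqF// lexx/= ltrDl dl0.
    exists t.+1; rewrite -ler_pdivrMr// ltW//= -ltr_pdivlMr// mulrDl divff ?gt_eqF//.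
    by rewrite -natr1 ltrD2r lt_neqAle th.
  have iN : (i <= n.+1 ^ 2)%N.
    have d1 : dl n <= 1 by rewrite /dl invf_le1 ?ler1n.
    rewrite -(ler_nat R) -(ler_pM2r (dl0 n)) dlN; lra.
  have -> : discounted_path sigma n.+1%:R^-1 (n.+1 ^ 2) w =
      1 - expR (- sigma * (i%:R * dl n)).
    rewrite -expE -geo /discounted_path; congr (_ * _).
    rewrite [RHS](big_ord_widen _ (fun j => expR (- sigma * dl n) ^+ j) iN).
    rewrite [RHS]big_mkcond; apply: eq_bigr => j _; rewrite indicE.
    case: ltnP => ji.
      rewrite mem_set ?mulr1//; apply: avoid_indic; first exact: ltW.
      rewrite Hh lte_fin -/(dl n).
      have h1 : j.+1%:R * dl n <= i%:R * dl n by rewrite ler_pM2r// ler_nat.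
      by rewrite -natr1 mulrDl mul1r in h1; lra.
    rewrite memNset ?mulr0// => /(_ i ji); apply/negP; rewrite negbK.
    by apply: He; rewrite hi1 (lt_trans hi2)// ltrD2l.
  rewrite !lerD2l !lerN2 !ler_expR !mulNr !lerN2 !ler_pM2l//.
  by rewrite hi1 ltW.
- exact: cvg_cst.
- apply: cvgB; first exact: cvg_cst.
  have c1 : - sigma * (h + dl n) @[n --> \oo] --> - sigma * h.
    apply: cvgMr; rewrite -[X in _ --> X]addr0; apply: cvgD => //; exact: cvg_cst.
  by apply: continuous_cvg c1; exact: continuous_expR.
Unshelve. all: by end_near. Qed.

(** The hitting time is an infimum over uncountably many times; as a pointwise limit of functions of
    the skeletons its discount is measurable. *)
Lemma measurable_discount sigma : 0 < sigma ->
  measurable_fun setT (fun w => discount sigma (hitting_time w)).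
Proof.
move=> s0; apply: (@measurable_fun_cvg _ _ _ _
  (fun n w => 1 - discounted_path sigma n.+1%:R^-1 (n.+1 ^ 2) w)) => [n|w _].
  apply: measurable_funB => //; apply: measurable_funM => //.
  apply: measurable_sum => i; apply: measurable_funM => //.
  by apply: measurable_indic; apply: measurable_avoid; rewrite invr_ge0.
rewrite -[X in _ --> X](subKr 1); apply: cvgB; first exact: cvg_cst.
exact: cvg_discounted_path.
Qed.

Lemma discount_itv sigma w : 0 < sigma -> 0 <= discount sigma (hitting_time w) <= 1.
Proof.
move=> s0; rewrite /discount; have := hitting_time_ge0 w.
case: (hitting_time w) => [h|_|//]; last by rewrite lexx ler01.
rewrite lee_fin => h0; rewrite expR_ge0/= -[leRHS]expR0 ler_expR mulNr.
by rewrite oppr_le0 mulr_ge0// ltW.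
Qed.

Section laplace.
Variable sigma : R.
Hypothesis sigma0 : 0 < sigma.

Let cvg_discounted p : transition_function q p ->
    (forall delta, 0 <= delta -> forall n,
      P (avoid delta n) = (survival p B delta n a)%:E) ->
  sigma * discounted p B sigma n.+1%:R^-1 (n.+1 ^ 2) a @[n --> \oo] -->
  1 - \int[P]_w discount sigma (hitting_time w).
Proof.
move=> tp Pavoid; pose dl (n : nat) : R := n.+1%:R^-1.
have dl0 n : 0 < dl n by rewrite invr_gt0.
have e01 n : 0 <= expR (- sigma * dl n) <= 1.
  rewrite expR_ge0/= -[leRHS]expR0 ler_expR mulNr oppr_le0.
  by rewrite mulr_ge0// ltW.
have mI n i : measurable_fun setT (\1_(avoid (dl n) i) : T -> R).
  by apply: measurable_indic; apply: measurable_avoid; rewrite ltW.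
have I1 n i w : `|(\1_(avoid (dl n) i) w : R)| <= 1.
  by rewrite indicE; case: (w \in _); rewrite ?normr1 ?normr0.
have path1 n w : `|discounted_path sigma (dl n) (n.+1 ^ 2) w| <= 1.
  have /andP[e0 e1] := e01 n.
  have s0 : 0 <= \sum_(i < n.+1 ^ 2)
      expR (- sigma * dl n) ^+ i * (\1_(avoid (dl n) i) w : R).
    by apply: sumr_ge0 => i _; rewrite mulr_ge0 ?exprn_ge0.
  rewrite /discounted_path ger0_norm ?mulr_ge0 ?subr_ge0//.
  apply: (@le_trans _ _ ((1 - expR (- sigma * dl n)) *
      \sum_(i < n.+1 ^ 2) expR (- sigma * dl n) ^+ i)).
    rewrite ler_wpM2l ?subr_ge0//; apply: ler_sum => i _.
    rewrite -[leRHS]mulr1 ler_wpM2l ?exprn_ge0//.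
  rewrite -[1 - _]opprB mulNr -subrX1 opprB gerBl.
  by rewrite exprn_ge0.
have mpath n : measurable_fun setT (discounted_path sigma (dl n) (n.+1 ^ 2)).
  apply: measurable_funM => //; apply: measurable_sum => i.
  exact: measurable_funM.
have intp n : \int[P]_w discounted_path sigma (dl n) (n.+1 ^ 2) w =
    (1 - expR (- sigma * dl n)) / dl n * discounted p B sigma (dl n) (n.+1 ^ 2) a.
  rewrite /discounted_path.
  under eq_Rintegral do rewrite mulr_sumr.
  under eq_Rintegral do under eq_bigr do rewrite mulrA.
  rewrite (@Rintegral_lincomb _ _ _ P _
    (fun i => (1 - expR (- sigma * dl n)) * expR (- sigma * dl n) ^+ i)
    (fun i => \1_(avoid (dl n) i)))//.
  rewrite /discounted mulrA divfK ?gt_eqF// mulr_sumr; apply: eq_bigr => i _.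
  rewrite Rintegral_indic; last by apply: measurable_avoid; rewrite ltW.
  by rewrite Pavoid ?(ltW (dl0 n))//= mulrA.
have lim : \int[P]_w discounted_path sigma (dl n) (n.+1 ^ 2) w @[n --> \oo] -->
    \int[P]_w (1 - discount sigma (hitting_time w)).
  by apply: cvg_Rintegral_bounded => // w; exact: cvg_discounted_path.
rewrite -Rintegral_1B; [|exact: measurable_discount|]; last first.
  by move=> w; have /andP[h0 h1] := discount_itv w sigma0; rewrite ger0_norm.
have quot : (1 - expR (- sigma * dl n)) / dl n @[n --> \oo] --> sigma.
  have H := cvg_expR_quotient (ltW sigma0).
  have := cvg_comp _ _ (@cvg_harmonic_right R) H; move/cvgN; rewrite opprK.
  apply: cvg_trans; apply: near_eq_cvg; apply: nearW => n /=.
  by rewrite -mulNr opprB.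
have quot' : sigma / ((1 - expR (- sigma * dl n)) / dl n) @[n --> \oo] --> (1 : R).
  rewrite -[X in _ --> X](@divff _ sigma); last by rewrite gt_eqF.
  by apply: cvgM; [exact: cvg_cst|apply: cvgV => //; rewrite gt_eqF].
rewrite (_ : (fun n => _) = (fun n => sigma / ((1 - expR (- sigma * dl n)) / dl n) *
    \int[P]_w discounted_path sigma (dl n) (n.+1 ^ 2) w)); last first.
  apply/funext => n; rewrite intp.
  have e1 : expR (- sigma * dl n) < 1.
    by rewrite -[ltRHS]expR0 ltr_expR mulNr oppr_lt0 mulr_gt0.
  have A0 : (1 - expR (- sigma * dl n)) / dl n != 0.
    by rewrite gt_eqF// divr_gt0// subr_gt0.
  by move: (_ / dl n) A0 => A A0; rewrite [RHS]mulrA divfK.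
by rewrite -[X in _ --> X]mul1r; exact: cvgM.
Qed.

Let near_drift p (g : S -> R) (eps : R) : transition_function q p -> 0 < eps ->
  \forall n \near \oo, forall b,
    `|expR (- sigma * n.+1%:R^-1) * (\sum_c p n.+1%:R^-1 b c * g c) - g b
      - n.+1%:R^-1 * (drift q g b - sigma * g b)| <= eps * n.+1%:R^-1.
Proof.
move=> tp eps0; apply: filter_forall => b.
have H := @cvg_drift _ _ _ _ tp sigma g b (ltW sigma0).
have := cvg_comp _ _ (@cvg_harmonic_right R) H; move/cvgrPdist_le/(_ _ eps0); apply: filterS => n /=.
have d0 : 0 < n.+1%:R^-1 :> R by rewrite invr_gt0.
set u := expR _ * _ - _; set v := drift _ _ _ - _; set dl := n.+1%:R^-1 in d0 *.
rewrite distrC => h.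
rewrite (_ : u - dl * v = (u / dl - v) * dl); last first.
  by rewrite mulrBl divfK ?gt_eqF// [v * _]mulrC.
by rewrite normrM (gtr0_norm d0) ler_wpM2r// ltW.
Qed.

Lemma laplace_hitting_time_le (g : S -> R) :
  (forall c, 0 <= g c) ->
  (forall c, ~~ B c -> drift q g c - sigma * g c <= -1) ->
  1 - \int[P]_w discount sigma (hitting_time w) <= sigma * g a.
Proof.
move=> g0 gD; have [p tp Pavoid] := probability_avoid.
have lim := cvg_discounted tp Pavoid.
have H eps : 0 < eps -> eps <= 1 ->
    (1 - eps) * (1 - \int[P]_w discount sigma (hitting_time w)) <= sigma * g a.
  move=> e0 e1.
  have lim' : (1 - eps) * (sigma * discounted p B sigma n.+1%:R^-1 (n.+1 ^ 2) a)
      @[n --> \oo] --> (1 - eps) * (1 - \int[P]_w discount sigma (hitting_time w)).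
    exact: cvgMr.
  rewrite -(cvg_lim (@Rhausdorff R) lim').
  apply: limr_le; first by apply/cvg_ex; eexists; exact: lim'.
  apply: filterS (near_drift g tp e0) => n geps.
  rewrite mulrCA ler_wpM2l ?(ltW sigma0)//.
  apply: (@discounted_le _ _ _ _ tp _ _ _ _ g) => //.
  + by move=> c Bc; split => //; exact: gD.
apply/ler_addgt0Pr => e e0.
set I := 1 - _.
pose eps := Num.min 1 (e / (1 + `|I|)).
have I0 : 0 < 1 + `|I| by rewrite ltr_pwDl.
have eps0 : 0 < eps by rewrite lt_min ltr01 divr_gt0.
have eps1 : eps <= 1 by rewrite ge_min lexx.
have := H _ eps0 eps1; rewrite -/I mulrBl mul1r.
have : eps * I <= e.
  have h1 : eps * (1 + `|I|) <= e by rewrite -ler_pdivlMr// ge_min lexx orbT.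
  have h2 : eps * I <= eps * (1 + `|I|).
    by rewrite ler_pM2l// (le_trans (ler_norm I))// lerDr.
  exact: le_trans h1.
by lra.
Qed.

Lemma laplace_hitting_time_ge (g : S -> R) :
  (forall c, B c -> g c <= 0) ->
  (forall c, ~~ B c -> -1 <= drift q g c - sigma * g c) ->
  sigma * g a <= 1 - \int[P]_w discount sigma (hitting_time w).
Proof.
move=> g0 gD; have [p tp Pavoid] := probability_avoid.
have lim := cvg_discounted tp Pavoid.
pose C := \sum_c `|g c|.
have C0 : 0 <= C by exact: sumr_ge0.
have gC c : g c <= C.
  by rewrite /C (bigD1 c)//= (le_trans (ler_norm _))// lerDl sumr_ge0.
have H eps : 0 < eps -> sigma * g a <=
    (1 + eps) * (1 - \int[P]_w discount sigma (hitting_time w)).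
  move=> e0.
  have e1 : `|expR (- sigma)| < 1.
    by rewrite ger0_norm ?expR_ge0// -[ltRHS]expR0 ltr_expR oppr_lt0.
  (* The truncation error of [discounted_ge] is C exp(-sigma (n + 1)) on a window of length n + 1,
     and disappears in the limit. *)
  have lim' : (1 + eps) * (sigma * discounted p B sigma n.+1%:R^-1 (n.+1 ^ 2) a)
      + sigma * (C * expR (- sigma) ^+ n.+1) @[n --> \oo] -->
      (1 + eps) * (1 - \int[P]_w discount sigma (hitting_time w)) + sigma * (C * 0).
    apply: cvgD; first exact: cvgMr.
    apply: cvgMr; apply: cvgMr.
    by have := cvg_expr e1; rewrite -(cvg_shiftS (fun n => expR (- sigma) ^+ n)).
  rewrite -[leRHS]addr0 -[X in _ <= _ + X](mulr0 sigma) -[X in _ <= _ + _ * X](mulr0 C).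
  rewrite -(cvg_lim (@Rhausdorff R) lim').
  apply: limr_ge; first by apply/cvg_ex; eexists; exact: lim'.
  apply: filterS (near_drift g tp e0) => n geps.
  have d0 : 0 <= n.+1%:R^-1 :> R by rewrite invr_ge0.
  have h := @discounted_ge _ _ _ _ tp B sigma n.+1%:R^-1 eps g d0
    (fun b _ => geps b) (n.+1 ^ 2) a C g0 gD C0 gC (ltW e0) aB.
  have := ler_wpM2l (ltW sigma0) h.
  have -> : expR (- sigma * n.+1%:R^-1) ^+ (n.+1 ^ 2) = expR (- sigma) ^+ n.+1.
    rewrite -mulnn exprM -expRM_natl -mulr_natl; congr (expR _ ^+ _).
    by rewrite mulrCA divff ?mulr1.
  by rewrite mulrBr; lra.
apply/ler_addgt0Pr => e e0.
set I := 1 - _.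
have I0 : 0 < 1 + `|I| by rewrite ltr_pwDl.
have eps0 : 0 < e / (1 + `|I|) by rewrite divr_gt0.
have := H _ eps0; rewrite -/I mulrDl mul1r.
have : e / (1 + `|I|) * I <= e.
  rewrite mulrAC ler_pdivrMr// ler_pM2l//.
  by rewrite (le_trans (ler_norm I))// lerDr.
by lra.
Qed.
End laplace.

(** (1 - exp(-sigma H)) / sigma at sigma = 1/(n + 1): bounded, at most H, and convergent to H even
    where H is infinite. It carries the Laplace bounds over to the mean. *)
Let quotient n w : R := n.+1%:R * (1 - discount n.+1%:R^-1 (hitting_time w)).

Let quotient_ge0 n w : 0 <= quotient n w.
Proof.
have d0 : 0 < n.+1%:R^-1 :> R by rewrite invr_gt0.
by have /andP[_ h1] := discount_itv w d0; rewrite mulr_ge0// subr_ge0.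
Qed.

Let quotient_le n w : ((quotient n w)%:E <= hitting_time w)%E.
Proof.
have := hitting_time_ge0 w; rewrite /quotient.
case: (hitting_time w) => [h| |//] h0; last by rewrite leey.
rewrite lee_fin -ler_pdivlMl// /=.
rewrite mulNr; move: (n.+1%:R^-1 * h) => x; clear h0.
by have := expR_ge1Dx (- x); lra.
Qed.

Let cvg_quotient w : ((quotient n w)%:E @[n --> \oo] --> hitting_time w)%E.
Proof.
have := hitting_time_ge0 w; rewrite /quotient.
case: (hitting_time w) => [h| |//] h0; last first.
  apply/cvgeryP; rewrite /= (_ : (fun n => _) = (fun n => n.+1%:R)); last first.
    by apply/funext => n; rewrite subr0 mulr1.
  apply/cvgryPge => A; apply: filterS (nbhs_infty_ger A) => n /le_trans; apply.
  by rewrite ler_nat.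
apply: cvg_EFin; first exact: nearW.
have h0' : 0 <= h by rewrite -lee_fin.
have := cvg_comp _ _ (@cvg_harmonic_right R) (cvg_expR_quotient h0'); move/cvgN; rewrite opprK.
apply: cvg_trans; apply: near_eq_cvg; apply: nearW => n /=.
rewrite -[LHS]/(- ((expR (- h * n.+1%:R^-1) - 1) / n.+1%:R^-1)).
by rewrite invrK mulrC -mulrN opprB !mulNr [h * _]mulrC.
Qed.

Let measurable_quotient n : measurable_fun setT (quotient n).
Proof.
apply: measurable_funM => //; apply: measurable_funB => //.
by apply: measurable_discount; rewrite invr_gt0.
Qed.

Lemma measurable_hitting_time : measurable_fun setT hitting_time.
Proof.
apply: (emeasurable_fun_cvg (fun n w => (quotient n w)%:E)) => [n|w _].
  exact/measurable_EFinP.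
exact: cvg_quotient.
Qed.

Let integral_quotient n : (\int[P]_w (quotient n w)%:E =
  (n.+1%:R * (1 - \int[P]_w discount n.+1%:R^-1 (hitting_time w))%R)%:E)%E.
Proof.
have d0 : 0 < n.+1%:R^-1 :> R by rewrite invr_gt0.
have md : measurable_fun setT (fun w => discount n.+1%:R^-1 (hitting_time w)).
  exact: measurable_discount.
have d1 w : `|discount n.+1%:R^-1 (hitting_time w)| <= 1.
  by have /andP[h1 h2] := discount_itv w d0; rewrite ger0_norm.
have intB : P.-integrable setT
    (EFin \o (fun w => 1 - discount n.+1%:R^-1 (hitting_time w))).
  apply: (@integrable_bounded _ _ _ _ 1) => [|w]; first exact: measurable_funB.
  by have /andP[h1 h2] := discount_itv w d0; rewrite ger0_norm; lra.
rewrite -Rintegral_1B// -RintegralZl// /Rintegral fineK//.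
apply: integrable_fin_num => //.
rewrite (_ : (fun _ => _) = (fun w => n.+1%:R%:E *
  (1 - discount n.+1%:R^-1 (hitting_time w))%:E)%E); last first.
  by apply/funext => w; rewrite EFinM.
exact: integrableZl.
Qed.

(** m satisfies the upper comparison inequality for every sigma > 0, and Fatou's lemma gives the
    upper bound; the lower bound needs m slightly reduced. Finiteness of the mean is part of the
    conclusion. *)
Lemma mean_hitting_time (m : S -> R) :
  (forall c, 0 <= m c) -> (forall c, B c -> m c = 0) ->
  (forall c, ~~ B c -> drift q m c = -1) ->
  (\int[P]_w hitting_time w = (m a)%:E)%E.
Proof.
move=> m0 mB mD; pose dl n : R := n.+1%:R^-1.
have d0 n : 0 < dl n by rewrite invr_gt0.
have dn n : n.+1%:R = (dl n)^-1 by rewrite invrK.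
apply/eqP; rewrite eq_le; apply/andP; split.
  have -> : (\int[P]_w hitting_time w =
      \int[P]_w limn_einf (fun n => (quotient n w)%:E))%E.
    apply: eq_integral => w _; by have [-> _] := cvg_limn_einf_sup (@cvg_quotient w).
  apply: le_trans (fatou _ _ _ _) _ => //.
  - by move=> n; exact/measurable_EFinP.
  - by move=> n w _; rewrite lee_fin.
  rewrite limn_einf_lim; apply: lime_le; first exact: is_cvg_einfs.
  apply: nearW => n; apply: (@le_trans _ _ (\int[P]_w (quotient n w)%:E)%E).
    by apply: ereal_inf_lbound; exists n => /=.
  rewrite integral_quotient lee_fin dn -/(dl n) -ler_pdivlMl ?invr_gt0// invrK.
  apply: (laplace_hitting_time_le (d0 n)) => // c Bc.
  by rewrite mD// gerDl oppr_le0 mulr_ge0// ltW.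
(* Any upper bound of m would do: m / (1 + sigma C) has drift -1/(1 + sigma C), and its discount
   term is at least -sigma C/(1 + sigma C), which add up to -1. *)
pose C := \sum_c m c.
have C0 : 0 <= C by exact: sumr_ge0.
have mC c : m c <= C by rewrite /C (bigD1 c)//= lerDl sumr_ge0.
have H n : ((m a / (1 + dl n * C))%:E <= \int[P]_w hitting_time w)%E.
  have p0 : 0 < 1 + dl n * C by rewrite ltr_pwDl// mulr_ge0// ltW.
  apply: (@le_trans _ _ (\int[P]_w (quotient n w)%:E)%E); last first.
    apply: ge0_le_integral => //.
    - by move=> w _; rewrite lee_fin.
    - exact/measurable_EFinP.
    - exact: measurable_hitting_time.
  rewrite integral_quotient lee_fin dn -/(dl n) -ler_pdivrMl ?invr_gt0// invrK.
  apply: (laplace_hitting_time_ge (d0 n) (g := fun c => m c / (1 + dl n * C))).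
    by move=> c Bc; rewrite mB// mul0r.
  move=> c Bc; have -> : drift q (fun c => m c / (1 + dl n * C)) c =
      drift q m c / (1 + dl n * C).
    by rewrite /drift mulr_suml; apply: eq_bigr => b _; rewrite -mulrBl mulrA.
  rewrite mD// mulrA -mulrBl ler_pdivlMr// mulN1r -opprD lerN2 lerD2l.
  by rewrite ler_pM2l.
have : m a / (1 + dl n * C) @[n --> \oo] --> m a / (1 + 0 * C).
  apply: cvgM; first exact: cvg_cst.
  apply: cvgV; first by rewrite mul0r addr0.
  apply: cvgD; first exact: cvg_cst.
  by apply: cvgMl; exact: cvg_harmonic.
rewrite mul0r addr0 divr1 => c.
case E : (\int[P]_w hitting_time w)%E => [r| |]; last 2 first.
- by rewrite leey.
- by have := H 0%N; rewrite E.
rewrite lee_fin -(cvg_lim (@Rhausdorff R) c).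
apply: limr_le; first by apply/cvg_ex; exists (m a).
by apply: nearW => n; have := H n; rewrite E lee_fin.
Qed.
End hitting.

(* No measurability of [f] is required: the lower integral is bounded by any
   simple function below [f]. *)
Lemma measure_le_integral (R : realType) d (T : measurableType d)
    (mu : {measure set T -> \bar R}) (D A : set T) (f : T -> \bar R) :
  measurable A -> A `<=` D -> (forall x, 0 <= f x)%E -> (forall x, A x -> f x = 1%E) ->
  (mu A <= \int[mu]_(x in D) f x)%E.
Proof.
move=> mA AD f0 f1; rewrite ge0_integralE//.
rewrite -(sintegral_indic mu A); apply: ereal_sup_ubound => /=.
exists (indic_nnsfun R mA) => //= x.
rewrite -[mindic _ _ _]/(\1_A x) indicE patchE; have [xA|xA] := boolP (x \in A).
  by move/set_mem: (xA) => Ax; rewrite mem_set ?f1//; exact: AD.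
by case: ifP.
Qed.

Section paths.
Context (R : realType) (S : finType) (d : measure_display)
  (T : measurableType d) (P : probability T R) (q : S -> S -> R)
  (X : R -> T -> S).
Hypothesis MX : markov_process P q X.

(** If the path is in b at time 0, right continuity keeps it there at arbitrarily small positive
    times, and both infima are 0. *)
Lemma transition_timeE b w : transition_time X b w = hitting_time X (pred1 b) w.
Proof.
apply/eqP; rewrite eq_le; apply/andP; split; last first.
  apply: ereal_inf_le_tmp => _ [t [t0 Xt] <-]; exists t => //; split.
    exact: ltW.
  by rewrite /= Xt.
apply: le_ereal_inf_tmp => _ [t [t0 /eqP Xt] <-].
have [t1|t1] := ltP 0 t; first by apply: ereal_inf_lbound; exists t.
have {t0 t1} t0 : t = 0 by apply/eqP; rewrite eq_le t1.
case: MX => _ /(_ w 0 (lexx _)) [e /= e0 He] _.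
rewrite t0; apply/lee_addgt0Pr => r r0; rewrite add0e.
pose s := Num.min r (e / 2); have s0 : 0 < s by rewrite lt_min r0 divr_gt0.
apply: (@le_trans _ _ s%:E); last by rewrite lee_fin ge_min lexx.
apply: ereal_inf_lbound; exists s => //; split => //.
rewrite -Xt t0; apply: He => //=; rewrite sub0r normrN gtr0_norm//.
have : s <= e / 2 by rewrite ge_min lexx orbT.
by lra.
Qed.

End paths.

(** A hit before t is followed by a stay of positive length, hence by positive throughput; a hit at
    t exactly costs one instant, of measure 0, hence the weak inequality. *)
Lemma throughput_eq0 (R : realType) (K : nat) (L : 'I_K -> nat)
    (d : measure_display) (T : measurableType d) (P : probability T R)
    (q : state L -> state L -> R) (X : R -> T -> state L) (k : 'I_K) (t : R) w :
  markov_process P q X -> 0 <= t ->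
  throughput X k t w = 0%E <-> (t%:E <= hitting_time X (in_component k) w)%E.
Proof.
move=> MX t0; split; last first.
  move=> /le_hitting_time av; rewrite /throughput.
  have H s : s \in `[0, t] -> ((in_component k (X s w))%:R%:E : \bar R) =
      (((in_component k (X t w))%:R)%:E * (\1_[set t] s)%:E)%E.
    rewrite in_itv/= => /andP[s0 st]; rewrite indicE.
    have [->|st'] := eqVneq s t; first by rewrite mem_set// mule1.
    rewrite memNset; last exact/eqP.
    rewrite mule0; have := av s; rewrite s0 lt_neqAle st' st => /(_ isT).
    by move/negbTE ->.
  transitivity (\int[lebesgue_measure]_(s in `[0%R, t])
      (((in_component k (X t w))%:R)%:E * (\1_[set t] s)%:E))%E.
    by apply: eq_integral => s; rewrite inE; exact: H.
  rewrite ge0_integralZl//; last first.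
    by apply/measurable_EFinP; exact: measurable_indic.
  rewrite integral_indic// (_ : _ `&` _ = [set t]).
    by rewrite [X in (_ * X)%E](lebesgue_measure_set1 t) mule0.
  by apply/seteqP; split=> s /=; [case|move=> ->; rewrite in_itv/= lexx t0].
move=> thr0; rewrite leNgt; apply/negP => Ht.
have h0 := hitting_time_ge0 X (in_component k) w.
case E : (hitting_time X (in_component k) w) Ht h0 => [h| |]//.
rewrite lte_fin lee_fin => ht h0.
have [e e0 He] := hitting_time_attained MX E.
pose u := Num.min (h + e) t.
have hu : h < u by rewrite lt_min ht ltrDl e0.
have ut : u <= t by rewrite ge_min lexx orbT.
have ue : u <= h + e by rewrite ge_min lexx.
have : (lebesgue_measure `[h, u[%classic <= throughput X k t w)%E.
  apply: measure_le_integral => //.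
  - move=> s /=; rewrite !in_itv/= => /andP[hs su].
    by rewrite (le_trans h0 hs)/= ltW// (lt_le_trans su).
  - move=> s /=; rewrite in_itv/= => /andP[hs su].
    by rewrite He// hs (lt_le_trans su).
rewrite thr0 lebesgue_measure_itv/= lte_fin hu -EFinD lee_fin leNgt subr_gt0.
by rewrite hu.
Qed.

(** * Mean times and discounted times on the star *)

Section branch.
Context (R : realType).
Implicit Types (n l : nat) (g : R).

Definition tail_weight n g l : R := \sum_(l <= i < n.+1) 'C(n, i)%:R * g ^+ i.

(* Mean time to go from level [l] to level [l - 1] in a branch of [n] levels
   with upward rates [(n - l) g] and downward rates [l]; the reversible measure
   gives weight ['C(n, l) g ^ l] to level [l]. *)
Definition step_mean n g l : R :=
  tail_weight n g l / (l%:R * 'C(n, l)%:R * g ^+ l).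

Definition level_mean n g l : R := \sum_(1 <= i < l.+1) step_mean n g i.

Lemma level_mean0 n g : level_mean n g 0 = 0.
Proof. by rewrite /level_mean big_geq. Qed.

Lemma level_meanS n g l :
  level_mean n g l.+1 = level_mean n g l + step_mean n g l.+1.
Proof. by rewrite /level_mean big_nat_recr. Qed.

Lemma tail_weight_ge0 n g l : 0 <= g -> 0 <= tail_weight n g l.
Proof. by move=> g0; apply: sumr_ge0 => i _; rewrite mulr_ge0// exprn_ge0. Qed.

Lemma step_mean_ge0 n g l : 0 <= g -> 0 <= step_mean n g l.
Proof.
by move=> g0; rewrite divr_ge0 ?tail_weight_ge0// mulr_ge0 ?exprn_ge0.
Qed.

Lemma level_mean_ge0 n g l : 0 <= g -> 0 <= level_mean n g l.
Proof. by move=> g0; apply: sumr_ge0 => i _; exact: step_mean_ge0. Qed.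

Lemma le_level_mean n g l l' : 0 <= g -> (l <= l')%N ->
  level_mean n g l <= level_mean n g l'.
Proof.
move=> g0 ll'; rewrite /level_mean (@big_cat_nat _ _ _ l.+1 1 l'.+1)//=.
by rewrite lerDl sumr_ge0// => i _; exact: step_mean_ge0.
Qed.

(** The first-step equation, by the detailed balance (n - l) C(n, l) = (l + 1) C(n, l + 1). At l = n
    the upward term has coefficient 0. *)
Lemma step_mean_rec n g l : 0 < g -> (0 < l <= n)%N ->
  l%:R * step_mean n g l = 1 + (n - l)%:R * g * step_mean n g l.+1.
Proof.
move=> g0 /andP[l0 ln].
have l0' : (l%:R : R) != 0 by rewrite pnatr_eq0 -lt0n.
have c0 : ('C(n, l)%:R : R) != 0 by rewrite pnatr_eq0 -lt0n bin_gt0.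
have gl : g ^+ l != 0 by rewrite expf_eq0 (gt_eqF g0) andbF.
have g0' : g != 0 by rewrite gt_eqF.
have E : tail_weight n g l = 'C(n, l)%:R * g ^+ l + tail_weight n g l.+1.
  by rewrite /tail_weight big_ltn.
rewrite /step_mean E.
have [ln'|nl] := ltnP l n; last first.
  have nl' : n = l by apply/eqP; rewrite eqn_leq nl.
  rewrite /tail_weight big_geq ?nl'// subnn !mul0r !addr0 -nl'.
  by move: l0' c0 gl; rewrite -nl' => l0' c0 gl; field; rewrite l0' c0 gl.
have c1 : ('C(n, l.+1)%:R : R) != 0 by rewrite pnatr_eq0 -lt0n bin_gt0.
have key : (n - l)%:R * 'C(n, l)%:R = l.+1%:R * 'C(n, l.+1)%:R :> R.
  by rewrite -!natrM mul_bin_left.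
have l1 : (l.+1%:R : R) != 0 by rewrite pnatr_eq0.
rewrite exprS -key.
have nl0 : ((n - l)%:R : R) != 0 by rewrite pnatr_eq0 subn_eq0 -ltnNge.
by field; rewrite l0' c0 gl g0' nl0.
Qed.

(** Entrance rate times mean excursion is the reversible weight of levels 1 to n, summed by the
    binomial theorem. *)
Lemma level_mean1 n g : 0 < g -> (0 < n)%N ->
  n%:R * g * level_mean n g 1 = (1 + g) ^+ n - 1.
Proof.
move=> g0 n0.
have -> : level_mean n g 1 = step_mean n g 1 by rewrite level_meanS level_mean0 add0r.
have E : (1 + g) ^+ n = 1 + tail_weight n g 1.
  rewrite exprDn /tail_weight.
  under eq_bigr do rewrite expr1n mul1r -mulr_natl.
  rewrite -(big_mkord xpredT (fun i => 'C(n, i)%:R * g ^+ i)) big_ltn//.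
  by rewrite bin0 expr0 mulr1.
rewrite E addrC addKr /step_mean bin1 expr1 mul1r.
have n0' : (n%:R : R) != 0 by rewrite pnatr_eq0 -lt0n.
by field; rewrite n0' gt_eqF.
Qed.

Lemma level_mean_gt0 n g l : 0 < g -> (0 < l)%N -> (0 < n)%N -> 0 < level_mean n g l.
Proof.
move=> g0 l0 n0; apply: lt_le_trans (le_level_mean n (ltW g0) l0).
have : 0 < n%:R * g * level_mean n g 1.
  rewrite level_mean1// subr_gt0 exprn_egt1 ?ltrDl// -?lt0n//.
by rewrite pmulr_rgt0// mulr_gt0// ltr0n.
Qed.

(* For [g >= n] the first step dominates all the others. *)
Lemma step_mean_le n g l : 0 < g -> n%:R <= g -> (0 < l < n)%N ->
  step_mean n g l.+1 <= n%:R / g * step_mean n g 1.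
Proof.
move=> g0 ng; elim: l => // l IH /andP[_ ln].
have rec (m : nat) : (0 < m < n)%N ->
    step_mean n g m.+1 <= n%:R / g * step_mean n g m.
  move=> /andP[m0 mn].
  have := @step_mean_rec n g m g0; rewrite m0 ltnW// => /(_ isT) E.
  have s1 := step_mean_ge0 n m.+1 (ltW g0).
  have h1 : g * step_mean n g m.+1 <= (n - m)%:R * g * step_mean n g m.+1.
    rewrite -mulrA; apply: ler_peMl; last by rewrite ler1n subn_gt0.
    by apply: mulr_ge0; first exact: ltW.
  have h2 : m%:R * step_mean n g m <= n%:R * step_mean n g m.
    by rewrite ler_wpM2r ?step_mean_ge0 ?(ltW g0)// ler_nat ltnW.
  rewrite mulrAC ler_pdivlMr// mulrC; lra.
have ng1 : n%:R / g <= 1 by rewrite ler_pdivrMr// mul1r.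
case: l IH ln => [_ n1|l IH ln]; first by apply: rec.
apply: le_trans (rec l.+2 _) _; first by rewrite ln.
have s1 := step_mean_ge0 n l.+2 (ltW g0).
apply: (@le_trans _ _ (step_mean n g l.+2)); first by rewrite ler_piMl.
by apply: IH; rewrite /= ltnW.
Qed.

(** There are n - 1 further steps, each at most n / g times the first; this is what makes the two
    bounds on the Laplace transform merge. *)
Lemma level_mean_le n g : 0 < g -> n%:R <= g -> (0 < n)%N ->
  level_mean n g n <= (1 + n%:R ^+ 2 / g) * level_mean n g 1.
Proof.
move=> g0 ng n0.
have -> : level_mean n g 1 = step_mean n g 1 by rewrite level_meanS level_mean0 add0r.
have H l : (0 < l <= n)%N -> level_mean n g l <=
    (1 + l.-1%:R * (n%:R / g)) * step_mean n g 1.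
  elim: l => // l IH /andP[_ ln].
  have [->|l0] := posnP l; first by rewrite level_meanS level_mean0 add0r mul0r addr0 mul1r.
  rewrite level_meanS/=.
  have h1 : level_mean n g l <= (1 + l.-1%:R * (n%:R / g)) * step_mean n g 1.
    by apply: IH; rewrite l0 ltnW.
  have h2 : step_mean n g l.+1 <= n%:R / g * step_mean n g 1.
    by apply: step_mean_le => //; rewrite l0.
  have -> : (l%:R : R) = 1 + l.-1%:R by rewrite nat1r prednK.
  lra.
apply: le_trans (H n _) _; first by rewrite n0 leqnn.
rewrite ler_wpM2r ?step_mean_ge0 ?(ltW g0)// lerD2l expr2 -mulrA ler_wpM2r//.
  by rewrite divr_ge0// ltW.
by rewrite ler_nat leq_pred.
Qed.

End branch.

(** * Comparison functions on the star *)

Section star.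
Context (R : realType) (K : nat) (L : 'I_K -> nat).
Variable g : 'I_K -> R.

Lemma sum_state (F : state L -> R) :
  \sum_c F c = F None + \sum_k \sum_(l < L k) F (active l).
Proof.
rewrite (bigD1 None)//=; congr (_ + _).
rewrite (sig_big_dep xpredT (fun _ _ => true)
  (fun k l => F (active (L := L) (k := k) l)))/=.
rewrite (reindex_omap Some id)/=; last by case.
by apply: eq_big => [u|[k l] _]; rewrite ?eqxx.
Qed.

Lemma sum_level n l (V : nat -> R) :
  \sum_(j < n) (if j.+1 == l then V j.+1 else 0) =
  if (0 < l <= n)%N then V l else 0.
Proof.
case: l => [|l] /=; first by rewrite big1.
case: ltnP => ln; last first.
  rewrite big1// => j _; case: eqP => // -[jl].
  by have := ltn_ord j; rewrite jl ltnNge ln.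
rewrite (bigD1 (Ordinal ln))//= eqxx big1 ?addr0// => j jl.
by case: eqP => // -[jl']; move/eqP: jl; case; apply: val_inj.
Qed.

(** With [phi k 0 = h0], the state 0 is level 0 of every branch, and the step from level 1 to 0
    follows the same formula as the others. *)
Definition level_fun (h0 : R) (phi : 'I_K -> nat -> R) (x : state L) : R :=
  if x is Some u then phi (tag u) (level u) else h0.

Lemma drift_level_None h0 phi : (forall k, (0 < L k)%N) ->
  drift (rate (L := L) g) (level_fun h0 phi) None =
  \sum_k (L k)%:R * g k * (phi k 1%N - h0).
Proof.
move=> L0; rewrite /drift.
transitivity (\sum_c rate (L := L) g None c * (level_fun h0 phi c - h0)).
  by rewrite [RHS](bigD1 None)//= subrr mulr0 add0r.
rewrite sum_state/= mul0r add0r; apply: eq_bigr => k _.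
rewrite (eq_bigr (fun l : 'I__ => if l.+1 == 1%N then
   (fun m => (L k)%:R * g k * (phi k m - h0)) l.+1 else 0)); last first.
  by move=> l _; rewrite /level/=; case: ifP => _; rewrite ?mul0r.
apply: etrans (sum_level (L k) 1 (fun m => (L k)%:R * g k * (phi k m - h0))) _.
by rewrite L0.
Qed.

(** The ordinal l is level l + 1. At the top, [phi] is read beyond the last level, with coefficient
    0. *)
Lemma drift_level_Some h0 phi k (l : 'I_(L k)) : phi k 0%N = h0 ->
  drift (rate g) (level_fun h0 phi) (active l) =
  (L k - l.+1)%:R * g k * (phi k l.+2 - phi k l.+1) +
  l.+1%:R * (phi k l - phi k l.+1).
Proof.
move=> p0; rewrite /drift.
transitivity (\sum_c rate g (active l) c *
    (level_fun h0 phi c - level_fun h0 phi (active l))).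
  by rewrite [RHS](bigD1 (active l))//= subrr mulr0 add0r.
rewrite sum_state (bigD1 k)//= [X in _ + (_ + X)]big1 ?addr0; last first.
  by move=> k' k'k; apply: big1 => l' _ /=; rewrite eq_sym k'k mul0r.
rewrite /level/=.
rewrite (eq_bigr (fun j : 'I_(L k) => (if j.+1 == l.+2 then
   (fun m => (L k - l.+1)%:R * g k * (phi k m - phi k l.+1)) j.+1 else 0) +
   (if j.+1 == l then (fun m => l.+1%:R * (phi k m - phi k l.+1)) j.+1 else 0))); last first.
  move=> j _; rewrite eqxx/= [l.+1 == _]eqSS [_ == j.+1]eq_sym.
  case: eqP => [->|_]; first by rewrite eqn_leq ltnNge leqnSn/= addr0.
  by case: ifP => _; rewrite add0r ?mul0r.
rewrite big_split/= (sum_level _ l.+2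
  (fun m => (L k - l.+1)%:R * g k * (phi k m - phi k l.+1))).
rewrite (sum_level _ l (fun m => l.+1%:R * (phi k m - phi k l.+1))).
rewrite /= addrCA; congr (_ + _).
  case: ltnP => // Ll; have -> : (L k - l.+1 = 0)%N by apply/eqP; rewrite subn_eq0.
  by rewrite mul0r mul0r.
case: (posnP l) => [l0|l0]; last by rewrite eqSS gtn_eqF// mul0r add0r ltnW.
by rewrite l0 eqxx addr0 p0 mul1r.
Qed.

Hypotheses (L0 : forall k, (0 < L k)%N) (g0 : forall k, 0 < g k).

Definition branch_mean (x : state L) : R :=
  level_fun 0 (fun k l => level_mean (L k) (g k) l) x.

Lemma branch_mean_ge0 x : 0 <= branch_mean x.
Proof. by case: x => [u|]//=; rewrite level_mean_ge0// ltW. Qed.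

Let up_down k (l : 'I_(L k)) :
  (L k - l.+1)%:R * g k *
    (level_mean (L k) (g k) l.+2 - level_mean (L k) (g k) l.+1) +
  l.+1%:R * (level_mean (L k) (g k) l - level_mean (L k) (g k) l.+1) = -1.
Proof.
rewrite !level_meanS.
have := @step_mean_rec R (L k) (g k) l.+1 (g0 k) (ltn_ord l).
move: (level_mean _ _ _) (step_mean _ _ l.+1) (step_mean _ _ l.+2) => m s s' E.
have -> : m + s + s' - (m + s) = s' by ring.
have -> : m - (m + s) = - s by ring.
by rewrite mulrN E; ring.
Qed.

Lemma drift_branch_mean k (l : 'I_(L k)) :
  drift (rate g) branch_mean (active l) = -1.
Proof. by rewrite drift_level_Some ?level_mean0// up_down. Qed.

Variable k2 : 'I_K.

(** Reversible weight of branch k when the state 0 has weight 1. *)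
Definition cycle_weight k : R := (1 + g k) ^+ L k - 1.

Lemma cycle_weightE k : (L k)%:R * g k * level_mean (L k) (g k) 1 = cycle_weight k.
Proof. exact: level_mean1. Qed.

(** Mean time from 0 to component k2: the weight of all states outside that component over the rate
    of entering it from 0. *)
Definition idle_mean : R :=
  (1 + \sum_(k | k != k2) cycle_weight k) / ((L k2)%:R * g k2).

(** The mean time to (k2, 1): above it in branch k2 the path only has to come down to level 1, from
    another branch it has to pass through 0. *)
Definition switch_mean (x : state L) : R :=
  level_fun idle_mean (fun k l =>
    if l == 0%N then idle_mean else
    if k == k2 then level_mean (L k) (g k) l - level_mean (L k) (g k) 1
    else idle_mean + level_mean (L k) (g k) l) x.

Lemma cycle_weight_ge0 k : 0 <= cycle_weight k.
Proof.
by rewrite -cycle_weightE mulr_ge0 ?mulr_ge0// ?level_mean_ge0// ltW.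
Qed.

Lemma Lg_gt0 k : 0 < (L k)%:R * g k.
Proof. by rewrite mulr_gt0// ltr0n. Qed.

Lemma idle_mean_gt0 : 0 < idle_mean.
Proof.
rewrite divr_gt0 ?Lg_gt0// ltr_pwDl// sumr_ge0// => k _.
exact: cycle_weight_ge0.
Qed.

Lemma switch_mean_ge0 x : 0 <= switch_mean x.
Proof.
case: x => [[k l]|] /=; last exact/ltW/idle_mean_gt0.
case: eqP => [kk|_].
  by rewrite subr_ge0 le_level_mean// ltW.
by rewrite addr_ge0 ?level_mean_ge0 ?(ltW (g0 k))// ltW// idle_mean_gt0.
Qed.

Lemma switch_mean_target : switch_mean (active (Ordinal (L0 k2))) = 0.
Proof. by rewrite /= eqxx subrr. Qed.

Lemma drift_switch_mean x : x != active (Ordinal (L0 k2)) ->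
  drift (rate g) switch_mean x = -1.
Proof.
have H k (l : 'I_(L k)) : active l != active (Ordinal (L0 k2)) ->
    drift (rate g) switch_mean (active l) = -1.
  move=> xb; rewrite drift_level_Some//=.
  have [kk|kk] := eqVneq k k2; last first.
    rewrite -(up_down l); congr (_ * _ + _ * _); first by ring.
    case: (posnP l) => [->|l0]; first by rewrite level_mean0/=; ring.
    by ring.
  rewrite -(up_down l); congr (_ * _ + _ * _); first by ring.
  case: (posnP l) => [l0|l0]; last by ring.
  exfalso; move/negP: xb; apply; apply/eqP; congr Some.
  by subst k; congr (Tagged _ _); exact: val_inj.
case: x => [[k l]|] xb; first exact: H.
rewrite drift_level_None// (bigD1 k2)//= eqxx subrr sub0r.
rewrite (eq_bigr cycle_weight); last first.
  move=> k kk; rewrite (negbTE kk) -cycle_weightE; congr (_ * _); ring.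
rewrite /idle_mean; have := Lg_gt0 k2; move: (_ * g k2) => c c0.
by rewrite mulrN mulrCA divff ?gt_eqF// mulr1 opprD -addrA addNr addr0.
Qed.

Section discounted.
Variables (sigma : R) (r : 'I_K -> R).
Hypotheses (sigma_gt0 : 0 < sigma) (r_ge0 : forall k, 0 <= r k).

(* The Laplace transform at [sigma] of the time from [None] to component [k2]
   would have this form if every excursion in branch [k] were exponential of
   mean [r k]. *)
Definition idle_laplace : R :=
  (1 + sigma / ((L k2)%:R * g k2) + \sum_(k | k != k2)
     cycle_weight k / ((L k2)%:R * g k2) * (sigma / (1 + sigma * r k)))^-1.

(** Affine in [level_mean] inside a branch, instead of the exact Laplace transform, so that its
    drift is explicit; when the mean from level l equals [r k], it gives the exponential factor 1/(1
    + sigma r_k). *)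
Definition discounted_mean (x : state L) : R :=
  level_fun ((1 - idle_laplace) / sigma) (fun k l =>
    if k == k2 then (if l == 0%N then (1 - idle_laplace) / sigma else 0)
    else (1 - idle_laplace) / sigma +
      idle_laplace * (level_mean (L k) (g k) l / (1 + sigma * r k))) x.

Let sr k : 0 < 1 + sigma * r k.
Proof. by rewrite ltr_pwDl// mulr_ge0// ltW. Qed.

Lemma idle_laplace_sum_ge0 : 0 <= sigma / ((L k2)%:R * g k2) +
  \sum_(k | k != k2) cycle_weight k / ((L k2)%:R * g k2) *
    (sigma / (1 + sigma * r k)).
Proof.
rewrite addr_ge0 ?sumr_ge0// => [|k _].
  by rewrite divr_ge0// ltW// Lg_gt0.
by rewrite mulr_ge0 ?divr_ge0 ?cycle_weight_ge0// ltW// Lg_gt0.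
Qed.

Lemma idle_laplace_gt0 : 0 < idle_laplace.
Proof. by rewrite invr_gt0 -addrA ltr_pwDl// idle_laplace_sum_ge0. Qed.

Lemma idle_laplace_le1 : idle_laplace <= 1.
Proof.
rewrite /idle_laplace -addrA invf_le1 ?lerDl ?idle_laplace_sum_ge0//.
by rewrite ltr_pwDl// idle_laplace_sum_ge0.
Qed.

Lemma discounted_mean_ge0 x : 0 <= discounted_mean x.
Proof.
have v1 : 0 <= (1 - idle_laplace) / sigma.
  by rewrite divr_ge0 ?(ltW sigma_gt0)// subr_ge0 idle_laplace_le1.
case: x => [[k l]|]//=; case: ifP => _ //.
rewrite addr_ge0// mulr_ge0 ?(ltW idle_laplace_gt0)// divr_ge0 ?(ltW (sr k))//.
by rewrite level_mean_ge0// ltW.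
Qed.

Lemma discounted_mean_target x : in_component k2 x -> discounted_mean x = 0.
Proof. by case: x => [[k l]|]//= ->. Qed.

(** The equation at 0 holds exactly for every r; it is what determines [idle_laplace]. *)
Lemma drift_discounted_mean_None :
  drift (rate (L := L) g) discounted_mean None - sigma * discounted_mean None
  = -1.
Proof.
rewrite drift_level_None// (bigD1 k2)//= eqxx.
have c0 := Lg_gt0 k2; set c := _ * g k2 in c0 *.
pose s := \sum_(k | k != k2) cycle_weight k / (1 + sigma * r k).
rewrite (_ : \sum_(i | i != k2) _ = idle_laplace * s); last first.
  rewrite /s mulr_sumr; apply: eq_bigr => k kk; rewrite (negbTE kk).
  rewrite -cycle_weightE; ring.
have v0 : idle_laplace = (1 + sigma / c + sigma / c * s)^-1.
  rewrite /idle_laplace -/c /s mulr_sumr; congr (_ + _)^-1.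
  by apply: eq_bigr => k _; ring.
have D0 : 1 + sigma / c + sigma / c * s != 0.
  by rewrite -invr_eq0 -v0 gt_eqF// idle_laplace_gt0.
have D1 : c + sigma + sigma * s != 0.
  have -> : c + sigma + sigma * s = c * (1 + sigma / c + sigma / c * s).
    by field; rewrite gt_eqF.
  by rewrite mulf_neq0// gt_eqF.
rewrite v0; field.
by rewrite D1 !gt_eqF.
Qed.

(** The defect has the sign of r_k minus the mean from the current level, so r_k taken at an extreme
    level gives one sign throughout the branch. *)
Lemma drift_discounted_mean_Some k (l : 'I_(L k)) : k != k2 ->
  drift (rate g) discounted_mean (active l) -
    sigma * discounted_mean (active l) =
  -1 + idle_laplace * (sigma / (1 + sigma * r k)) *
    (r k - level_mean (L k) (g k) l.+1).
Proof.
move=> kk; rewrite drift_level_Some/= (negbTE kk); last first.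
  by rewrite level_mean0; ring.
have s0 := sigma_gt0; have := sr k; set c := 1 + _ => c0.
have E := up_down l.
set u := (L k - l.+1)%:R * g k in E *.
move: (level_mean _ _ l.+2) (level_mean _ _ l.+1) (level_mean _ _ l) E => m'' m' m E.
pose x := u * (m'' - m') + l.+1%:R * (m - m').
transitivity (idle_laplace / c * x -
    (1 - idle_laplace + idle_laplace * (sigma * m' / c))).
  by rewrite /x /=; field; rewrite !gt_eqF.
have -> : idle_laplace * (sigma / c) * (r k - m') =
  idle_laplace / c * (sigma * r k - sigma * m') by ring.
have -> : sigma * r k = c - 1 by rewrite /c addrC addKr.
by rewrite /x E; field; rewrite gt_eqF.
Qed.

End discounted.

End star.

Section star_process.
Context (R : realType) (K : nat) (L : 'I_K -> nat).
Variables (L0 : forall k, (0 < L k)%N) (g : 'I_K -> R).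
Hypothesis g0 : forall k, 0 < g k.
Context (k1 k2 : 'I_K) (l1 : 'I_(L k1)) (d : measure_display)
  (T : measurableType d) (P : probability T R) (X : R -> T -> state L).
Hypotheses (k12 : k1 != k2) (MX : markov_process P (rate g) X)
  (X0 : P [set w | X 0 w = active l1] = 1%E).

Lemma mean_transition_time_None :
  mean_transition_time P X None = (level_mean (L k1) (g k1) l1.+1)%:E.
Proof.
transitivity ((branch_mean g (active l1))%:E) => //.
rewrite /mean_transition_time; under eq_integral do rewrite (transition_timeE MX).
apply: (mean_hitting_time MX X0 _ (m := branch_mean g)) => //.
- by move=> c; exact: branch_mean_ge0.
- by move=> c /eqP ->.
- by case=> [[k l] _|//]; exact: drift_branch_mean.
Qed.

Lemma mean_transition_time_switch :
  mean_transition_time P X (active (Ordinal (L0 k2))) =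
  (idle_mean L g k2 + level_mean (L k1) (g k1) l1.+1)%:E.
Proof.
transitivity ((switch_mean g k2 (active l1))%:E); last first.
  by rewrite /= (negbTE k12).
rewrite /mean_transition_time; under eq_integral do rewrite (transition_timeE MX).
apply: (mean_hitting_time MX X0 _ (m := switch_mean g k2)) => //.
- apply/negP => /eqP /(congr1 (in_component k2)) /=.
  by rewrite eqxx (negbTE k12).
- by move=> c; exact: switch_mean_ge0.
- by move=> c /eqP ->; exact: switch_mean_target.
- by move=> c cb; exact: drift_switch_mean.
Qed.

Lemma one_sub_discounted_mean sigma r : 0 < sigma -> (forall k, 0 <= r k) ->
  1 - sigma * discounted_mean g k2 sigma r (active l1) =
  idle_laplace L g k2 sigma r *
    (1 - sigma * level_mean (L k1) (g k1) l1.+1 / (1 + sigma * r k1)).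
Proof.
move=> s0 r0; rewrite /= (negbTE k12).
have c0 : 1 + sigma * r k1 != 0.
  by rewrite gt_eqF// ltr_pwDl// mulr_ge0// ltW.
by field; rewrite c0 gt_eqF.
Qed.

Let h w := hitting_time X (in_component k2) w.
Let out : ~~ in_component k2 (active l1) := k12.

(** With r_k the mean from the top level every defect is nonnegative, so sigma [discounted_mean] is
    at most 1 - E exp(-sigma H). *)
Lemma laplace_switch_le sigma : 0 < sigma ->
  \int[P]_w discount sigma (h w) <=
  idle_laplace L g k2 sigma (fun k => level_mean (L k) (g k) (L k)) *
    (1 - sigma * level_mean (L k1) (g k1) l1.+1 /
      (1 + sigma * level_mean (L k1) (g k1) (L k1))).
Proof.
move=> s0; set r := fun k : 'I_K => level_mean (L k) (g k) (L k).
have r0 k : 0 <= r k by rewrite level_mean_ge0// ltW.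
rewrite -(@one_sub_discounted_mean sigma r)// lerBrDr -lerBrDl.
apply: (laplace_hitting_time_ge MX X0 out s0) => c.
  by move=> /discounted_mean_target ->.
case: c => [[k l]|] kB; last by rewrite drift_discounted_mean_None.
rewrite (@drift_discounted_mean_Some _ _ _ _ _ _ _ _ s0 r0 k l)//.
rewrite lerDl mulr_ge0//; last by rewrite subr_ge0 le_level_mean// ltW.
rewrite mulr_ge0//; first exact/ltW/idle_laplace_gt0.
by rewrite divr_ge0 ?(ltW s0)// addr_ge0// mulr_ge0// ltW.
Qed.

Lemma laplace_switch_ge sigma : 0 < sigma ->
  idle_laplace L g k2 sigma (fun k => level_mean (L k) (g k) 1) *
    (1 - sigma * level_mean (L k1) (g k1) l1.+1 /
      (1 + sigma * level_mean (L k1) (g k1) 1)) <=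
  \int[P]_w discount sigma (h w).
Proof.
move=> s0; set r := fun k : 'I_K => level_mean (L k) (g k) 1.
have r0 k : 0 <= r k by rewrite level_mean_ge0// ltW.
rewrite -(@one_sub_discounted_mean sigma r)// lerBlDr -lerBlDl.
apply: (laplace_hitting_time_le MX X0 out s0) => c.
  exact: discounted_mean_ge0.
case: c => [[k l]|] kB; last by rewrite drift_discounted_mean_None.
rewrite (@drift_discounted_mean_Some _ _ _ _ _ _ _ _ s0 r0 k l)//.
rewrite gerDl mulr_ge0_le0//; last by rewrite subr_le0 le_level_mean// ltW.
rewrite mulr_ge0//; first exact/ltW/idle_laplace_gt0.
by rewrite divr_ge0 ?(ltW s0)// addr_ge0// mulr_ge0// ltW.
Qed.

End star_process.

(** * Asymptotics *)

Section asymptotics.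
Context (R : realType) (K : nat) (L : 'I_K -> nat).
Variables (L0 : forall k, (0 < L k)%N) (f : 'I_K -> R -> R).
Hypothesis f_infty : forall k, f k nu @[nu --> +oo] --> +oo.
Context (k1 k2 : 'I_K) (l1 : 'I_(L k1)).
Hypothesis k12 : k1 != k2.
Variable gamma : 'I_K -> R.
Hypothesis gamma_lim : forall k : 'I_K, k != k2 ->
  f k nu ^+ L k / (\sum_(j | j != k2) f j nu ^+ L j) @[nu --> +oo] --> gamma k.

Lemma near_f_ge (M : R) : \forall nu \near +oo, forall k, M <= f k nu.
Proof.
by apply: filter_forall => k; move/cvgryPge: (f_infty k); apply.
Qed.

Lemma near_f_gt0 : \forall nu \near +oo, forall k, 0 < f k nu.
Proof.
by apply: filterS (near_f_ge 1) => nu h k; exact: lt_le_trans (h k).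
Qed.

Lemma near_rate_gt0 : \forall nu \near +oo, forall k, 0 < (L k)%:R * f k nu.
Proof. by apply: filterS near_f_gt0 => nu f0 k; rewrite mulr_gt0// ltr0n. Qed.

Lemma cvg_inv_f k : (f k nu)^-1 @[nu --> +oo] --> (0 : R).
Proof.
apply/gtr0_cvgV0; last exact: f_infty.
by apply: filterS near_f_gt0.
Qed.

Local Notation A k nu := (cycle_weight L (fun j => f j nu) k).
Local Notation S nu := (\sum_(j | j != k2) f j nu ^+ L j).
Local Notation m k l nu := (level_mean (L k) (f k nu) l).

Lemma cvg_cycle_weight k : A k nu / f k nu ^+ L k @[nu --> +oo] --> (1 : R).
Proof.
have h : ((f k nu)^-1 + 1) ^+ L k - (f k nu)^-1 ^+ L k
    @[nu --> +oo] --> ((0 + 1) ^+ L k - 0 ^+ L k : R).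
  have cX (u : R -> R) (l : R) : u nu @[nu --> +oo] --> l ->
      u nu ^+ L k @[nu --> +oo] --> l ^+ L k.
    move=> ul; apply: (@cvg_comp _ _ _ u (fun y => y ^+ L k) _ _ _ ul).
    exact: exprn_continuous.
  apply: cvgB; last by apply: cX; exact: cvg_inv_f.
  by apply: cX; apply: cvgD; [exact: cvg_inv_f|exact: cvg_cst].
rewrite add0r expr1n expr0n gtn_eqF// subr0 in h.
apply: cvg_trans h; apply: near_eq_cvg.
apply: filterS near_f_gt0 => nu /(_ k) f0.
have fn : f k nu != 0 by rewrite gt_eqF.
rewrite /cycle_weight mulrBl div1r exprVn -expr_div_n mulrDl mul1r divff//.
Qed.

Lemma cvg_sum_pow_inv : (S nu)^-1 @[nu --> +oo] --> (0 : R).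
Proof.
apply: (@squeeze_cvgr _ _ _ _ (fun=> 0) (fun nu => (f k1 nu)^-1)).
- apply: filterS (near_f_ge 1) => nu f1.
  have f0 k : 0 <= f k nu by exact: le_trans (f1 k).
  have S1 : f k1 nu <= S nu.
    rewrite (bigD1 k1)//= -[leLHS]addr0 lerD ?sumr_ge0// => [|k _]; last exact: exprn_ge0.
    by rewrite -[leLHS]expr1 ler_weXn2l.
  have f10 : 0 < f k1 nu by exact: lt_le_trans (f1 k1).
  rewrite invr_ge0 (le_trans _ S1)//= lef_pV2// posrE// (lt_le_trans f10)//.
- exact: cvg_cst.
- exact: cvg_inv_f.
Qed.

Lemma sum_gamma : \sum_(j | j != k2) gamma j = 1.
Proof.
have h : \sum_(k | k != k2) (f k nu ^+ L k / S nu)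
    @[nu --> +oo] --> \sum_(j | j != k2) gamma j.
  by apply: cvg_sumr.
apply: (cvg_unique _ h); first exact: norm_hausdorff.
apply: cvg_near_cst; apply: filterS near_f_gt0 => nu f0.
rewrite -mulr_suml divff// gt_eqF// (bigD1 k1)//= ltr_pwDl ?exprn_gt0//.
by apply: sumr_ge0 => k _; rewrite exprn_ge0// ltW.
Qed.

Lemma cvg_cycle_weight_pow k : k != k2 -> A k nu / S nu @[nu --> +oo] --> gamma k.
Proof.
move=> kk.
have h : A k nu / f k nu ^+ L k * (f k nu ^+ L k / S nu)
    @[nu --> +oo] --> 1 * gamma k.
  by apply: cvgM; [exact: cvg_cycle_weight|exact: gamma_lim].
rewrite mul1r in h; apply: cvg_trans h; apply: near_eq_cvg.
apply: filterS near_f_gt0 => nu /(_ k) f0 /=.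
by rewrite mulrA mulfVK// gt_eqF// exprn_gt0.
Qed.

Lemma cvg_cycle_sum : (1 + \sum_(k | k != k2) A k nu) / S nu @[nu --> +oo] --> (1 : R).
Proof.
have h : (S nu)^-1 + \sum_(k | k != k2) (A k nu / S nu)
    @[nu --> +oo] --> 0 + \sum_(j | j != k2) gamma j.
  apply: cvgD; first exact: cvg_sum_pow_inv.
  by apply: cvg_sumr => k kk; exact: cvg_cycle_weight_pow.
rewrite sum_gamma add0r in h; apply: cvg_trans h; apply: near_eq_cvg.
by apply: nearW => nu; rewrite mulrDl div1r mulr_suml.
Qed.

Lemma cvg_cycle_sum_inv : (1 + \sum_(k | k != k2) A k nu)^-1 @[nu --> +oo] --> (0 : R).
Proof.
have h : (S nu)^-1 * ((1 + \sum_(k | k != k2) A k nu) / S nu)^-1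
    @[nu --> +oo] --> (0 * 1^-1 : R).
  apply: cvgM; first exact: cvg_sum_pow_inv.
  by apply: cvgV; [exact: oner_neq0|exact: cvg_cycle_sum].
rewrite mul0r in h; apply: cvg_trans h; apply: near_eq_cvg.
apply: filterS near_f_gt0 => nu f0 /=.
have S0 : S nu != 0.
  rewrite gt_eqF// (bigD1 k1)//= ltr_pwDl ?exprn_gt0//.
  by apply: sumr_ge0 => k _; rewrite exprn_ge0// ltW.
by rewrite invf_div mulrA mulVf// mul1r.
Qed.

Lemma cvg_cycle_fraction k : k != k2 ->
  A k nu / (1 + \sum_(j | j != k2) A j nu) @[nu --> +oo] --> gamma k.
Proof.
move=> kk.
have h : A k nu / S nu * ((1 + \sum_(j | j != k2) A j nu) / S nu)^-1
    @[nu --> +oo] --> gamma k * 1^-1.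
  apply: cvgM; first exact: cvg_cycle_weight_pow.
  by apply: cvgV; [exact: oner_neq0|exact: cvg_cycle_sum].
rewrite invr1 mulr1 in h; apply: cvg_trans h; apply: near_eq_cvg.
apply: filterS near_f_gt0 => nu f0 /=.
have S0 : S nu != 0.
  rewrite gt_eqF// (bigD1 k1)//= ltr_pwDl ?exprn_gt0//.
  by apply: sumr_ge0 => j _; rewrite exprn_ge0// ltW.
by rewrite invf_div mulrA mulfVK.
Qed.

Lemma cvg_level_mean_ratio k l : (0 < l <= L k)%N ->
  m k l nu / m k 1 nu @[nu --> +oo] --> (1 : R).
Proof.
move=> /andP[l0 lL].
apply: (@squeeze_cvgr _ _ _ _ (fun=> 1) (fun nu => 1 + (L k)%:R ^+ 2 * (f k nu)^-1)).
- near=> nu; have f0 : 0 < f k nu by near: nu; apply: filterS near_f_gt0.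
  have fL : (L k)%:R <= f k nu.
    by near: nu; apply: filterS (near_f_ge (L k)%:R).
  have m0 : 0 < m k 1 nu by exact: level_mean_gt0.
  rewrite ler_pdivlMr// mul1r le_level_mean ?(ltW f0)//= ler_pdivrMr//.
  exact: le_trans (le_level_mean _ (ltW f0) lL) (level_mean_le f0 fL (L0 k)).
- exact: cvg_cst.
- rewrite -[X in _ --> X]addr0 -[X in _ --> _ + X](mulr0 ((L k)%:R ^+ 2)).
  apply: cvgD; first exact: cvg_cst.
  by apply: cvgM; [exact: cvg_cst|exact: cvg_inv_f].
Unshelve. all: by end_near. Qed.

Variable beta : 'I_K -> \bar R.
Hypothesis beta_lim : forall k : 'I_K, k != k2 -> 0 < gamma k ->
  ((L k)%:R * f k nu / ((L k2)%:R * f k2 nu))%:E @[nu --> +oo] --> beta k.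

Local Notation M nu :=
  (idle_mean L (fun j => f j nu) k2 + m k1 l1.+1 nu).
Variable alpha : R.
Hypothesis alpha_lim : m k1 l1.+1 nu / M nu @[nu --> +oo] --> alpha.

Lemma near_M_gt0 : \forall nu \near +oo, 0 < M nu.
Proof.
apply: filterS near_f_gt0 => nu f0.
by rewrite ltr_pwDl ?idle_mean_gt0// level_mean_ge0// ltW.
Qed.

Lemma near_mean_ratio : \forall nu \near +oo, 0 <= m k1 l1.+1 nu / M nu <= 1.
Proof.
near=> nu; have f0 : forall k, 0 < f k nu by near: nu; exact: near_f_gt0.
have M0 : 0 < M nu by near: nu; exact: near_M_gt0.
rewrite divr_ge0 ?level_mean_ge0 ?(ltW M0) ?(ltW (f0 k1))//=.
by rewrite ler_pdivrMr// mul1r lerDr ltW// idle_mean_gt0.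
Unshelve. all: by end_near. Qed.

Lemma alpha_itv : 0 <= alpha <= 1.
Proof.
apply/andP; split.
  by apply: cvgr_to_ge alpha_lim _; apply: filterS near_mean_ratio => nu /andP[].
by apply: cvgr_to_le alpha_lim _; apply: filterS near_mean_ratio => nu /andP[].
Qed.

Lemma gamma_ge0 k : k != k2 -> 0 <= gamma k.
Proof.
move=> /gamma_lim /cvgr_to_ge; apply; apply: filterS near_f_gt0 => nu f0.
apply: divr_ge0; first by rewrite exprn_ge0// ltW.
by apply: sumr_ge0 => j _; rewrite exprn_ge0// ltW.
Qed.

Section moment.
Variable n : nat.
Local Notation s := ((1 - alpha) * n%:R).
Local Notation sigma nu := (n%:R / M nu).
Local Notation x k nu := (sigma nu * (A k nu / ((L k2)%:R * f k2 nu))).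

(** 1 - m / M is the share of [idle_mean] in M, so x_k is n (1 - m / M) times the fraction of branch
    k in the total weight outside k2. That fraction tends to gamma_k since (1 + f)^L - 1 is
    equivalent to f^L. *)
Lemma cvg_excursion_rate k : k != k2 -> x k nu @[nu --> +oo] --> gamma k * s.
Proof.
move=> kk.
have h : A k nu / (1 + \sum_(j | j != k2) A j nu) *
    ((1 - m k1 l1.+1 nu / M nu) * n%:R) @[nu --> +oo] --> gamma k * s.
  apply: cvgM; first exact: cvg_cycle_fraction.
  apply: cvgM; last exact: cvg_cst.
  by apply: cvgB => //; exact: cvg_cst.
apply: cvg_trans h; apply: near_eq_cvg; near=> nu.
have f0 : forall k, 0 < f k nu by near: nu; exact: near_f_gt0.
have M0 : M nu != 0 by rewrite gt_eqF//; near: nu; exact: near_M_gt0.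
have c0 : (L k2)%:R * f k2 nu != 0.
  by rewrite gt_eqF//; near: nu; apply: filterS near_rate_gt0.
have S0 : 1 + \sum_(j | j != k2) A j nu != 0.
  by rewrite gt_eqF// ltr_pwDl// sumr_ge0// => j _; exact: cycle_weight_ge0.
have -> : 1 - m k1 l1.+1 nu / M nu =
    (1 + \sum_(j | j != k2) A j nu) / ((L k2)%:R * f k2 nu) / M nu.
  by rewrite -[X in X - _](divff M0) -mulrBl addrK.
move: M0 c0 S0.
move: (M nu) (_ * f k2 nu) (1 + _) (A k nu) => M' c S A M0 c0 S0.
by field; rewrite M0 c0.
Unshelve. all: by end_near. Qed.

(** The same computation for the state 0, of weight 1, whose fraction of the total weight
    vanishes. *)
Lemma cvg_sigma_rate : sigma nu / ((L k2)%:R * f k2 nu) @[nu --> +oo] --> (0 : R).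
Proof.
have h : (1 + \sum_(j | j != k2) A j nu)^-1 *
    ((1 - m k1 l1.+1 nu / M nu) * n%:R) @[nu --> +oo] --> 0 * s.
  apply: cvgM; first exact: cvg_cycle_sum_inv.
  apply: cvgM; last exact: cvg_cst.
  by apply: cvgB => //; exact: cvg_cst.
rewrite mul0r in h; apply: cvg_trans h; apply: near_eq_cvg; near=> nu.
have f0 : forall k, 0 < f k nu by near: nu; exact: near_f_gt0.
have M0 : M nu != 0 by rewrite gt_eqF//; near: nu; exact: near_M_gt0.
have c0 : (L k2)%:R * f k2 nu != 0.
  by rewrite gt_eqF//; near: nu; apply: filterS near_rate_gt0.
have S0 : 1 + \sum_(j | j != k2) A j nu != 0.
  by rewrite gt_eqF// ltr_pwDl// sumr_ge0// => j _; exact: cycle_weight_ge0.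
have -> : 1 - m k1 l1.+1 nu / M nu =
    (1 + \sum_(j | j != k2) A j nu) / ((L k2)%:R * f k2 nu) / M nu.
  by rewrite -[X in X - _](divff M0) -mulrBl addrK.
move: M0 c0 S0.
move: (M nu) (_ * f k2 nu) (1 + _) => M' c S M0 c0 S0.
by field; rewrite M0 c0.
Unshelve. all: by end_near. Qed.

Variable r : R -> 'I_K -> R.
Hypothesis r_lim : forall k, r nu k / m k 1 nu @[nu --> +oo] --> (1 : R).
Hypothesis r_ge0 : \forall nu \near +oo, forall k, 0 <= r nu k.

(** Contribution of branch k to the inverse of [laplace_W]. At most one summand is nonzero; both are
    0 when gamma_k or beta_k is 0. *)
Definition laplace_term k : R :=
  (if k \in index_A k2 gamma beta
   then gamma k * s / (1 + gamma k * s / fine (beta k)) else 0) +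
  (if k \in index_S k2 gamma beta then s * gamma k else 0).

Lemma moment_arg_ge0 : 0 <= s.
Proof. by rewrite mulr_ge0// subr_ge0; case/andP: alpha_itv. Qed.

Lemma near_sigma_ge0 : \forall nu \near +oo, 0 <= sigma nu.
Proof.
by apply: filterS near_M_gt0 => nu M0; rewrite divr_ge0// ltW.
Qed.

Lemma cvg_laplace_term0 k : k != k2 -> gamma k * s = 0 ->
  x k nu / (1 + sigma nu * r nu k) @[nu --> +oo] --> (0 : R).
Proof.
move=> kk s0; have := cvg_excursion_rate kk; rewrite s0 => h.
apply: (@squeeze_cvgr _ _ _ _ (fun=> 0) (fun nu => x k nu)) => //; last exact: cvg_cst.
near=> nu; have f0 : forall k, 0 < f k nu by near: nu; exact: near_f_gt0.
have sg0 : 0 <= sigma nu by near: nu; exact: near_sigma_ge0.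
have r0 : 0 <= r nu k by near: nu; apply: filterS r_ge0.
have d1 : 1 <= 1 + sigma nu * r nu k by rewrite lerDl mulr_ge0.
have x0 : 0 <= x k nu.
  rewrite mulr_ge0// divr_ge0 ?cycle_weight_ge0// ltW//.
  by near: nu; apply: filterS near_rate_gt0.
rewrite divr_ge0 ?(le_trans ler01 d1)//= ler_pdivrMr ?(lt_le_trans ltr01 d1)//.
by rewrite ler_peMr.
Unshelve. all: by end_near. Qed.

(** The term is x / (1 + rho x / b) with x -> gamma_k s, rho -> 1 and b -> beta_k. The three cases
    of the limit are beta_k finite positive, 0 and infinite. *)
Lemma cvg_laplace_term k : k != k2 ->
  A k nu / ((L k2)%:R * f k2 nu) * (sigma nu / (1 + sigma nu * r nu k))
    @[nu --> +oo] --> laplace_term k.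
Proof.
move=> kk.
suff h : x k nu / (1 + sigma nu * r nu k) @[nu --> +oo] --> laplace_term k.
  apply: cvg_trans h; apply: near_eq_cvg; apply: nearW => nu.
  by rewrite [LHS]mulrAC [LHS]mulrC.
rewrite /laplace_term !inE kk/=.
have [g0|g0] := ltP 0 (gamma k); last first.
  rewrite addr0; apply: cvg_laplace_term0 => //.
  by have /le_anti <- : 0 <= gamma k <= 0; rewrite ?mul0r// g0 gamma_ge0.
pose b nu := (L k)%:R * f k nu / ((L k2)%:R * f k2 nu).
pose rho nu := r nu k / m k 1 nu.
(* From L_k f_k m_1 = [cycle_weight]: the quotient x / b is sigma times the mean excursion from
   level 1. *)
have xr : \forall nu \near +oo, sigma nu * r nu k = rho nu * (x k nu / b nu).
  near=> nu.
  have f0 : forall k, 0 < f k nu by near: nu; exact: near_f_gt0.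
  have m0 : m k 1 nu != 0 by rewrite gt_eqF// level_mean_gt0.
  have c0 : forall j, 0 < (L j)%:R * f j nu by near: nu; exact: near_rate_gt0.
  have ck : (L k)%:R * f k nu != 0 by rewrite gt_eqF.
  have c2 : (L k2)%:R * f k2 nu != 0 by rewrite gt_eqF.
  rewrite /rho /b -(cycle_weightE L0 f0); move: m0 ck c2.
  move: (_ * f k nu) (_ * f k2 nu) (m k 1 nu) (sigma nu) => ck c2 mk sg m0 ck0 c20.
  by field; rewrite m0 ck0 c20.
have x_lim := cvg_excursion_rate kk.
have rho_lim : rho nu @[nu --> +oo] --> (1 : R) by exact: r_lim.
have sg0 : 0 <= gamma k * s by rewrite mulr_ge0 ?moment_arg_ge0// ltW.
have h (y : R) : 0 <= y -> (b nu)^-1 @[nu --> +oo] --> y ->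
    x k nu / (1 + sigma nu * r nu k) @[nu --> +oo] -->
    gamma k * s / (1 + 1 * (gamma k * s * y)).
  move=> y0 by_; have : x k nu / (1 + rho nu * (x k nu * (b nu)^-1)) @[nu --> +oo] -->
      gamma k * s / (1 + 1 * (gamma k * s * y)).
    apply: cvgM => //; apply: cvgV.
      by rewrite gt_eqF// ltr_pwDl// mul1r mulr_ge0.
    apply: cvgD; first exact: cvg_cst.
    by apply: cvgM => //; apply: cvgM.
  apply: cvg_trans; apply: near_eq_cvg; apply: filterS xr => nu -> //.
have b0 : \forall nu \near +oo, 0 < b nu.
  by apply: filterS near_rate_gt0 => nu c0; rewrite divr_gt0.
have := beta_lim kk g0; case E : (beta k) => [y| |] /=.
- rewrite lte_fin ltry andbT addr0 => /fine_cvg by_.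
  have {}by_ : b nu @[nu --> +oo] --> y by [].
  have y0 : 0 <= y.
    by apply: cvgr_to_ge by_ _; apply: filterS b0 => nu /ltW.
  move: y0; rewrite le_eqVlt => /predU1P[y0|y0].
    rewrite -y0 ltxx; have [s0|s0] := eqVneq (gamma k * s) 0.
      exact: cvg_laplace_term0.
    (* For beta_k = 0 the fraction is multiplied through by b, which leaves the nonzero limit
       gamma_k s in the denominator. *)
    have : x k nu * b nu / (b nu + rho nu * x k nu) @[nu --> +oo] -->
        gamma k * s * y / (y + 1 * (gamma k * s)).
      apply: cvgM; first exact: cvgM.
      apply: cvgV; first by rewrite -y0 add0r mul1r.
      by apply: cvgD => //; exact: cvgM.
    rewrite -y0 mulr0 mul0r; apply: cvg_trans; apply: near_eq_cvg.
    near=> nu; have -> : sigma nu * r nu k = rho nu * (x k nu / b nu).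
      by near: nu.
    have bn : b nu != 0 by rewrite gt_eqF//; near: nu.
    have -> : 1 + rho nu * (x k nu / b nu) = (b nu + rho nu * x k nu) / b nu.
      by rewrite [RHS]mulrDl divff// [in LHS]mulrA.
    by rewrite -[LHS]mulrA invf_div.
  rewrite y0; have := h y^-1; rewrite invr_ge0 (ltW y0) mul1r => /(_ isT); apply.
  by apply: cvgV => //; rewrite gt_eqF.
- move=> /cvgeryP boo; rewrite ltxx andbF add0r.
  have := h 0 (lexx _); rewrite mulr0 mulr0 addr0 divr1 [s * _]mulrC; apply.
  by apply/gtr0_cvgV0.
(* The limit -oo is impossible for the positive ratio b. *)
- move=> /cvgeNyPle/(_ 0) bN; have [nu []] := filter_ex (filterI bN b0).
  by rewrite lee_fin => /le_lt_trans/[apply]; rewrite ltxx.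
Unshelve. all: by end_near. Qed.

Lemma laplace_W_term : (laplace_W k2 gamma beta s)^-1 =
  1 + \sum_(k | k != k2) laplace_term k.
Proof.
rewrite invrK -addrA; congr (_ + _); rewrite big_split; congr (_ + _).
  rewrite -big_mkcondr; apply: eq_bigl => k; rewrite !inE.
  by case: (k != k2).
rewrite mulr_sumr -big_mkcondr; apply: eq_bigl => k; rewrite !inE.
by case: (k != k2).
Qed.

Lemma laplace_term_ge0 k : k != k2 -> 0 <= laplace_term k.
Proof.
move=> kk; have g0 := gamma_ge0 kk; have sg0 := mulr_ge0 g0 moment_arg_ge0.
rewrite addr_ge0//; case: ifP => // kA; last by rewrite mulr_ge0// moment_arg_ge0.
rewrite divr_ge0// addr_ge0// divr_ge0// fine_ge0//.
by move: kA; rewrite !inE => /and3P[_ _ /andP[/ltW]].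
Qed.

(** sigma m and sigma r_k1 have the same limit alpha n, so the second factor tends to 1 - alpha n/(1
    + alpha n), the Laplace transform of alpha Y at n. *)
Lemma cvg_laplace_bound :
  idle_laplace L (fun j => f j nu) k2 (sigma nu) (r nu) *
    (1 - sigma nu * m k1 l1.+1 nu / (1 + sigma nu * r nu k1)) @[nu --> +oo] -->
  (1 + alpha * n%:R)^-1 * laplace_W k2 gamma beta s.
Proof.
have [a0 a1] := andP alpha_itv.
have d0 : 1 + alpha * n%:R != 0.
  by rewrite gt_eqF// ltr_pwDl// mulr_ge0.
have -> : (1 + alpha * n%:R)^-1 * laplace_W k2 gamma beta s =
    (1 + 0 + \sum_(k | k != k2) laplace_term k)^-1 *
    (1 - alpha * n%:R / (1 + 1 * (alpha * n%:R))).
  rewrite addr0 -laplace_W_term invrK mulrC; congr (_ * _).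
  by field.
apply: cvgM.
  apply: cvgV.
    rewrite addr0 gt_eqF// ltr_pwDl// sumr_ge0// => k; exact: laplace_term_ge0.
  apply: cvgD; last by apply: cvg_sumr => k kk; exact: cvg_laplace_term.
  by apply: cvgD; [exact: cvg_cst|exact: cvg_sigma_rate].
apply: cvgB; first exact: cvg_cst.
have sm : sigma nu * m k1 l1.+1 nu @[nu --> +oo] --> alpha * n%:R.
  have : m k1 l1.+1 nu / M nu * n%:R @[nu --> +oo] --> alpha * n%:R.
    by apply: cvgM => //; exact: cvg_cst.
  apply: cvg_trans; apply: near_eq_cvg; apply: nearW => nu.
  by rewrite mulrC mulrCA mulrC.
apply: cvgM => //; apply: cvgV; first by rewrite mul1r.
apply: cvgD; first exact: cvg_cst.
have : r nu k1 / m k1 1 nu * (m k1 l1.+1 nu / m k1 1 nu)^-1 *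
    (sigma nu * m k1 l1.+1 nu) @[nu --> +oo] --> 1 * 1^-1 * (alpha * n%:R).
  apply: cvgM => //; apply: cvgM; first exact: r_lim.
  apply: cvgV; first exact: oner_neq0.
  by apply: (@cvg_level_mean_ratio k1 l1.+1); exact: ltn_ord.
rewrite invr1 mulr1; apply: cvg_trans; apply: near_eq_cvg; near=> nu.
have f0 : forall k, 0 < f k nu by near: nu; exact: near_f_gt0.
have m0 : m k1 1 nu != 0 by rewrite gt_eqF// level_mean_gt0.
have m1 : m k1 l1.+1 nu != 0 by rewrite gt_eqF// level_mean_gt0.
move: (sigma nu) => sg; move: (m k1 1 nu) (m k1 l1.+1 nu) m0 m1 => m' m'' m0 m1.
by field; rewrite m0 m1.
Unshelve. all: by end_near. Qed.

End moment.
End asymptotics.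

(** * From the Laplace bounds to the theorem *)

Lemma discountX (R : realType) (sigma : R) (h : \bar R) n : (0 < n)%N ->
  discount sigma h ^+ n = discount (n%:R * sigma) h.
Proof.
move=> n0; case: h => [h| |] /=; rewrite ?expr0n ?gtn_eqF//.
by rewrite -expRM_natl; congr expR; ring.
Qed.

Lemma le_discount (R : realType) (sigma t : R) (h : \bar R) : 0 < sigma ->
  (0 <= h)%E -> discount sigma h <= expR (- sigma * t) <-> (t%:E <= h)%E.
Proof.
move=> s0; case: h => [h _| _|//]; last by rewrite leey /= expR_ge0.
by rewrite lee_fin ler_expR !mulNr lerN2 ler_pM2l.
Qed.

Section laplace_W_mixture.
Context (R : realType) (K : nat) (k2 : 'I_K) (gamma : 'I_K -> R)
  (beta : 'I_K -> \bar R).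

(** gamma s / (1 + gamma s / beta) is beta s / (beta / gamma + s), hence weight beta and rate beta /
    gamma. Outside A the weight is 0 and the rate an arbitrary positive number. *)
Definition mixture_weight k : R :=
  if k \in index_A k2 gamma beta then fine (beta k) else 0.

Definition mixture_rate k : R :=
  if k \in index_A k2 gamma beta then fine (beta k) / gamma k else 1.

Definition mixture_drift : R := \sum_(k in index_S k2 gamma beta) gamma k.

Let beta_gt0 k : k \in index_A k2 gamma beta -> 0 < fine (beta k) /\ 0 < gamma k.
Proof. by rewrite inE => /and3P[_ g0 b]; rewrite fine_gt0. Qed.

Lemma mixture_weight_ge0 k : 0 <= mixture_weight k.
Proof. by rewrite /mixture_weight; case: ifP => // /beta_gt0[/ltW]. Qed.

Lemma mixture_rate_gt0 k : 0 < mixture_rate k.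
Proof. by rewrite /mixture_rate; case: ifP => // /beta_gt0[]; exact: divr_gt0. Qed.

Lemma mixture_drift_ge0 : 0 <= mixture_drift.
Proof. by apply: sumr_ge0 => k; rewrite inE => /and3P[_ /ltW]. Qed.

Lemma laplace_W_mixture s : 0 <= s ->
  laplace_W k2 gamma beta s =
  laplace_mixture mixture_weight mixture_rate mixture_drift s.
Proof.
move=> s0; congr (_ + _ + _)^-1; rewrite big_mkcond; apply: eq_bigr => k _.
rewrite /mixture_weight /mixture_rate; case: ifP => [/beta_gt0[b0 g0]|_]; last first.
  by rewrite !mul0r.
have h3 : fine (beta k) + gamma k * s != 0.
  by rewrite gt_eqF// ltr_wpDr// mulr_ge0// ltW.
by field; rewrite [s * _]mulrC h3 !gt_eqF.
Qed.

End laplace_W_mixture.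

Theorem theorem3p3 (R : realType) (K : nat) (L : 'I_K -> nat)
  (L_gt0 : forall k, (0 < L k)%N)
  (f : 'I_K -> R -> R)
  (f_ge0 : forall k (nu : R), 0 <= nu -> 0 <= f k nu)
  (f_mono : forall k (nu nu' : R), 0 <= nu -> nu <= nu' -> f k nu <= f k nu')
  (f_infty : forall k, f k nu @[nu --> +oo] --> +oo)
  (k1 k2 : 'I_K) (k1_neq_k2 : k1 != k2) (l1 : 'I_(L k1))
  (d : R -> measure_display) (T : forall nu : R, measurableType (d nu))
  (P : forall nu : R, probability (T nu) R)
  (X : forall nu : R, R -> T nu -> state L)
  (X_markov : forall nu : R, 0 <= nu ->
     markov_process (P nu) (rate (fun k => f k nu)) (X nu))
  (X_start : forall nu : R, 0 <= nu ->
     P nu [set w | X nu 0 w = active l1] = 1%E)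
  (gamma : 'I_K -> R)
  (gamma_lim : forall k : 'I_K, k != k2 ->
     f k nu ^+ L k / (\sum_(j | j != k2) f j nu ^+ L j) @[nu --> +oo]
       --> gamma k)
  (beta : 'I_K -> \bar R)
  (beta_lim : forall k : 'I_K, k != k2 -> 0 < gamma k ->
     ((L k)%:R * f k nu / ((L k2)%:R * f k2 nu))%:E @[nu --> +oo] --> beta k)
  (alpha : R)
  (alpha_lim :
     (mean_transition_time (P nu) (X nu) None /
      mean_transition_time (P nu) (X nu) (active (Ordinal (L_gt0 k2))))%E
       @[nu --> +oo] --> alpha%:E)
  (dZ : measure_display) (TZ : measurableType dZ) (PZ : probability TZ R)
  (Y W : {RV PZ >-> R})
  (Y_exp : forall A : set R, measurable A ->
     distribution PZ Y A = exponential_prob 1 A)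
  (W_laplace : forall s : R, 0 <= s ->
     ('E_PZ[fun w => expR (- s * W w)] = (laplace_W k2 gamma beta s)%:E)%E)
  (YW_indep : independent_RV Y W) :
  let Z w := alpha * Y w + (1 - alpha) * W w in
  (forall (omega : R) (t : R -> R), 0 <= omega ->
     0 < omega \/ PZ [set w | Z w = 0] = 0%E ->
     (forall nu : R, 0 <= nu -> 0 <= t nu) ->
     ((t nu)%:E /
      mean_transition_time (P nu) (X nu) (active (Ordinal (L_gt0 k2))))%E
       @[nu --> +oo] --> omega%:E ->
     exists2 l : \bar R,
       P nu [set w | throughput (X nu) k2 (t nu) w = 0%E] @[nu --> +oo] --> l &
       (PZ [set w | (omega <= Z w)%R] <= l)%E) /\
  (forall t : R -> R,
     PZ [set w | Z w = 0] = 0%E ->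
     (forall nu : R, 0 <= nu -> 0 <= t nu) ->
     ((t nu)%:E /
      mean_transition_time (P nu) (X nu) (active (Ordinal (L_gt0 k2))))%E
       @[nu --> +oo] --> 0%E ->
     P nu [set w | throughput (X nu) k2 (t nu) w = 0%E] @[nu --> +oo] --> 1%E).
Proof.
move=> Z.
pose m nu := level_mean (L k1) (f k1 nu) l1.+1.
pose M nu := idle_mean L (fun j => f j nu) k2 + m nu.
have nu0 : \forall nu \near pinfty_nbhs R, 0 <= nu by apply: nbhs_pinfty_ge; exact: num_real.
have f0 := near_f_gt0 f_infty.
have M0 : \forall nu \near +oo, 0 < M nu by exact: near_M_gt0.
have meanM : \forall nu \near +oo, mean_transition_time (P nu) (X nu)
    (active (Ordinal (L_gt0 k2))) = (M nu)%:E.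
  near=> nu; have n0 : 0 <= nu by near: nu.
  apply: (@mean_transition_time_switch _ _ _ L_gt0 _ _ _ _ _ _ _ _ _ k1_neq_k2
    (X_markov _ n0) (X_start _ n0)).
  by near: nu.
have ratioM (u : R -> \bar R) (l : R) (w : R -> R) :
    (u nu / mean_transition_time (P nu) (X nu) (active (Ordinal (L_gt0 k2))))%E
      @[nu --> +oo] --> l%:E ->
    (\forall nu \near +oo, u nu = (w nu)%:E) -> w nu / M nu @[nu --> +oo] --> l.
  move=> ul uw; have : ((w nu / M nu)%:E : \bar R) @[nu --> +oo] --> l%:E.
    apply: cvg_trans ul; apply: near_eq_cvg; near=> nu.
    have -> : u nu = (w nu)%:E by near: nu.
    rewrite (near meanM nu)// inver gt_eqF//.
    by near: nu.
  by move/fine_cvg.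
have alpha_lim' : m nu / M nu @[nu --> +oo] --> alpha.
  apply: (ratioM (fun nu => mean_transition_time (P nu) (X nu) None)) => //.
  near=> nu; have n0 : 0 <= nu by near: nu.
  apply: (mean_transition_time_None _ (X_markov _ n0) (X_start _ n0)).
  by near: nu.
have alpha01 : 0 <= alpha <= 1 := alpha_itv L_gt0 f_infty alpha_lim'.
have [a0 a1] := andP alpha01.
pose h := laplace_mixture (mixture_weight k2 gamma beta)
  (mixture_rate k2 gamma beta) (mixture_drift k2 gamma beta).
have W_h s : 0 <= s -> ('E_PZ[fun w => expR (- s * W w)] = (h s)%:E)%E.
  by move=> s0; rewrite W_laplace// laplace_W_mixture.
have h_le1 s : 0 <= s -> h s <= 1.
  apply: laplace_mixture_le1; [exact: mixture_weight_ge0|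
    exact: mixture_rate_gt0|exact: mixture_drift_ge0].
pose z := exp_mixture Y W alpha.
pose H nu w := hitting_time (X nu) (in_component k2) w.
pose x nu w := discount (M nu)^-1 (H nu w).
have moments n : \int[P nu]_w x nu w ^+ n @[nu --> +oo] --> \int[PZ]_w z w ^+ n.
  (* The moment of order 0 is 1 even where H is infinite, where [discount] is 0 at every order; it
     is treated apart. *)
  have [->|n0] := posnP n.
    rewrite [X in _ --> X](_ : _ = 1); last first.
      under eq_Rintegral do rewrite expr0.
      by rewrite Rintegral_cst// [P in fine P]probability_setT mulr1.
    apply: cvg_near_cst; apply: nearW => nu.
    under eq_Rintegral do rewrite expr0.
    by rewrite Rintegral_cst// [P in fine P]probability_setT mulr1.
  rewrite (exp_mixture_moment Y_exp YW_indep W_h h_le1 alpha01).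
  rewrite /h -laplace_W_mixture ?mulr_ge0 ?subr_ge0//.
  have xn : \forall nu \near +oo, \int[P nu]_w x nu w ^+ n =
      \int[P nu]_w discount (n%:R / M nu) (H nu w).
    by apply: nearW => nu; apply: eq_Rintegral => w _; rewrite /x discountX.
  apply: (cvg_trans (near_eq_cvg (filterS (fun nu => @esym _ _ _) xn))).
  pose bound (r : R -> 'I_K -> R) nu :=
    idle_laplace L (fun j => f j nu) k2 (n%:R / M nu) (r nu) *
    (1 - n%:R / M nu * m nu / (1 + n%:R / M nu * r nu k1)).
  pose low nu k := level_mean (L k) (f k nu) 1.
  pose high nu k := level_mean (L k) (f k nu) (L k).
  (* The limit does not depend on the level l from which the mean excursion is measured; it is
     applied to level 1 and to level L_k. *)
  have bound_lim (r : R -> 'I_K -> R) (l : 'I_K -> nat) :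
      (forall nu k, r nu k = level_mean (L k) (f k nu) (l k)) ->
      (forall k, (0 < l k <= L k)%N) ->
      bound r nu @[nu --> +oo] -->
      (1 + alpha * n%:R)^-1 * laplace_W k2 gamma beta ((1 - alpha) * n%:R).
    move=> rl l0; apply: (@cvg_laplace_bound _ _ _ L_gt0 _ f_infty _ _ _
      k1_neq_k2 _ gamma_lim _ beta_lim _ alpha_lim') => [k|].
      under eq_fun do rewrite rl; exact: cvg_level_mean_ratio.
    by apply: filterS f0 => nu fnu k; rewrite rl level_mean_ge0// ltW.
  apply: (@squeeze_cvgr _ _ _ _ (bound low) (bound high)).
  - near=> nu; have nu_ge0 : 0 <= nu by near: nu.
    have fnu : forall k, 0 < f k nu by near: nu.
    have s0 : 0 < n%:R / M nu by rewrite divr_gt0 ?ltr0n//; near: nu.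
    apply/andP; split.
      exact: (laplace_switch_ge L_gt0 (g := fun k => f k nu) fnu k1_neq_k2
        (X_markov nu nu_ge0) (X_start nu nu_ge0) s0).
    exact: (laplace_switch_le L_gt0 (g := fun k => f k nu) fnu k1_neq_k2
      (X_markov nu nu_ge0) (X_start nu nu_ge0) s0).
  - by apply: (bound_lim _ (fun=> 1%N)) => // k; rewrite L_gt0.
  - by apply: (bound_lim _ L) => // k; rewrite L_gt0 leqnn.
have mx : \forall nu \near +oo,
    measurable_fun setT (x nu) /\ forall w, 0 <= x nu w <= 1.
  near=> nu; have nu_ge0 : 0 <= nu by near: nu.
  have s0 : 0 < (M nu)^-1 by rewrite invr_gt0; near: nu.
  split; first exact: (measurable_discount (X_markov nu nu_ge0) _ s0).
  by move=> w; exact: discount_itv.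
have mz : measurable_fun setT z by exact: measurable_exp_mixture.
have z01 w : 0 <= z w <= 1 by exact: exp_mixture_itv.
(* The limit is identified as P(max(0, Z) >= omega), written with z; the inequality of the theorem
   is then an inclusion of events. *)
have main (omega : R) (t : R -> R) : 0 <= omega ->
    0 < omega \/ PZ [set w | Z w = 0] = 0%E ->
    (forall nu : R, 0 <= nu -> 0 <= t nu) ->
    ((t nu)%:E /
     mean_transition_time (P nu) (X nu) (active (Ordinal (L_gt0 k2))))%E
      @[nu --> +oo] --> omega%:E ->
    P nu [set w | throughput (X nu) k2 (t nu) w = 0%E] @[nu --> +oo] -->
    PZ [set w | (z w <= expR (- omega))%R].
  move=> o0 oZ t0 tM; have {}tM : t nu / M nu @[nu --> +oo] --> omega.
    by apply: (ratioM (fun nu => (t nu)%:E)) => //; exact: nearW.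
  pose a nu := expR (- (M nu)^-1 * t nu).
  have ev : \forall nu \near +oo,
      P nu [set w | throughput (X nu) k2 (t nu) w = 0%E] =
      (fine (P nu [set w | (x nu w <= a nu)%R]))%:E.
    near=> nu; have nu_ge0 : 0 <= nu by near: nu.
    have s0 : 0 < (M nu)^-1 by rewrite invr_gt0; near: nu.
    have [mxn _] : measurable_fun setT (x nu) /\ forall w, 0 <= x nu w <= 1.
      by near: nu.
    rewrite fineK; last by apply: fin_num_measure; exact: measurable_le_level.
    congr (P nu _); apply/seteqP; split=> w /=.
      move/(throughput_eq0 _ _ (X_markov nu nu_ge0) (t0 _ nu_ge0)).
      by move/(le_discount _ s0 (hitting_time_ge0 _ _ _)).
    move/(le_discount _ s0 (hitting_time_ge0 _ _ _)).
    by move/(throughput_eq0 _ _ (X_markov nu nu_ge0) (t0 _ nu_ge0)).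
  apply: (cvg_trans (near_eq_cvg (filterS (fun nu => @esym _ _ _) ev))).
  rewrite -[PZ _]fineK; last first.
    by apply: fin_num_measure; exact: measurable_le_level.
  apply: cvg_EFin; first exact: nearW.
  apply: (@cvg_moments_level _ _ _ _ _ _ P x _ _ PZ z a (expR (- omega))) => //.
  - by rewrite expR_gt0/= -expR0 ler_expR oppr_le0.
  (* For omega > 0 the level exp(-omega) is in (0, 1), where z has no atom; omega = 0 is the level
     1, where P(Z = 0) = 0 is used. *)
  - have [gt0|le0] := ltP 0 omega.
      apply: (exp_mixture_atomless Y_exp YW_indep _ _ _ W_h) => //.
      - exact: mixture_weight_ge0.
      - exact: mixture_rate_gt0.
      - exact: mixture_drift_ge0.
      - by rewrite expR_gt0/= expR_lt1 oppr_lt0.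
    have /le_anti <- : 0 <= omega <= 0 by rewrite o0.
    rewrite oppr0 expR0; case: oZ; first by rewrite ltNge le0.
    exact: (atom_exp_mixture1 Y_exp W_h h_le1 alpha01).
  - near=> nu; have nu_ge0 : 0 <= nu by near: nu.
    have s0 : 0 < (M nu)^-1 by rewrite invr_gt0; near: nu.
    rewrite expR_ge0/= -expR0 ler_expR mulNr oppr_le0.
    by rewrite mulr_ge0 ?t0// ltW.
  - have tN : - (M nu)^-1 * t nu @[nu --> +oo] --> - omega.
      by under eq_fun do rewrite mulNr mulrC; exact: cvgN.
    exact: (cvg_comp _ _ tN (@continuous_expR R (- omega))).
split=> [omega t o0 oZ t0 tM|t Z0 t0 tM].
  exists (PZ [set w | (z w <= expR (- omega))%R]); first exact: main.
  exact: le_level_exp_mixture.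
(* At omega = 0 the limit event {z <= 1} is the whole space. *)
have := main 0 t (lexx _) (or_intror Z0) t0 tM.
rewrite (_ : [set w | _] = setT) ?probability_setT//.
apply/seteqP; split=> // w _ /=; rewrite oppr0 expR0.
by case/andP: (z01 w).
Unshelve. all: by end_near. Qed.
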